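(* There exists an integer $n_0\ge1$ such that \[ \rho(\mathbf{H}^\varepsilon_{n_0})\le(1-\varepsilon^2)\,\rho(\mathbf{H})+o(\varepsilon^2),\qquad\text{as }\varepsilon\searrow0 . \] In particular, since each $\mathbf{H}^\varepsilon_{n_0}$ is a simply connected planar open set with finite inradius, $\mathbf{H}$ does not attain \[ C_{MH}=\inf\{\rho(\Omega):\Omega\subseteq\mathbb{R}^2\text{ open, simply connected, }r_\Omega<+\infty\}. \]
   Context: Hersch's pipe is $\mathbf{H}=\{(x_1,x_2):x_1^2+x_2^2<1,\ x_1<0\}\cup\{(x_1,x_2):0<|x_2|<1,\ x_1\ge0\}\subseteq\mathbb{R}^2$. For $n\ge1$, $0<\varepsilon<1/(2n)$ and $i=0,\dots,n$: $T^\varepsilon_i=(2+\tfrac in-\varepsilon,2+\tfrac in+\varepsilon)\times[1,2)$ and $\mathbf{H}^\varepsilon_n=\mathbf{H}\cup\bigcup_{i=0}^nT^\varepsilon_i$. For an open set $\Omega$, the inradius is $r_\Omega=\sup\{r>0:\exists x\in\Omega,\ B_r(x)\subseteq\Omega\}$, $\lambda_1(\Omega)=\inf\{\int_\Omega|\nabla\varphi|^2:\varphi\in W^{1,2}_0(\Omega),\|\varphi\|_{L^2(\Omega)}=1\}$, and $\rho(\Omega)=r_\Omega^2\,\lambda_1(\Omega)$. *)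

(* Defs.v *)
From HB Require Import structures.
From mathcomp Require Import all_boot all_order all_algebra.
From mathcomp Require Import all_classical all_reals all_analysis.
Import Order.TTheory GRing.Theory Num.Theory.
Import numFieldNormedType.Exports.
Local Open Scope ring_scope.
Local Open Scope classical_set_scope.

Set Implicit Arguments.
Unset Strict Implicit.
Unset Printing Implicit Defensive.

Section Defs.
Variable R : realType.
Implicit Types (Omega : set (R * R)).

(* Euclidean open disc B_r(x) in R^2 (the product norm on R*R is the max
   norm, so we write the Euclidean disc explicitly). *)
Definition eball (x : R * R) (r : R) : set (R * R) :=
  [set y | (y.1 - x.1) ^+ 2 + (y.2 - x.2) ^+ 2 < r ^+ 2].

Definition hersch : set (R * R) :=
  [set x | x.1 ^+ 2 + x.2 ^+ 2 < 1 /\ x.1 < 0] `|`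
  [set x | 0 < `|x.2| < 1 /\ 0 <= x.1].

Definition tooth (n i : nat) (eps : R) : set (R * R) :=
  [set x | 2 + i%:R / n%:R - eps < x.1 < 2 + i%:R / n%:R + eps /\
           1 <= x.2 < 2].

Definition hersch_teeth (n : nat) (eps : R) : set (R * R) :=
  hersch `|` \bigcup_(i in [set i : nat | (i <= n)%N]) tooth n i eps.

Definition inradius Omega : \bar R :=
  ereal_sup [set r%:E | r in [set r : R | 0 < r /\
                          exists x, eball x r `<=` Omega]].

Definition d1 (phi : R * R -> R) (x : R * R) : R := 'D_((1, 0) : R * R) phi x.
Definition d2 (phi : R * R -> R) (x : R * R) : R := 'D_((0, 1) : R * R) phi x.

Definition Cc1 Omega (phi : R * R -> R) : Prop :=
  (forall x, differentiable phi x) /\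
  continuous (d1 phi) /\ continuous (d2 phi) /\
  compact (closure [set x | phi x != 0]) /\
  closure [set x | phi x != 0] `<=` Omega.

Definition leb2 : set (R * R) -> \bar R :=
  (lebesgue_measure \x lebesgue_measure)%E.

(* First Dirichlet eigenvalue, as the infimum of the Dirichlet energy over
   L^2-normalised test functions (C_c^1(Omega) is dense in W_0^{1,2}(Omega)). *)
Definition lambda1 Omega : \bar R :=
  ereal_inf [set (\int[leb2]_x ((d1 phi x) ^+ 2 + (d2 phi x) ^+ 2)%:E)%E
            | phi in [set phi | Cc1 Omega phi /\
                      (\int[leb2]_x ((phi x) ^+ 2)%:E)%E = 1%E]].

Definition rho Omega : \bar R :=
  (inradius Omega * inradius Omega * lambda1 Omega)%E.

Definition path_in Omega (g : R -> R * R) : Prop :=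
  {within `[0, 1], continuous g} /\ g @` `[0, 1] `<=` Omega.

Definition simply_connected Omega : Prop :=
  Omega !=set0 /\
  (forall x y, Omega x -> Omega y ->
     exists g, path_in Omega g /\ g 0 = x /\ g 1 = y) /\
  (forall g, path_in Omega g -> g 0 = g 1 ->
     exists F : R * R -> R * R,
       {within `[0, 1] `*` `[0, 1], continuous F} /\
       F @` (`[0, 1] `*` `[0, 1]) `<=` Omega /\
       (forall s, F (s, 0) = g s) /\
       (forall s, F (s, 1) = g 0) /\
       (forall t, F (0, t) = g 0) /\
       (forall t, F (1, t) = g 0)).

Definition C_MH : \bar R :=
  ereal_inf [set rho Omega | Omega in [set Omega | open Omega /\
             simply_connected Omega /\ (inradius Omega < +oo)%E]].

End Defs.

(* Main.v *)
(** Write l for the first eigenvalue of the pipe H. A trial function gives l < pi^2, and since the strips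
    x1 >= 0 only carry Dirichlet energy at least pi^2 per unit mass, every nonnegative near-minimiser u
    keeps mass in the bend; a Harnack inequality (test with powers of r^2 - |x - q|^2 along a chain of
    discs) transports it to a fixed cell below the lid x2 = 1.

    For a tooth of width 2 e centred at p, let D be the difference of two harmonic poles just above the
    opening, weighted so that D <= 0 on the lid away from the opening. With theta convex and vanishing
    below 1, the function eta = e^2 theta(D), cut off inside the tooth, is subharmonic in H and of energy
    O(e^2), while testing near-minimality of u against eta gains at least c e^2 times the mass of u in the
    cell. The interaction of the correctors of N equally spaced teeth is negligible as e tends to 0, so the
    eigenvalue drops by at least c' N e^2. The teeth let the inradius grow only from 1/2 to at most
    (1 + e^2) / 2, hence for N large the drop wins. *)
Require Import Defs.
From HB Require Import structures.
From mathcomp Require Import all_boot all_order all_algebra.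
From mathcomp Require Import all_classical all_reals all_analysis.
From mathcomp Require Import measurable_realfun.
From mathcomp Require Import ring lra zify.
Import Order.TTheory GRing.Theory Num.Theory.
Import numFieldNormedType.Exports.
Local Open Scope ring_scope.
Local Open Scope classical_set_scope.
Set Implicit Arguments.
Unset Strict Implicit.
Unset Printing Implicit Defensive.

(** * Test functions and integration in the plane *)

(** No eigenfunction of the pipe is used: it would require compactness on an unbounded domain and
    control of a normal derivative at the lid. Everything is quantified over C^1 near-minimisers u
    with compact support in the pipe, and the lower bound for their mass in the cell must not depend
    on how good they are, because their defect is later taken below a multiple of e^2.
    Cauchy-Schwarz for the form energy - l mass replaces the eigenvalue equation, at the price of
    the square root of that defect. Compact support in the pipe also means that Green's formula has
    no boundary term on the lid: the gain of a corrector is l times its integral against u. With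
    amplitude t, N correctors yield a linear gain of order t N and a quadratic cost of order t^2 N /
    e^2, so t is a small multiple of e^2 and the drop is of order N e^2. The growth of the inradius
    does not see N, and this is why many teeth are needed and suffice. *)

Section Base.
Variable R : realType.
Implicit Types (f g : R * R -> R) (x : R * R).

Local Notation T2 := (measurableTypeR R * measurableTypeR R)%type.

(* The sigma-algebra that [leb2] carries on [R * R] is not convertible to that of
   [measurableTypeR R * measurableTypeR R], for which the Fubini theorems apply. *)
Definition leb : {measure set T2 -> \bar R} := (lebesgue_measure \x lebesgue_measure)%E.

Lemma integral_leb2 (f : R * R -> \bar R) : measurable_fun (setT : set T2) f -> (forall x, 0 <= f x)%E ->
  (\int[@leb2 R]_x f x = \int[leb]_x f x)%E.
Proof.
move=> mf f0.
have mid : measurable_fun (setT : set T2) (id : T2 -> (R * R)%type) by [].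
exact: (ge0_integral_pushforward mid leb measurableT).
Qed.


(** An open set is the countable union of the boxes with rational corners that it contains; the
    conditional under the union discards all other boxes. *)
Lemma open_measurable_prod (U : set (R * R)) : open U -> measurable (U : set T2).
Proof.
move=> oU.
have -> : U = \bigcup_a \bigcup_b \bigcup_c \bigcup_d
   (if `[< `]ratr a, ratr b[ `*` `]ratr c, ratr d[ `<=` U >] then
     (`]ratr a, ratr b[ `*` `]ratr c, ratr d[ : set (R * R)) else set0).
  apply/seteqP; split=> [x Ux|x [a _ [b _ [c _ [d _]]]]]; last first.
    by case: asboolP => // + xb; apply.
  have /nbhs_ballP[e /= e0 eU] : nbhs x U by exact: open_nbhs_nbhs.
  have [a /= ha] := @rat_in_itvoo R (x.1 - e) x.1 ltac:(by rewrite gtrBl).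
  have [b /= hb] := @rat_in_itvoo R x.1 (x.1 + e) ltac:(by rewrite ltrDl).
  have [c /= hc] := @rat_in_itvoo R (x.2 - e) x.2 ltac:(by rewrite gtrBl).
  have [d /= hd] := @rat_in_itvoo R x.2 (x.2 + e) ltac:(by rewrite ltrDl).
  move: ha hb hc hd; rewrite !in_itv /= => /andP[a1 a2] /andP[b1 b2] /andP[c1 c2] /andP[d1 d2].
  exists a => //; exists b => //; exists c => //; exists d => //.
  case: asboolP => [_|]; first by split; rewrite /= in_itv /=; apply/andP.
  move=> nU; exfalso; apply: nU => y [/= ]; rewrite !in_itv /= => /andP[y1 y2] /andP[y3 y4].
  apply: eU; split; rewrite /ball /= ltr_distl; apply/andP; split; lra.
do 4 (apply: bigcupT_measurable_rat => ?).
by case: asboolP => // _; apply: measurableX; exact: measurable_itv.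
Qed.

Lemma cont_meas2 f : continuous f -> measurable_fun (setT : set T2) f.
Proof.
move=> cf; apply: (measurability _ (@measurable_realfun.RGenOpens.measurableE R)).
move=> _ [_ [a [b ->]] <-]; rewrite setTI.
by apply: open_measurable_prod; move/continuousP: cf; apply; exact: interval_open.
Qed.

(** One constant serves as bound and as half-width of a square off which f vanishes. The class is
    stable under sums and products and its members are integrable, so [int2] is linear on it without
    side conditions. *)
Definition Bc f := measurable_fun (setT : set T2) f /\
  exists M, forall x, `|f x| <= M /\ (M < `|x.1| \/ M < `|x.2| -> f x = 0).

Definition int2 f : R := \int[leb]_x f x.

Definition bx (M : R) : set (R * R) := (`[- M, M] : set (measurableTypeR R)) `*` (`[-M, M] : set (measurableTypeR R)).

Lemma bx_meas M : measurable (bx M : set T2).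
Proof. by apply: measurableX; exact: measurable_itv. Qed.

Lemma bx_fin M : (leb (bx M) < +oo)%E.
Proof.
have -> : leb (bx M) = (lebesgue_measure (`[(- M)%R, M]%classic : set R) * lebesgue_measure (`[(- M)%R, M]%classic : set R))%E.
  have m1 := @measurable_itv R `[(- M), M]%R.
  exact: (@product_measure1E _ _ (measurableTypeR R) (measurableTypeR R) R lebesgue_measure lebesgue_measure _ _ m1 m1).
rewrite lebesgue_measure_itv /= lte_fin; case: ifPn => _; last by rewrite mule0 ltry.
by rewrite -EFinD -EFinM ltry.
Qed.

Lemma Bc_integrable f : Bc f -> leb.-integrable setT (EFin \o f).
Proof.
move=> [mf [M hM]].
have h : leb.-integrable (bx M) (EFin \o f).
  apply: measurable_bounded_integrable; [exact: bx_meas|exact: bx_fin|exact: measurable_funTS|].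
  exists M; split; first exact: num_real.
  by move=> K MK x _ /=; apply: le_trans (ltW MK); case: (hM x).
have := (@integrable_mkcond _ T2 R leb (bx M) (EFin \o f) (bx_meas M)).1 h.
congr (leb.-integrable _ _); apply/funext => x /=; rewrite patchE; case: ifPn => // /negP h1 /=.
rewrite (hM x).2 //; apply: contrapT => /not_orP[/negP h2 /negP h3]; apply: h1.
by rewrite inE; split; rewrite /= in_itv /= -ler_norml leNgt.
Qed.

Lemma Bc_meas f : Bc f -> measurable_fun (setT : set T2) f. Proof. by case. Qed.

Lemma BcD f g : Bc f -> Bc g -> Bc (fun x => f x + g x).
Proof.
move=> [mf [M hM]] [mg [N hN]]; split; first exact: measurable_funD.
have M0 : 0 <= M by apply: le_trans (hM (0,0)).1.
have N0 : 0 <= N by apply: le_trans (hN (0,0)).1.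
exists (M + N) => x; split.
  by apply: le_trans (ler_normD _ _) _; apply: lerD; [case: (hM x)|case: (hN x)].
move=> h; rewrite (hM x).2 ?(hN x).2 ?addr0 //.
  by case: h => h; [left|right]; apply: le_lt_trans h; rewrite lerDr.
by case: h => h; [left|right]; apply: le_lt_trans h; rewrite lerDl.
Qed.

Lemma BcM f g : Bc f -> Bc g -> Bc (fun x => f x * g x).
Proof.
move=> [mf [M hM]] [mg [N hN]]; split; first exact: measurable_funM.
have M0 : 0 <= M by apply: le_trans (hM (0,0)).1.
have N0 : 0 <= N by apply: le_trans (hN (0,0)).1.
exists (M * N + M) => x; split.
  rewrite normrM; apply: le_trans (_ : M * N <= _); last by rewrite lerDl.
  by apply: ler_pM => //; [case: (hM x)|case: (hN x)].
move=> h; rewrite (hM x).2 ?mul0r //.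
by case: h => h; [left|right]; apply: le_lt_trans h; rewrite lerDr mulr_ge0.
Qed.

Lemma BcMl f g : measurable_fun (setT : set T2) g -> (forall M, exists K, forall x, `|x.1| <= M -> `|x.2| <= M -> `|g x| <= K) ->
  Bc f -> Bc (fun x => g x * f x).
Proof.
move=> mg bg [mf [M hM]]; split; first exact: measurable_funM.
have M0 : 0 <= M by apply: le_trans (hM (0,0)).1.
have [K hK] := bg M.
have K0 : 0 <= K by apply: le_trans (hK (0,0) _ _); rewrite //= normr0.
exists (K * M + M) => x; split.
  have [h|h] := pselect (M < `|x.1| \/ M < `|x.2|).
    by rewrite (hM x).2 // mulr0 normr0 addr_ge0 // mulr_ge0.
  move/not_orP : h => -[/negP + /negP]; rewrite -!leNgt => h1 h2.
  rewrite normrM; apply: le_trans (_ : K * M <= _); last by rewrite lerDl.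
  by apply: ler_pM => //; [exact: hK|case: (hM x)].
move=> h; rewrite (hM x).2 ?mulr0 //.
by case: h => h; [left|right]; apply: le_lt_trans h; rewrite lerDr mulr_ge0.
Qed.

Lemma BcZ c f : Bc f -> Bc (fun x => c * f x).
Proof. by apply: BcMl => //; move=> M; exists `|c|. Qed.

Lemma BcN f : Bc f -> Bc (fun x => - f x).
Proof. by move=> /(BcZ (-1)); congr Bc; apply/funext => x; rewrite mulN1r. Qed.

Lemma BcB f g : Bc f -> Bc g -> Bc (fun x => f x - g x).
Proof. by move=> hf hg; apply: BcD => //; exact: BcN. Qed.

Lemma Bc0 : Bc (fun=> 0).
Proof. by split => //; exists 0 => x; rewrite normr0. Qed.

Lemma Bc_abs f : Bc f -> Bc (fun x => `|f x|).
Proof.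
move=> [mf [M hM]]; split; first exact: measurableT_comp.
exists M => x; rewrite normr_id; split; first by case: (hM x).
by move=> h; rewrite (hM x).2 // normr0.
Qed.

Lemma Bc_sum (T : eqType) (s : seq T) (F : T -> R * R -> R) :
  (forall i, i \in s -> Bc (F i)) -> Bc (fun x => \sum_(i <- s) F i x).
Proof.
elim: s => [_|a s IH h].
  by under [X in Bc X]eq_fun do rewrite big_nil; exact: Bc0.
under [X in Bc X]eq_fun do rewrite big_cons.
apply: BcD; first by apply: h; rewrite mem_head.
by apply: IH => i hi; apply: h; rewrite in_cons hi orbT.
Qed.

Lemma Bc_indic (A : set T2) f : measurable A -> Bc f -> Bc (fun x => \1_A x * f x).
Proof.
move=> mA; apply: BcMl; first exact: measurable_indic.
by move=> M; exists 1 => x _ _; rewrite indicE; case: (_ \in _) => /=; rewrite ?normr1 ?normr0.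
Qed.

Lemma int2_D f g : Bc f -> Bc g -> int2 (fun x => f x + g x) = int2 f + int2 g.
Proof.
move=> hf hg; have i1 := Bc_integrable hf; have i2 := Bc_integrable hg.
exact: (RintegralD measurableT i1 i2).
Qed.

Lemma int2_Z c f : Bc f -> int2 (fun x => c * f x) = c * int2 f.
Proof. by move=> /Bc_integrable i1; exact: (@RintegralZl _ T2 R leb setT f c measurableT i1). Qed.

Lemma int2_N f : Bc f -> int2 (fun x => - f x) = - int2 f.
Proof. by move=> /(int2_Z (-1)); rewrite mulN1r => <-; congr int2; apply/funext => x; rewrite mulN1r. Qed.

Lemma int2_B f g : Bc f -> Bc g -> int2 (fun x => f x - g x) = int2 f - int2 g.
Proof. by move=> hf hg; rewrite int2_D ?int2_N //; exact: BcN. Qed.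

Lemma int2_le f g : Bc f -> Bc g -> (forall x, f x <= g x) -> int2 f <= int2 g.
Proof. by move=> /Bc_integrable i1 /Bc_integrable i2 h; exact: (le_Rintegral measurableT i1 i2). Qed.

Lemma int2_ge0 f : (forall x, 0 <= f x) -> 0 <= int2 f.
Proof. by move=> h; apply: Rintegral_ge0. Qed.

Lemma int2_0 : int2 (fun=> 0) = 0.
Proof. transitivity (int2 (fun x => 0 * (fun=> 0 : R) x)); last by rewrite int2_Z ?mul0r //; exact: Bc0.
by congr int2; apply/funext => x; rewrite mul0r. Qed.

Lemma int2_sum (T : eqType) (s : seq T) (F : T -> R * R -> R) :
  (forall i, i \in s -> Bc (F i)) -> int2 (fun x => \sum_(i <- s) F i x) = \sum_(i <- s) int2 (F i).
Proof.
elim: s => [_|a s IH h].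
  by under [X in int2 X]eq_fun do rewrite big_nil; rewrite big_nil int2_0.
under [X in int2 X]eq_fun do rewrite big_cons.
have h' : forall i, i \in s -> Bc (F i) by move=> i hi; apply: h; rewrite in_cons hi orbT.
rewrite big_cons int2_D ?IH //; first by apply: h; rewrite mem_head.
exact: Bc_sum.
Qed.

Lemma EFin_int2 f : Bc f -> (\int[leb]_x (f x)%:E)%E = (int2 f)%:E.
Proof.
move=> hf; rewrite /int2 /Rintegral fineK //.
exact: (integrable_fin_num measurableT (Bc_integrable hf)).
Qed.

Lemma int2_fubini1 f : Bc f -> (int2 f)%:E = (\int[lebesgue_measure]_a \int[lebesgue_measure]_b (f (a, b))%:E)%E.
Proof.
move=> hf; rewrite -EFin_int2 //.
exact: (esym (integral12_prod_meas1 (Bc_integrable hf))).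
Qed.

Lemma int2_fubini2 f : Bc f -> (int2 f)%:E = (\int[lebesgue_measure]_b \int[lebesgue_measure]_a (f (a, b))%:E)%E.
Proof.
move=> hf; rewrite -EFin_int2 //.
exact: (esym (integral21_prod_meas1 (Bc_integrable hf))).
Qed.

(** Signs and zeros of plane integrals are proved line by line, which reduces them to one-variable
    calculus. *)
Lemma int2_ge0_slice2 f : Bc f -> (forall a, 0 <= \int[lebesgue_measure]_b (f (a, b))%:E)%E -> 0 <= int2 f.
Proof. by move=> hf h; rewrite -lee_fin int2_fubini1 //; apply: integral_ge0. Qed.

Lemma int2_eq0_slice2 f : Bc f -> (forall a, \int[lebesgue_measure]_b (f (a, b))%:E = 0)%E -> int2 f = 0.
Proof. by move=> hf h; apply: EFin_inj; rewrite int2_fubini1 //; apply: integral0_eq. Qed.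

Lemma int2_eq0_slice1 f : Bc f -> (forall b, \int[lebesgue_measure]_a (f (a, b))%:E = 0)%E -> int2 f = 0.
Proof. by move=> hf h; apply: EFin_inj; rewrite int2_fubini2 //; apply: integral0_eq. Qed.

End Base.

(** * One-variable calculus, partial derivatives and compact supports *)

Section Calc.
Variable R : realType.
Implicit Types (f g : R * R -> R).

(** The rules below produce a derivative in raw form; this step replaces its value by the wanted
    expression, up to a ring or field identity. *)
Lemma dv_eq (F : R -> R) (x a b : R) : is_derive x 1 F a -> a = b -> is_derive x 1 F b.
Proof. by move=> h <-. Qed.

Lemma dvD (F G : R -> R) (x a b : R) : is_derive x 1 F a -> is_derive x 1 G b ->
  is_derive x 1 (fun t => F t + G t) (a + b).
Proof. by move=> h1 h2; exact: is_deriveD. Qed.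

Lemma dvB (F G : R -> R) (x a b : R) : is_derive x 1 F a -> is_derive x 1 G b ->
  is_derive x 1 (fun t => F t - G t) (a - b).
Proof. by move=> h1 h2; exact: is_deriveB. Qed.

Lemma dvN (F : R -> R) (x a : R) : is_derive x 1 F a -> is_derive x 1 (fun t => - F t) (- a).
Proof. by move=> h1; exact: is_deriveN. Qed.

Lemma dvM (F G : R -> R) (x a b : R) : is_derive x 1 F a -> is_derive x 1 G b ->
  is_derive x 1 (fun t => F t * G t) (a * G x + F x * b).
Proof.
move=> h1 h2; apply: (dv_eq (is_deriveM h1 h2)).
by rewrite /GRing.scale /=; ring.
Qed.

Lemma dvC (c x : R) : is_derive x 1 (fun _ : R => c : R) 0.
Proof. exact: is_derive_cst. Qed.

Lemma dvZ (c : R) (F : R -> R) (x a : R) : is_derive x 1 F a -> is_derive x 1 (fun t => c * F t) (c * a).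
Proof. by move=> h; apply: (dv_eq (dvM (dvC c x) h)); rewrite mul0r add0r. Qed.

Lemma dv_id (x : R) : is_derive x 1 (fun t : R => t) 1.
Proof. exact: is_derive_id. Qed.

Lemma dvX n (F : R -> R) (x a : R) : is_derive x 1 F a ->
  is_derive x 1 (fun t => F t ^+ n) (n%:R * F x ^+ n.-1 * a).
Proof. move=> h; elim: n => [|n IH].
  by rewrite mul0r mul0r; under eq_fun do rewrite expr0; exact: dvC.
under eq_fun do rewrite exprS.
apply: (dv_eq (dvM h IH)); case: n {IH} => [|n]; first by rewrite /= !expr0; ring.
by rewrite /= -[n.+2%:R]natr1 !exprS; ring. Qed.

Lemma dvV (F : R -> R) (x a : R) : is_derive x 1 F a -> F x != 0 ->
  is_derive x 1 (fun t => (F t)^-1) (- (a / F x ^+ 2)).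
Proof. by move=> h h0; apply: (dv_eq (is_deriveV h0 h)); rewrite /GRing.scale /= mulNr mulrC. Qed.

Lemma dv_div (F G : R -> R) (x a b : R) : is_derive x 1 F a -> is_derive x 1 G b -> G x != 0 ->
  is_derive x 1 (fun t => F t / G t) ((a * G x - F x * b) / G x ^+ 2).
Proof.
by move=> h1 h2 h0; apply: (dv_eq (dvM h1 (dvV h2 h0))); field.
Qed.

Lemma dv_comp (F G : R -> R) (x a b : R) : is_derive (G x) 1 F a -> is_derive x 1 G b ->
  is_derive x 1 (fun t => F (G t)) (a * b).
Proof. exact: is_derive1_comp. Qed.

Lemma dv_near (F G : R -> R) (x a : R) : (\near x, F x = G x) -> is_derive x 1 F a -> is_derive x 1 G a.
Proof. exact: near_eq_is_derive. Qed.

Lemma dv_uniq (F : R -> R) (x a b : R) : is_derive x 1 F a -> is_derive x 1 F b -> a = b.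
Proof. by move=> [_ <-] [_ <-]. Qed.

Lemma dv_continuous (F : R -> R) (x : R) a : is_derive x 1 F a -> {for x, continuous F}.
Proof. by move=> [d _]; apply: differentiable_continuous; apply/derivable1_diffP. Qed.

Lemma MVT_any (F dF : R -> R) (a b : R) : (forall t : R, is_derive t 1 F (dF t)) ->
  exists c, `|c - a| <= `|b - a| /\ F b - F a = dF c * (b - a).
Proof.
move=> hF; have cF : continuous F by move=> t; exact: (dv_continuous (hF t)).
have [ab|ba] := leP a b.
  have [c] := MVT_segment ab (fun t _ => hF t) (continuous_subspaceT cF).
  rewrite in_itv /= => /andP[ac cb] E; exists c; split => //.
  by rewrite !ger0_norm ?subr_ge0 //; lra.
have [c] := MVT_segment (ltW ba) (fun t _ => hF t) (continuous_subspaceT cF).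
rewrite in_itv /= => /andP[ac cb] E; exists c; split => //.
  by rewrite !ler0_norm ?subr_le0 //; lra.
by rewrite -[LHS]opprB E; ring.
Qed.

(** Partial derivatives are taken on slices, so that the one-variable rules apply to them
    directly. *)
Definition pd1 f (x : R * R) a := is_derive x.1 1 (fun t => f (t, x.2)) a.
Definition pd2 f (x : R * R) a := is_derive x.2 1 (fun t => f (x.1, t)) a.

Definition lin2 (a b : R) (h : R * R) : R := a * h.1 + b * h.2.

Lemma lin2_is_linear a b : linear (lin2 a b).
Proof. by move=> k u v; rewrite /lin2 /= /GRing.scale /=; ring. Qed.

HB.instance Definition _ a b :=
  GRing.isLinear.Build R (R * R)%type R *:%R (lin2 a b) (@lin2_is_linear a b).

Lemma lin2_continuous a b : continuous (lin2 a b).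
Proof.
move=> x; rewrite /lin2; apply: cvgD; apply: cvgM; do ?exact: cvg_cst.
  exact: cvg_fst. exact: cvg_snd.
Qed.

(** The increment is a step in x1 at the new height followed back by a step in x2 on the vertical
    line of [x]; the mean value theorem turns each into a partial at a nearby point, and continuity
    of the partials at [x] finishes. *)
Lemma partial_diff f f1 f2 (x : R * R) : (forall y, pd1 f y (f1 y)) -> (forall y, pd2 f y (f2 y)) ->
  {for x, continuous f1} -> {for x, continuous f2} ->
  forall e, 0 < e -> \forall h \near (0 : R * R), `|f (h + x) - (f x + lin2 (f1 x) (f2 x) h)| <= e * `|h|.
Proof.
move=> h1 h2 c1 c2 e e0.
have e2 : 0 < e / 2 by rewrite divr_gt0.
move: c1 => /cvgrPdist_lt /(_ _ e2) /nbhs_ballP[d1 /= d10 H1].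
move: c2 => /cvgrPdist_lt /(_ _ e2) /nbhs_ballP[d2 /= d20 H2].
apply/nbhs_ballP; exists (Num.min d1 d2) => /=; first by rewrite lt_min d10.
move=> h [/=]; rewrite /ball /= !sub0r !normrN !lt_min => /andP[ha hb] /andP[hc hd].
rewrite /lin2.
have [c [cb Ec]] := @MVT_any (fun t => f (t, h.2 + x.2)) (fun t => f1 (t, h.2 + x.2)) x.1 (h.1 + x.1) (fun t => h1 (t, h.2 + x.2)).
have [k [kb Ek]] := @MVT_any (fun t => f (x.1, t)) (fun t => f2 (x.1, t)) x.2 (h.2 + x.2) (fun t => h2 (x.1, t)).
move: Ec Ek cb kb => /=; rewrite !addrK => Ec Ek cb kb.
have -> : f (h + x) - (f x + (f1 x * h.1 + f2 x * h.2)) =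
   (f1 (c, h.2 + x.2) - f1 x) * h.1 + (f2 (x.1, k) - f2 x) * h.2.
  rewrite !mulrBl -Ec -Ek; have -> : h + x = (h.1 + x.1, h.2 + x.2) by [].
  have -> : f x = f (x.1, x.2) by case: (x).
  ring.
have B1 : `|f1 (c, h.2 + x.2) - f1 x| <= e / 2.
  rewrite distrC; apply/ltW/H1; split => /=; rewrite /ball /= distrC ?addrK //.
  exact: le_lt_trans cb _.
have B2 : `|f2 (x.1, k) - f2 x| <= e / 2.
  rewrite distrC; apply/ltW/H2; split => /=; rewrite /ball /= distrC ?subrr ?normr0 //.
  exact: le_lt_trans kb _.
have n1 : `|h.1| <= `|h| by rewrite [X in _ <= X]/Num.norm /= le_max lexx.
have n2 : `|h.2| <= `|h| by rewrite [X in _ <= X]/Num.norm /= le_max lexx orbT.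
apply: le_trans (ler_normD _ _) _; rewrite !normrM.
by rewrite [X in _ <= X * _](splitr e) mulrDl; apply: lerD; apply: ler_pM.
Qed.

Lemma partial_differentiable f f1 f2 (x : R * R) : (forall y, pd1 f y (f1 y)) -> (forall y, pd2 f y (f2 y)) ->
  {for x, continuous f1} -> {for x, continuous f2} ->
  [/\ differentiable f x, d1 f x = f1 x & d2 f x = f2 x].
Proof.
move=> h1 h2 c1 c2.
have H : f \o shift x = cst (f x) + lin2 (f1 x) (f2 x) +o_ (0 : R * R) id.
  by apply/eqaddoE/eqaddoP => e e0; exact: partial_diff.
have Ed := diff_unique (@lin2_continuous (f1 x) (f2 x)) H.
have df : differentiable f x.
  by apply/diff_locallyP; rewrite Ed; split => //; exact: lin2_continuous.
split => //.
  by rewrite /d1 deriveE // Ed /= /lin2 mulr1 mulr0 addr0.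
by rewrite /d2 deriveE // Ed /= /lin2 mulr1 mulr0 add0r.
Qed.

Lemma pd1_d1 f (x : R * R) : differentiable f x -> pd1 f x (d1 f x).
Proof.
move=> df; have h := @diff_derivable _ _ _ f x (1, 0) df.
have E : (fun h : R => h^-1 *: ((f \o shift x) (h *: ((1, 0) : R * R)) - f x)) =
  (fun h : R => h^-1 *: (((fun t => f (t, x.2)) \o shift x.1) (h *: (1 : R)) - f (x.1, x.2))).
  apply/funext => k; rewrite /shift /=; congr (_ *: (f _ - f _)); last by case: (x).
  by congr pair; rewrite /= /GRing.scale /= mulr0 add0r.
apply: DeriveDef.
  by move: h; rewrite /derivable E.
by rewrite /d1 /derive E.
Qed.

Lemma pd2_d2 f (x : R * R) : differentiable f x -> pd2 f x (d2 f x).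
Proof.
move=> df; have h := @diff_derivable _ _ _ f x (0, 1) df.
have E : (fun h : R => h^-1 *: ((f \o shift x) (h *: ((0, 1) : R * R)) - f x)) =
  (fun h : R => h^-1 *: (((fun t => f (x.1, t)) \o shift x.2) (h *: (1 : R)) - f (x.1, x.2))).
  apply/funext => k; rewrite /shift /=; congr (_ *: (f _ - f _)); last by case: (x).
  by congr pair; rewrite /= /GRing.scale /= mulr0 add0r.
apply: DeriveDef.
  by move: h; rewrite /derivable E.
by rewrite /d2 /derive E.
Qed.

(** Any compact set carrying f is allowed, not only the closure of the nonzero set. The two notions
    agree by [supp_inP], and this one passes to products and derivatives with the same witness. *)
Definition supp_in (A : set (R * R)) f := exists K, [/\ compact K, K `<=` A & forall x, ~ K x -> f x = 0].

Lemma Hausdorff_plane : hausdorff_space (R * R)%type.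
Proof. exact: norm_hausdorff. Qed.

Lemma supp_inP A f : supp_in A f <->
  compact (closure [set x | f x != 0]) /\ closure [set x | f x != 0] `<=` A.
Proof.
split=> [[K [cK KA K0]]|[cK KA]].
  have clK : closed K by apply: compact_closed => //; exact: Hausdorff_plane.
  have sub : closure [set x | f x != 0] `<=` K.
    rewrite [X in _ `<=` X]((closure_id K).1 clK); apply: closure_subset => x /= /eqP fx.
    by apply: contrapT => /K0.
  split; last exact: subset_trans sub KA.
  by apply: subclosed_compact cK sub; exact: closed_closure.
exists (closure [set x | f x != 0]); split => // x nx.
by apply: contrapT => /eqP fx; apply: nx; exact: subset_closure.
Qed.

Lemma supp_in_sub A B f : A `<=` B -> supp_in A f -> supp_in B f.
Proof. by move=> AB [K [cK KA K0]]; exists K; split => //; exact: subset_trans AB. Qed.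

Lemma supp_in_0 A f g : (forall x, f x = 0 -> g x = 0) -> supp_in A f -> supp_in A g.
Proof. by move=> h [K [cK KA K0]]; exists K; split => // x /K0; exact: h. Qed.

Lemma supp_inD A f g h : (forall x, f x = 0 -> g x = 0 -> h x = 0) -> supp_in A f -> supp_in A g ->
  supp_in A h.
Proof.
move=> H [K [cK KA K0]] [L [cL LA L0]]; exists (K `|` L); split.
- exact: compactU.
- by move=> x [/KA|/LA].
- by move=> x /not_orP[/K0 h1 /L0 h2]; exact: H.
Qed.

Lemma supp_in_near A f (x : R * R) : supp_in A f -> ~ A x -> \forall y \near x, f y = 0.
Proof.
move=> [K [cK KA K0]] nA.
have clK : closed K by apply: compact_closed => //; exact: Hausdorff_plane.
have : open (~` K) by exact: closed_openC.
rewrite openE => /(_ x) /= H; have := H (fun h => nA (KA _ h)).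
by apply: filterS => y; exact: K0.
Qed.

Lemma compact_box (M : R) : compact (`[- M, M] `*` `[- M, M] : set (R * R)).
Proof. by apply: compact_setX; exact: segment_compact. Qed.

Lemma cont_supp_bounded A f : continuous f -> supp_in A f ->
  exists2 M, 0 <= M & forall x, `|f x| <= M /\ (M < `|x.1| \/ M < `|x.2| -> f x = 0).
Proof.
move=> cf [K [cK KA K0]].
have [M1 [_ hM1]] := compact_bounded cK.
have /compact_bounded[M2 [_ hM2]] : compact (f @` K).
  by apply: continuous_compact => //; apply: continuous_subspaceT.
pose M := Num.max 0 (Num.max (M1 + 1) (M2 + 1)).
have HM1 : M1 < M by rewrite lt_max; apply/orP; right; rewrite lt_max ltrDl ltr01.
have HM2 : M2 < M by rewrite lt_max; apply/orP; right; rewrite lt_max ltrDl ltr01 orbT.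
exists M; first by rewrite le_max lexx.
move=> x; have [Kx|nKx] := pselect (K x); last first.
  by rewrite K0 // normr0; split => //; rewrite le_max lexx.
split.
  by apply: (hM2 M HM2); exists x.
have h12 : `|x| <= M := hM1 M HM1 x Kx.
have h1 : `|x.1| <= M by apply: le_trans h12; rewrite /Num.norm /= le_max lexx.
have h2 : `|x.2| <= M by apply: le_trans h12; rewrite /Num.norm /= le_max lexx orbT.
by move=> [|]; rewrite ltNge ?h1 ?h2.
Qed.

Lemma Bc_cont A f : continuous f -> supp_in A f -> Bc f.
Proof.
move=> cf sf; split; first exact: cont_meas2.
by have [M _ hM] := cont_supp_bounded cf sf; exists M.
Qed.

Lemma pd1_supp A f f1 : (forall x, pd1 f x (f1 x)) -> supp_in A f -> supp_in A f1.
Proof.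
move=> h [K [cK KA K0]]; exists K; split => // x nK.
have clK : closed K by apply: compact_closed => //; exact: Hausdorff_plane.
have oK : open (~` K) by exact: closed_openC.
have /nbhs_ballP[e /= e0 eK] : nbhs x (~` K) by exact: open_nbhs_nbhs.
apply: (dv_uniq (h x)); apply: dv_near (dvC 0 x.1).
apply/nbhs_ballP; exists e => //= t xt; apply/esym/K0/eK; split => //=; exact: ballxx.
Qed.

Lemma pd2_supp A f f2 : (forall x, pd2 f x (f2 x)) -> supp_in A f -> supp_in A f2.
Proof.
move=> h [K [cK KA K0]]; exists K; split => // x nK.
have clK : closed K by apply: compact_closed => //; exact: Hausdorff_plane.
have oK : open (~` K) by exact: closed_openC.
have /nbhs_ballP[e /= e0 eK] : nbhs x (~` K) by exact: open_nbhs_nbhs.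
apply: (dv_uniq (h x)); apply: dv_near (dvC 0 x.2).
apply/nbhs_ballP; exists e => //= t xt; apply/esym/K0/eK; split => //=; exact: ballxx.
Qed.

Lemma cont_slice1 f (b : R) : continuous f -> continuous (fun t => f (t, b)).
Proof.
move=> cf t; apply: (@continuous_comp _ _ _ (fun t => (t, b)) f); last exact: cf.
exact: (@cvg_pair _ _ _ (nbhs t) (nbhs t) (nbhs b) _ _ _ (fun t : R => t) (fun=> b) cvg_id (cvg_cst _)).
Qed.

Lemma cont_slice2 f (a : R) : continuous f -> continuous (fun t => f (a, t)).
Proof.
move=> cf t; apply: (@continuous_comp _ _ _ (fun t => (a, t)) f); last exact: cf.
exact: (@cvg_pair _ _ _ (nbhs t) (nbhs a) (nbhs t) _ _ _ (fun=> a) (fun t : R => t) (cvg_cst _) cvg_id).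
Qed.

Lemma dv_zero_out (F dF : R -> R) (M : R) : (forall t : R, is_derive t 1 F (dF t)) ->
  (forall t, M < `|t| -> F t = 0) -> forall t, M < `|t| -> dF t = 0.
Proof.
move=> hF F0 t Mt; apply: (dv_uniq (hF t)); apply: dv_near (dvC 0 t).
have /cvgrPdist_lt : {for t, continuous (fun t : R => `|t|)} by exact: norm_continuous.
move=> /(_ (`|t| - M)); rewrite subr_gt0 => /(_ Mt).
apply: filterS => y hy; apply/esym/F0.
have := ler_norm (`|t| - `|y|); lra.
Qed.

Lemma int_segment_derive (F dF : R -> R) (a b : R) : a < b -> (forall t : R, is_derive t 1 F (dF t)) -> continuous dF ->
  (\int[lebesgue_measure]_(t in `[a, b]) (dF t)%:E = (F b - F a)%:E)%E.
Proof.
move=> ab hF cF; rewrite EFinB; apply: continuous_FTC2 => //.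
- exact: continuous_subspaceT.
- have cc t := dv_continuous (hF t); split.
  + by move=> t _; case: (hF t).
  + by apply: cvg_at_right_filter; exact: cc.
  + by apply: cvg_at_left_filter; exact: cc.
- by move=> t _; rewrite derive1E; case: (hF t).
Qed.

Lemma int_derive_eq0 (F dF : R -> R) (M : R) : (forall t : R, is_derive t 1 F (dF t)) -> continuous dF ->
  (forall t, M < `|t| -> F t = 0) ->
  (\int[lebesgue_measure]_t (dF t)%:E = 0)%E.
Proof.
move=> hF cF F0; have dF0 := dv_zero_out hF F0.
pose N : R := `|M| + 1.
have MN : M < N by rewrite (le_lt_trans (ler_norm M)) // ltrDl.
have N0 : 0 < N by rewrite ltr_pwDr.
have <- : (\int[lebesgue_measure]_(t in `[(- N)%R, N]%classic) (dF t)%:E = 0)%E.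
  rewrite (int_segment_derive (F := F)) ?gtrN //.
  by rewrite !F0 ?subrr // ?normrN ger0_norm // ltW.
rewrite [RHS]integral_mkcond; apply: eq_integral => t _.
rewrite patchE; case: ifPn => // /negP h; rewrite dF0 //.
rewrite ltNge; apply/negP => h1; apply: h.
by rewrite inE /= in_itv /= -ler_norml (le_trans h1) // ltW.
Qed.

Lemma int_derive_neg (F dF : R -> R) (M : R) : (forall t : R, is_derive t 1 F (dF t)) -> continuous dF ->
  (forall t, M < `|t| -> F t = 0) ->
  (\int[lebesgue_measure]_t ((t < 0)%R%:R * dF t)%:E = (F 0)%:E)%E.
Proof.
move=> hF cF F0; have dF0 := dv_zero_out hF F0.
pose N : R := `|M| + 1.
have MN : M < N by rewrite (le_lt_trans (ler_norm M)) // ltrDl.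
have N0 : 0 < N by rewrite ltr_pwDr.
have <- : (\int[lebesgue_measure]_(t in `[(- N)%R, 0%R[%classic) (dF t)%:E = (F 0)%:E)%E.
  rewrite integral_itv_bndo_bndc; last first.
    by apply/measurable_EFinP; apply: measurable_funTS; exact: continuous_measurable_fun.
  rewrite (int_segment_derive (F := F)) ?oppr_lt0 //.
  by rewrite (F0 (- N)) ?subr0 // normrN ger0_norm // ltW.
rewrite [RHS]integral_mkcond; apply: eq_integral => t _.
rewrite patchE; case: ifPn => [|/negP h].
  by rewrite inE /= in_itv /= => /andP[_ ->]; rewrite mul1r.
case: ltP => t0; last by rewrite mul0r.
rewrite dF0 ?mulr0 //; rewrite ltNge; apply/negP => h1; apply: h.
rewrite inE /= in_itv /= t0 andbT; move: h1; rewrite ler_norml => /andP[h1 _].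
by rewrite (le_trans _ h1) // lerN2 ltW.
Qed.

End Calc.

(** * Rules for continuous functions *)

Section Continuity.
Variables (R : realType) (T : topologicalType).
Implicit Types (f g : T -> R) (h : T -> R * R).

Lemma cont_cst (c : R) : continuous (fun _ : T => c).
Proof. exact: cst_continuous. Qed.

Lemma contD f g : continuous f -> continuous g -> continuous (fun x => f x + g x).
Proof. by move=> cf cg x; apply: cvgD; [exact: cf|exact: cg]. Qed.

Lemma contN f : continuous f -> continuous (fun x => - f x).
Proof. by move=> cf x; apply: cvgN; exact: cf. Qed.

Lemma contB f g : continuous f -> continuous g -> continuous (fun x => f x - g x).
Proof. by move=> cf cg; apply: contD => //; exact: contN. Qed.

Lemma contM f g : continuous f -> continuous g -> continuous (fun x => f x * g x).
Proof. by move=> cf cg x; apply: cvgM; [exact: cf|exact: cg]. Qed.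

Lemma contZ (c : R) f : continuous f -> continuous (fun x => c * f x).
Proof. by move=> cf; apply: contM => //; exact: cont_cst. Qed.

Lemma cont_addc f (c : R) : continuous f -> continuous (fun x => f x + c).
Proof. by move=> cf; apply: contD => //; exact: cont_cst. Qed.

Lemma contX n f : continuous f -> continuous (fun x => f x ^+ n).
Proof. by move=> cf x; apply: (@continuous_comp _ _ _ f (fun t => t ^+ n)); [exact: cf|exact: exprn_continuous]. Qed.

Lemma cont_pair f g : continuous f -> continuous g -> continuous (fun x => (f x, g x)).
Proof. by move=> cf cg x; exact: (cvg_pair (cf x) (cg x)). Qed.

Lemma cont_proj1 h : continuous h -> continuous (fun x => (h x).1).
Proof. by move=> ch x; apply: (@continuous_comp _ _ _ h fst); [exact: ch|exact: cvg_fst]. Qed.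

Lemma cont_proj2 h : continuous h -> continuous (fun x => (h x).2).
Proof. by move=> ch x; apply: (@continuous_comp _ _ _ h snd); [exact: ch|exact: cvg_snd]. Qed.

End Continuity.

(** * The Dirichlet form and Rayleigh quotients *)

Section Form.
Variable R : realType.
Implicit Types (f g : R * R -> R) (A : set (R * R)).

(** The partials are carried as data, so that the energy of a concrete function is the integral of a
    formula; [C1c_Cc1] and [Cc1_C1c] pass to [Cc1] and back. *)
Definition C1c A f f1 f2 := [/\ continuous f1, continuous f2, forall x, pd1 f x (f1 x),
  forall x, pd2 f x (f2 x) & supp_in A f].

Lemma C1c_differentiable A f f1 f2 x : C1c A f f1 f2 ->
  [/\ differentiable f x, d1 f x = f1 x & d2 f x = f2 x].
Proof. by move=> [c1 c2 h1 h2 _]; exact: (partial_differentiable h1 h2 (c1 x) (c2 x)). Qed.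

Lemma C1c_cont A f f1 f2 : C1c A f f1 f2 -> continuous f.
Proof. by move=> h x; apply: differentiable_continuous; case: (C1c_differentiable x h). Qed.

Lemma C1c_d1 A f f1 f2 : C1c A f f1 f2 -> d1 f = f1.
Proof. by move=> h; apply/funext => x; case: (C1c_differentiable x h). Qed.

Lemma C1c_d2 A f f1 f2 : C1c A f f1 f2 -> d2 f = f2.
Proof. by move=> h; apply/funext => x; case: (C1c_differentiable x h). Qed.

Lemma C1c_Cc1 A f f1 f2 : C1c A f f1 f2 -> Cc1 A f.
Proof.
move=> h; split; first by move=> x; case: (C1c_differentiable x h).
rewrite (C1c_d1 h) (C1c_d2 h); case: h => c1 c2 _ _ /supp_inP[s1 s2].
by split => //; split.
Qed.

Lemma Cc1_C1c A f : Cc1 A f -> C1c A f (d1 f) (d2 f).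
Proof.
move=> [h [c1 [c2 [s1 s2]]]]; split => //.
- by move=> x; exact: pd1_d1.
- by move=> x; exact: pd2_d2.
- exact/supp_inP.
Qed.

Lemma C1c_Bc A f f1 f2 : C1c A f f1 f2 -> Bc f.
Proof. by move=> h; apply: Bc_cont (C1c_cont h) _; case: h => *; eassumption. Qed.

Lemma C1c_Bc1 A f f1 f2 : C1c A f f1 f2 -> Bc f1.
Proof. by case=> c1 c2 h1 h2 s; exact: Bc_cont c1 (pd1_supp h1 s). Qed.

Lemma C1c_Bc2 A f f1 f2 : C1c A f f1 f2 -> Bc f2.
Proof. by case=> c1 c2 h1 h2 s; exact: Bc_cont c2 (pd2_supp h2 s). Qed.

Lemma C1c_sub A A' f f1 f2 : A `<=` A' -> C1c A f f1 f2 -> C1c A' f f1 f2.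
Proof. by move=> AB [? ? ? ? s]; split => //; exact: supp_in_sub s. Qed.

Lemma C1cD A f f1 f2 g g1 g2 : C1c A f f1 f2 -> C1c A g g1 g2 ->
  C1c A (fun x => f x + g x) (fun x => f1 x + g1 x) (fun x => f2 x + g2 x).
Proof.
move=> [c1 c2 h1 h2 s] [c1' c2' h1' h2' s']; split.
- exact: contD. - exact: contD.
- by move=> x; exact: dvD (h1 x) (h1' x).
- by move=> x; exact: dvD (h2 x) (h2' x).
- by apply: supp_inD s s' => x -> ->; rewrite addr0.
Qed.

Lemma C1cZ A c f f1 f2 : C1c A f f1 f2 ->
  C1c A (fun x => c * f x) (fun x => c * f1 x) (fun x => c * f2 x).
Proof.
move=> [c1 c2 h1 h2 s]; split.
- exact: contZ. - exact: contZ.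
- by move=> x; exact: dvZ (h1 x).
- by move=> x; exact: dvZ (h2 x).
- by apply: supp_in_0 s => x ->; rewrite mulr0.
Qed.

Lemma C1c_0 A : C1c A (fun=> 0) (fun=> 0) (fun=> 0).
Proof.
split; do ?exact: cst_continuous.
- by move=> x; exact: dvC.
- by move=> x; exact: dvC.
- by exists set0; split => //; exact: compact0.
Qed.

Lemma C1c_sum (T : eqType) (s : seq T) A (F F1 F2 : T -> R * R -> R) :
  (forall i, i \in s -> C1c A (F i) (F1 i) (F2 i)) ->
  C1c A (fun x => \sum_(i <- s) F i x) (fun x => \sum_(i <- s) F1 i x) (fun x => \sum_(i <- s) F2 i x).
Proof.
elim: s => [_|a s IH h].
  have E (G : T -> R * R -> R) : (fun x => \sum_(i <- [::]) G i x) = fun=> 0.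
    by apply/funext => x; rewrite big_nil.
  by rewrite !E; exact: C1c_0.
have E (G : T -> R * R -> R) : (fun x => \sum_(i <- a :: s) G i x) = fun x => G a x + \sum_(i <- s) G i x.
  by apply/funext => x; rewrite big_cons.
rewrite !E; apply: C1cD; first by apply: h; rewrite mem_head.
by apply: IH => i hi; apply: h; rewrite in_cons hi orbT.
Qed.

Lemma C1c_comp A (T T' : R -> R) f f1 f2 : (forall t : R, is_derive t 1 T (T' t)) -> continuous T' -> T 0 = 0 ->
  C1c A f f1 f2 -> C1c A (fun x => T (f x)) (fun x => T' (f x) * f1 x) (fun x => T' (f x) * f2 x).
Proof.
move=> hT cT T0 h; have cf := C1c_cont h; case: h => [c1 c2 h1 h2 s].
have cTf : continuous (fun x => T' (f x)).
  by move=> x; apply: continuous_comp; [exact: cf|exact: cT].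
split.
- exact: contM. - exact: contM.
- by move=> [a b]; exact: (@dv_comp R T (fun t => f (t, b)) a _ _ (hT (f (a, b))) (h1 (a, b))).
- by move=> [a b]; exact: (@dv_comp R T (fun t => f (a, t)) b _ _ (hT (f (a, b))) (h2 (a, b))).
- by apply: supp_in_0 s => x ->.
Qed.

Lemma supp_bounded A f : supp_in A f -> exists M, forall x, M < `|x.1| \/ M < `|x.2| -> f x = 0.
Proof.
move=> [K [cK KA K0]]; have [M [_ hM]] := compact_bounded cK.
exists (M + 1) => x hx; apply: K0 => Kx.
have h12 : `|x| <= M + 1 by apply: hM => //; rewrite ltrDl.
have h1 : `|x.1| <= M + 1 by apply: le_trans h12; rewrite /Num.norm /= le_max lexx.
have h2 : `|x.2| <= M + 1 by apply: le_trans h12; rewrite /Num.norm /= le_max lexx orbT.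
by case: hx; rewrite ltNge ?h1 ?h2.
Qed.

Lemma int2_pd1 A f f1 : continuous f1 -> (forall x, pd1 f x (f1 x)) -> supp_in A f -> int2 f1 = 0.
Proof.
move=> c1 h1 s; have [M hM] := supp_bounded s.
apply: int2_eq0_slice1; first exact: Bc_cont c1 (pd1_supp h1 s).
move=> b; apply: (@int_derive_eq0 _ (fun t => f (t, b)) (fun t => f1 (t, b)) M).
- by move=> t; exact: (h1 (t, b)).
- exact: cont_slice1.
- by move=> t Mt; apply: hM; left.
Qed.

Lemma int2_pd2 A f f2 : continuous f2 -> (forall x, pd2 f x (f2 x)) -> supp_in A f -> int2 f2 = 0.
Proof.
move=> c1 h1 s; have [M hM] := supp_bounded s.
apply: int2_eq0_slice2; first exact: Bc_cont c1 (pd2_supp h1 s).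
move=> b; apply: (@int_derive_eq0 _ (fun t => f (b, t)) (fun t => f2 (b, t)) M).
- by move=> t; exact: (h1 (b, t)).
- exact: cont_slice2.
- by move=> t Mt; apply: hM; right.
Qed.

Definition nrm2 f := int2 (fun x => f x ^+ 2).
Definition energy f1 f2 := int2 (fun x : R * R => f1 x ^+ 2 + f2 x ^+ 2) : R.

Lemma Bc_sqr f : Bc f -> Bc (fun x => f x ^+ 2).
Proof. by move=> h; under eq_fun do rewrite expr2; exact: BcM. Qed.

Lemma Bc_en f g : Bc f -> Bc g -> Bc (fun x => f x ^+ 2 + g x ^+ 2).
Proof. by move=> h1 h2; apply: BcD; exact: Bc_sqr. Qed.

Lemma nrm2_ge0 f : 0 <= nrm2 f.
Proof. by apply: int2_ge0 => x; exact: sqr_ge0. Qed.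

Lemma energy_ge0 f g : 0 <= energy f g.
Proof. by apply: int2_ge0 => x; rewrite addr_ge0 ?sqr_ge0. Qed.

Lemma nrm2Z c f : Bc f -> nrm2 (fun x => c * f x) = c ^+ 2 * nrm2 f.
Proof.
by move=> h; rewrite /nrm2 -int2_Z; [|exact: Bc_sqr]; congr int2; apply/funext => x; rewrite exprMn.
Qed.

Lemma energyZ c f g : Bc f -> Bc g -> energy (fun x => c * f x) (fun x => c * g x) = c ^+ 2 * energy f g.
Proof.
move=> h h'; rewrite /energy -int2_Z; last exact: Bc_en.
by congr int2; apply/funext => x; rewrite !exprMn mulrDr.
Qed.

Lemma int_leb2_EFin f : Bc f -> (forall x, 0 <= f x) -> (\int[@leb2 R]_x (f x)%:E = (int2 f)%:E)%E.
Proof.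
move=> hf f0; rewrite integral_leb2.
- exact: EFin_int2.
- by apply/measurable_EFinP; case: hf.
- by move=> x; rewrite lee_fin.
Qed.

Lemma int_energy A f f1 f2 : C1c A f f1 f2 ->
  (\int[@leb2 R]_x ((d1 f x) ^+ 2 + (d2 f x) ^+ 2)%:E = (energy f1 f2)%:E)%E.
Proof.
move=> h; rewrite (C1c_d1 h) (C1c_d2 h) int_leb2_EFin //.
- by apply: Bc_en; [exact: C1c_Bc1 h|exact: C1c_Bc2 h].
- by move=> x; rewrite addr_ge0 ?sqr_ge0.
Qed.

Lemma int_nrm2 A f f1 f2 : C1c A f f1 f2 ->
  (\int[@leb2 R]_x (f x ^+ 2)%:E = (nrm2 f)%:E)%E.
Proof.
move=> h; rewrite int_leb2_EFin //.
- by apply: Bc_sqr; exact: C1c_Bc h.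
- by move=> x; exact: sqr_ge0.
Qed.

Lemma lambda1_ge0 A : (0 <= @lambda1 R A)%E.
Proof.
apply: le_ereal_inf_tmp => _ [f [cf _] <-].
by rewrite (int_energy (Cc1_C1c cf)) lee_fin energy_ge0.
Qed.

Lemma lambda1_le A f f1 f2 : C1c A f f1 f2 -> nrm2 f = 1 -> (lambda1 A <= (energy f1 f2)%:E)%E.
Proof.
move=> h n1; apply: ereal_inf_lbound; exists f; last exact: int_energy h.
by split; [exact: C1c_Cc1 h|rewrite (int_nrm2 h) n1].
Qed.

Lemma lambda1_sub A B : A `<=` B -> (lambda1 B <= @lambda1 R A)%E.
Proof.
move=> AB; apply: ereal_inf_le_tmp => _ [f [cf nf] <-]; exists f => //; split => //.
exact: C1c_Cc1 (C1c_sub AB (Cc1_C1c cf)).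
Qed.

Lemma rayleigh A f f1 f2 (l : R) : (l%:E <= lambda1 A)%E -> C1c A f f1 f2 -> 0 <= l ->
  l * nrm2 f <= energy f1 f2.
Proof.
move=> hl h l0; have := nrm2_ge0 f; rewrite le_eqVlt => /orP[/eqP <-|n0].
  by rewrite mulr0 energy_ge0.
pose c := (Num.sqrt (nrm2 f))^-1.
have c2 : c ^+ 2 = (nrm2 f)^-1 by rewrite exprVn sqr_sqrtr // ltW.
have EZ := energyZ c (C1c_Bc1 h) (C1c_Bc2 h).
have NZ := nrm2Z c (C1c_Bc h).
have := lambda1_le (C1cZ c h); rewrite NZ EZ c2.
rewrite mulVf ?gt_eqF // => /(_ erefl) /(le_trans hl); rewrite lee_fin => H.
by rewrite -ler_pdivlMr // mulrC.
Qed.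

Lemma near_min A (l d : R) : lambda1 A = l%:E -> 0 < d ->
  exists f, exists f1, exists f2, [/\ C1c A f f1 f2, nrm2 f = 1 & energy f1 f2 < l + d].
Proof.
move=> hl d0.
have : (lambda1 A < (l + d)%:E)%E by rewrite hl lte_fin ltrDl.
move=> /ereal_inf_lt[_ [f [cf nf] <-]].
have h := Cc1_C1c cf; rewrite (int_energy h) lte_fin => lt.
exists f, (d1 f), (d2 f); split => //.
by apply: EFin_inj; rewrite -(int_nrm2 h).
Qed.

Lemma quad_disc (a b c : R) : (forall t, 0 <= a + 2 * t * b + t ^+ 2 * c) ->
  0 <= a -> 0 <= c -> `|b| <= Num.sqrt a * Num.sqrt c.
Proof.
move=> H a0 c0; rewrite -sqrtrM // -sqrtr_sqr ler_sqrt ?mulr_ge0 //.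
have [c_eq|cn] := eqVneq c 0.
  subst c; rewrite mulr0; have [->|bn] := eqVneq b 0; first by rewrite expr0n.
  (* For c = 0 the expression is affine in t, and this t gives it the value -1. *)
  have := H (- (a + 1) / (2 * b)); rewrite mulr0 addr0.
  have -> : a + 2 * (- (a + 1) / (2 * b)) * b = -1 by field.
  by rewrite ler0N1.
have cp : 0 < c by rewrite lt_def cn.
have := H (- b / c).
have -> : a + 2 * (- b / c) * b + (- b / c) ^+ 2 * c = (a * c - b ^+ 2) / c by field.
by rewrite pmulr_lge0 ?invr_gt0 // subr_ge0.
Qed.

(** The energy form shifted by l. For 0 <= l at most the first eigenvalue of a domain it is
    nonnegative on the test functions of that domain; [Bf] is its polar form. *)
Definition Qf (l : R) f f1 f2 : R := energy f1 f2 - l * nrm2 f.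
Definition Bf (l : R) f f1 f2 g g1 g2 : R := int2 (fun x => f1 x * g1 x + f2 x * g2 x - l * (f x * g x)).

Lemma Qf_int l f f1 f2 : Bc f -> Bc f1 -> Bc f2 ->
  Bc (fun x => f1 x ^+ 2 + f2 x ^+ 2 - l * f x ^+ 2) /\
  Qf l f f1 f2 = int2 (fun x => f1 x ^+ 2 + f2 x ^+ 2 - l * f x ^+ 2).
Proof.
move=> h h1 h2; have b1 := Bc_en h1 h2; have b2 := BcZ l (Bc_sqr h); split.
  exact: BcB.
by rewrite /Qf /energy /nrm2 -int2_Z ?int2_B //; exact: Bc_sqr.
Qed.

Lemma Bf_Bc l f f1 f2 g g1 g2 : Bc f -> Bc f1 -> Bc f2 -> Bc g -> Bc g1 -> Bc g2 ->
  Bc (fun x => f1 x * g1 x + f2 x * g2 x - l * (f x * g x)).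
Proof.
move=> h h1 h2 k k1 k2; have b1 := BcD (BcM h1 k1) (BcM h2 k2); have b2 := BcZ l (BcM h k).
exact: BcB b1 b2.
Qed.

Lemma Qf_expand l A B f f1 f2 g g1 g2 t : C1c A f f1 f2 -> C1c B g g1 g2 ->
  Qf l (fun x => f x + t * g x) (fun x => f1 x + t * g1 x) (fun x => f2 x + t * g2 x) =
  Qf l f f1 f2 + 2 * t * Bf l f f1 f2 g g1 g2 + t ^+ 2 * Qf l g g1 g2.
Proof.
move=> hf hg.
have bf := C1c_Bc hf; have bf1 := C1c_Bc1 hf; have bf2 := C1c_Bc2 hf.
have bg := C1c_Bc hg; have bg1 := C1c_Bc1 hg; have bg2 := C1c_Bc2 hg.
have bh := BcD bf (BcZ t bg); have bh1 := BcD bf1 (BcZ t bg1); have bh2 := BcD bf2 (BcZ t bg2).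
have [_ ->] := Qf_int l bh bh1 bh2.
have [q1 ->] := Qf_int l bf bf1 bf2.
have [q2 ->] := Qf_int l bg bg1 bg2.
have q3 := Bf_Bc l bf bf1 bf2 bg bg1 bg2.
rewrite /Bf -(int2_Z _ q3) -(int2_Z _ q2).
have q3' := BcZ (2 * t) q3; have q2' := BcZ (t ^+ 2) q2.
rewrite -(int2_D q1 q3') -(int2_D (BcD q1 q3') q2').
congr int2; apply/funext => x; ring.
Qed.

(** Cauchy-Schwarz for the nonnegative form [Qf]. When [Qf l f f1 f2] is small, f solves the
    eigenvalue equation weakly up to the square root of this defect. *)
Lemma Bf_bound l A f f1 f2 g g1 g2 : (forall h h1 h2, C1c A h h1 h2 -> 0 <= Qf l h h1 h2) ->
  C1c A f f1 f2 -> C1c A g g1 g2 ->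
  `|Bf l f f1 f2 g g1 g2| <= Num.sqrt (Qf l f f1 f2) * Num.sqrt (Qf l g g1 g2).
Proof.
move=> H hf hg; apply: quad_disc; [|exact: H hf|exact: H hg] => t.
by rewrite -(Qf_expand _ _ hf hg); exact: (H _ _ _ (C1cD hf (C1cZ t hg))).
Qed.

End Form.

(** * The first eigenvalue of the pipe lies in [1/4, pi^2) *)

Section Half.
Variable R : realType.
Implicit Types (f g : R * R -> R) (A : set (R * R)).
Local Notation H := (@hersch R).

Lemma open_neg : open [set x : R * R | x.1 < 0].
Proof.
have -> : [set x : R * R | x.1 < 0] = (fun x : R * R => x.1) @^-1` [set t | t < 0] by [].
by apply: open_comp; [move=> x _; exact: cvg_fst|exact: open_lt].
Qed.

Lemma Bc_neg f : Bc f -> Bc (fun x => (x.1 < 0)%R%:R * f x).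
Proof.
move=> h; have := Bc_indic (open_measurable_prod open_neg) h.
congr Bc; apply/funext => x; rewrite indicE; congr (_%:R * _).
by case: ltP => h0; [rewrite mem_set|rewrite memNset //= ltNge h0].
Qed.

Lemma Bc_pos f : Bc f -> Bc (fun x => (0 <= x.1)%R%:R * f x).
Proof.
move=> h; have := BcB h (Bc_neg h); congr Bc; apply/funext => x.
by case: ltP => _; rewrite ?mul1r ?mul0r ?subrr ?subr0.
Qed.

Lemma int2_split f : Bc f ->
  int2 f = int2 (fun x => (x.1 < 0)%R%:R * f x) + int2 (fun x => (0 <= x.1)%R%:R * f x).
Proof.
move=> h; rewrite -(int2_D (Bc_neg h) (Bc_pos h)); congr int2; apply/funext => x.
by case: ltP => _; rewrite ?mul1r ?mul0r ?add0r ?addr0.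
Qed.

(** On the half-plane x1 < 0 the divergence theorem leaves a flux through x1 = 0, which vanishes
    with f on that line. *)
Lemma int2_pd1_neg A f f1 : continuous f1 -> (forall x, pd1 f x (f1 x)) -> supp_in A f ->
  (forall b, f (0, b) = 0) -> int2 (fun x => (x.1 < 0)%R%:R * f1 x) = 0.
Proof.
move=> c1 h1 s f0; have [M hM] := supp_bounded s.
apply: int2_eq0_slice1; first exact: Bc_neg (Bc_cont c1 (pd1_supp h1 s)).
move=> b /=; have -> : (0 = (f (0, b))%:E)%E by rewrite f0.
apply: (@int_derive_neg _ (fun t => f (t, b)) (fun t => f1 (t, b)) M).
- by move=> t; exact: (h1 (t, b)).
- exact: cont_slice1.
- by move=> t Mt; apply: hM; left.
Qed.

(** A weight depending on x1 alone is constant along each integration line in x2. *)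
Lemma int2_pd2_slices (h : R -> bool) f2 : Bc (fun x : R * R => (h x.1)%:R * f2 x) ->
  (forall a, h a -> exists F : R -> R, exists M, [/\ forall t : R, is_derive t 1 F (f2 (a, t)), continuous (fun t => f2 (a, t)) &
     forall t, M < `|t| -> F t = 0]) ->
  int2 (fun x => (h x.1)%:R * f2 x) = 0.
Proof.
move=> hb hs; apply: int2_eq0_slice2 => // a /=.
have [ha|ha] := boolP (h a); last first.
  by under eq_integral do rewrite mul0r; rewrite integral0.
have [F [M [h1 h2 h3]]] := hs a ha.
by under eq_integral do rewrite mul1r; exact: (int_derive_eq0 h1 h2 h3).
Qed.

Lemma hersch_x2 (x : R * R) : H x -> x.2 ^+ 2 < 1.
Proof.
case=> [[h _]|[/andP[h1 h2] _]].
  by apply: le_lt_trans h; rewrite lerDr sqr_ge0.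
by rewrite -real_normK ?num_real // expr_lt1.
Qed.

(** The strips contain their edges on x1 = 0; these are covered by the part of the unit disc off the
    line x2 = 0, which may be added because it lies in the pipe. *)
Lemma hersch_open : open H.
Proof.
have c1 : continuous (fun x : R * R => x.1) by move=> x; exact: cvg_fst.
have c2 : continuous (fun x : R * R => x.2) by move=> x; exact: cvg_snd.
have cq : continuous (fun x : R * R => x.1 ^+ 2 + x.2 ^+ 2).
  by rewrite /=; under eq_fun do rewrite !expr2; apply: contD; apply: contM.
have ca : continuous (fun x : R * R => `|x.2|).
  by move=> x; apply: (@continuous_comp _ _ _ _ (fun t : R => `|t|)); [exact: c2|exact: norm_continuous].
have -> : H = ([set x | x.1 < 0] `&` [set x | x.1 ^+ 2 + x.2 ^+ 2 < 1]) `|`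
  ([set x : R * R | `|x.2| != 0] `&` [set x | `|x.2| < 1] `&` ([set x | 0 < x.1] `|` [set x | x.1 ^+ 2 + x.2 ^+ 2 < 1])).
  apply/seteqP; split => x.
    case=> [[h1 h2]|[/andP[h1 h2] h3]]; first by left.
    right; split; first by split => //=; rewrite gt_eqF.
    move: h3; rewrite le_eqVlt => /orP[/eqP h3|h3]; last by left.
    by right; rewrite /= -h3 expr0n add0r -real_normK ?num_real // expr_lt1.
  case=> [[h1 h2]|[[h1 h2] h3]]; first by left.
  have [n|p] := ltP x.1 0.
    by left; split => //; case: h3 => // /= h3; move: (lt_trans h3 n); rewrite ltxx.
  by right; split => //; rewrite h2 andbT lt_def h1 normr_ge0.
have o1 : open [set x : R * R | x.1 < 0] by exact: open_neg.
have o2 : open [set x : R * R | x.1 ^+ 2 + x.2 ^+ 2 < 1].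
  by apply: (open_comp (f := fun x : R * R => x.1 ^+ 2 + x.2 ^+ 2) (D := [set t | t < 1])); [move=> x _; exact: cq|exact: open_lt].
have o3 : open [set x : R * R | `|x.2| != 0].
  apply: (open_comp (f := fun x : R * R => `|x.2|) (D := [set t | t != 0])); [move=> x _; exact: ca|exact: open_neq].
have o4 : open [set x : R * R | `|x.2| < 1].
  by apply: (open_comp (f := fun x : R * R => `|x.2|) (D := [set t | t < 1])); [move=> x _; exact: ca|exact: open_lt].
have o5 : open [set x : R * R | 0 < x.1].
  by apply: (open_comp (f := fun x : R * R => x.1) (D := [set t | 0 < t])); [move=> x _; exact: c1|exact: open_gt].
apply: openU; first exact: openI.
by apply: openI; [exact: openI|exact: openU].
Qed.

(** Adding the exact derivative of - x2 f^2 / 2 turns the claim into (f2 + x2 f / 2)^2 >= 0, because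
    |x2| < 1 on the pipe. It makes the eigenvalue positive. *)
Lemma poincare_quarter f f1 f2 : C1c H f f1 f2 -> (1 / 4) * nrm2 f <= energy f1 f2.
Proof.
move=> h; have cf := C1c_cont h.
have bf := C1c_Bc h; have b1 := C1c_Bc1 h; have b2 := C1c_Bc2 h.
case: (h) => c1 c2 h1 h2 s.
have cx : continuous (fun x : R * R => x.2) by move=> x; exact: cvg_snd.
pose F x := - (1/2) * (x.2 * f x ^+ 2).
pose F2 (x : R * R) := - (1/2) * (f x ^+ 2 + x.2 * (2 * (f x * f2 x))).
have hF x : pd2 F x (F2 x).
  apply: dvZ; apply: dv_eq (dvM (dv_id x.2) (dvX 2 (h2 x))) _.
  by rewrite -surjective_pairing /=; ring.
have cF2 : continuous F2.
  apply: contZ; apply: contD; first by under eq_fun do rewrite expr2; exact: contM.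
  by apply: contM => //; apply: contZ; exact: contM.
have sF : supp_in H F by apply: supp_in_0 s => x fx; rewrite /F fx expr0n /= !mulr0.
have BF2 : Bc F2 by exact: Bc_cont cF2 (pd2_supp hF sF).
have I0 := int2_pd2 cF2 hF sF.
have bn := Bc_sqr bf.
rewrite /nrm2 -(int2_Z _ bn).
rewrite -[X in X <= _]addr0 -I0 -(int2_D (BcZ _ bn) BF2).
apply: int2_le; [exact: BcD (BcZ _ bn) BF2|exact: Bc_en|] => x; rewrite /F2.
have [fx|fx] := eqVneq (f x) 0.
  by rewrite fx !(mul0r, mulr0, expr0n, addr0) /= ?mulr0 addr_ge0 ?sqr_ge0.
have Hx : H x.
  by case: s => K [_ KH K0]; apply: KH; apply: contrapT => /K0 /eqP; apply/negP.
have := hersch_x2 Hx => x2.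
have e1 := sqr_ge0 (f1 x); have e2 := sqr_ge0 (f2 x + x.2 / 2 * f x).
have e3 : 0 <= (1 - x.2 ^+ 2) * f x ^+ 2 by rewrite mulr_ge0 ?sqr_ge0 // subr_ge0 ltW.
nra.
Qed.

Lemma cont_bdd_integrable1 (v : R -> R) (M : R) : continuous v -> (forall t, M < `|t| -> v t = 0) ->
  lebesgue_measure.-integrable setT (EFin \o v).
Proof.
move=> cv v0; pose N : R := `|M| + 1.
have MN : M < N by rewrite (le_lt_trans (ler_norm M)) // ltrDl.
have i1 : lebesgue_measure.-integrable `[(- N)%R, N]%classic (EFin \o v).
  by apply: continuous_compact_integrable; [exact: segment_compact|exact: continuous_subspaceT].
have := (integrable_mkcond (mu := lebesgue_measure) (EFin \o v) (measurable_itv `[(- N), N]%R)).1 i1.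
congr (integrable _ _ _); apply/funext => t; rewrite patchE; case: ifPn => // /negP h /=.
rewrite v0 //; rewrite ltNge; apply/negP => h1; apply: h.
by rewrite inE /= in_itv /= -ler_norml (le_trans h1) // ltW.
Qed.

(** A minorant that is the derivative of a compactly supported function has integral 0. *)
Lemma int1_ge0_of_derive (v dG G : R -> R) (M : R) : continuous v -> (forall t, M < `|t| -> v t = 0) ->
  (forall t : R, is_derive t 1 G (dG t)) -> continuous dG -> (forall t, M < `|t| -> G t = 0) ->
  (forall t, dG t <= v t) -> (0 <= \int[lebesgue_measure]_t (v t)%:E)%E.
Proof.
move=> cv v0 hG cG G0 le.
rewrite -(int_derive_eq0 hG cG G0); apply: le_integral => //.
- exact: cont_bdd_integrable1 cG (dv_zero_out hG G0).
- exact: cont_bdd_integrable1 cv v0.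
- by move=> t _; rewrite lee_fin.
Qed.

Lemma sin_pi_neq0 (t : R) : 0 < `|t| < 1 -> sin (pi * t) != 0.
Proof.
move=> /andP[h1 h2].
have p0 : 0 < (pi : R) by exact: pi_gt0.
have [t0|t0|t0] := ltgtP t 0.
- rewrite -[t]opprK mulrN sinN oppr_eq0 gt_eqF //; apply: sin_gt0_pi.
  by move: h2; rewrite ltr0_norm // => h2; rewrite mulr_gt0 ?oppr_gt0 //= -[X in _ < X]mulr1 ltr_pM2l.
- rewrite gt_eqF //; apply: sin_gt0_pi.
  by move: h2; rewrite gtr0_norm // => h2; rewrite mulr_gt0 //= -[X in _ < X]mulr1 ltr_pM2l.
- by move: h1; rewrite t0 normr0 ltxx.
Qed.

(* v'^2 - pi^2 v^2 is at least the derivative of k v^2 for the Riccati solution k = pi cot(pi t). *)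
Lemma strip_wirtinger f f1 f2 : C1c H f f1 f2 ->
  0 <= int2 (fun x => (0 <= x.1)%R%:R * (f2 x ^+ 2 - pi ^+ 2 * f x ^+ 2)).
Proof.
move=> h; have cf := C1c_cont h.
have bf := C1c_Bc h; have b2 := C1c_Bc2 h.
case: (h) => c1 c2 h1 h2 s.
have sf2 := pd2_supp h2 s.
apply: int2_ge0_slice2; first by apply: Bc_pos; exact: BcB (Bc_sqr b2) (BcZ _ (Bc_sqr bf)).
move=> a /=; have [a0|a0] := leP 0 a; last by under eq_integral do rewrite mul0r; rewrite integral0.
under eq_integral do rewrite mul1r.
pose v (t : R) := f (a, t); pose v2 (t : R) := f2 (a, t).
have [M hM] := supp_bounded s.
have v0 t : M < `|t| -> v t = 0 by move=> Mt; apply: hM; right.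
have hv (t : R) : is_derive t 1 v (v2 t) by exact: (h2 (a, t)).
have v20 t : M < `|t| -> v2 t = 0 by exact: (dv_zero_out hv v0).
have cv : continuous v by exact: cont_slice2.
have cv2 : continuous v2 by exact: cont_slice2.
(* The cotangent blows up at integers t, but (a, t) is then off the pipe, and the compact support of
   f keeps v zero near t. *)
have alt t : sin (pi * t) != 0 \/ \forall y \near t, v y = 0.
  have [Ht|Ht] := pselect (H (a, t)).
    left; case: Ht => [[_ /=]|[/= ht _]]; last exact: sin_pi_neq0.
    by rewrite ltNge a0.
  right; have := supp_in_near s Ht => /nbhs_ballP[e /= e0 he].
  apply/nbhs_ballP; exists e => // y hy; apply: he; split => //=; exact: ballxx.
pose k (t : R) : R := pi * cos (pi * t) / sin (pi * t).
pose k' (t : R) : R := - (pi ^+ 2 / sin (pi * t) ^+ 2).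
have dpi (t : R) : is_derive t 1 (fun y : R => pi * y) pi.
  by apply: dv_eq (dvZ pi (dv_id t)) _; rewrite mulr1.
have dk (t : R) : sin (pi * t) != 0 -> is_derive t 1 k (k' t).
  move=> st; rewrite /k.
  apply: dv_eq (dv_div (dvZ pi (dv_comp (is_derive_cos _) (dpi t))) (dv_comp (is_derive_sin _) (dpi t)) st) _.
  have -> : k' t = (- pi ^+ 2) / sin (pi * t) ^+ 2 by rewrite /k' mulNr.
  apply: (congr1 (fun z => z / sin (pi * t) ^+ 2)).
  have := cos2Dsin2 (pi * t) => /(congr1 (fun z => - (pi ^+ 2 * z))); rewrite mulr1 => <-; ring.
pose G (t : R) := k t * v t ^+ 2.
pose dG (t : R) := k' t * v t ^+ 2 + k t * (2 * v t * v2 t).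
have hG (t : R) : is_derive t 1 G (dG t).
  have [st|vn] := alt t.
    by apply: dv_eq (dvM (dk t st) (dvX 2 (hv t))) _; rewrite /dG /= expr1.
  have vt : v t = 0 by exact: nbhs_singleton vn.
  rewrite /dG vt expr0n /= !mulr0 mul0r mulr0 addr0.
  apply: dv_near (dvC 0 t); apply: filterS vn => y vy; by rewrite /G vy expr0n mulr0.
have cs : continuous (fun t : R => sin (pi * t)).
  by move=> t; apply: dv_continuous (dv_comp (is_derive_sin _) (dpi t)).
have cc : continuous (fun t : R => cos (pi * t)).
  by move=> t; apply: dv_continuous (dv_comp (is_derive_cos _) (dpi t)).
have cG : continuous dG.
  move=> t; have [st|vn] := alt t.
    have iv : {for t, continuous (fun t : R => (sin (pi * t))^-1)} by apply: cvgV => //; exact: cs.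
    apply: cvgD; apply: cvgM.
    - apply: cvgN; apply: cvgM; first exact: cvg_cst.
      under eq_fun do rewrite -exprVn expr2; rewrite -exprVn expr2.
      exact: cvgM.
    - by under eq_fun do rewrite expr2; rewrite expr2; apply: cvgM; exact: cv.
    - apply: cvgM => //; apply: cvgM; [exact: cvg_cst|exact: cc].
    - apply: cvgM; last exact: cv2.
      by apply: cvgM; [exact: cvg_cst|exact: cv].
  have vt : v t = 0 by exact: nbhs_singleton vn.
  rewrite /continuous_at {2}/dG vt expr0n /= !mulr0 mul0r mulr0 addr0.
  apply: cvg_near_cst; apply: filterS vn => y vy.
  by rewrite /dG vy expr0n /= !mulr0 mul0r mulr0 addr0.
apply: (@int1_ge0_of_derive _ dG G M) => //.
- move=> t; apply: cvgB; first by under eq_fun do rewrite expr2; rewrite expr2; apply: cvgM; exact: cv2.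
  apply: cvgM; first exact: cvg_cst.
  by under eq_fun do rewrite expr2; rewrite expr2; apply: cvgM; exact: cv.
- by move=> t Mt; rewrite -/(v t) -/(v2 t) v0 // v20 // expr0n mulr0 subrr.
- by move=> t Mt; rewrite /G v0 // expr0n mulr0.
- move=> t; rewrite -/(v t) -/(v2 t) /dG.
  have [st|vn] := alt t; last first.
    have vt : v t = 0 by exact: nbhs_singleton vn.
    by rewrite vt expr0n /= !mulr0 mul0r mulr0 addr0 subr0 sqr_ge0.
  have e : k' t = - pi ^+ 2 - k t ^+ 2.
    rewrite /k' /k; have := cos2Dsin2 (pi * t) => /(congr1 (fun z => z - sin (pi * t) ^+ 2)).
    rewrite addrK => e; rewrite expr_div_n exprMn e; field; exact: st.
  rewrite e -subr_ge0.
  have -> : v2 t ^+ 2 - pi ^+ 2 * v t ^+ 2 - ((- pi ^+ 2 - k t ^+ 2) * v t ^+ 2 + k t * (2 * v t * v2 t)) =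
     (v2 t - k t * v t) ^+ 2 by ring.
  exact: sqr_ge0.
Qed.

End Half.

(** * The regularised ground state of the strip *)

Section Profile.
Variable R : realType.
Implicit Types (q s r c : R).

Lemma near_lt s c : s < c -> \forall y \near s, y < c.
Proof. by move=> h; apply: (open_nbhs_nbhs (A := [set y | y < c])); split => //; exact: open_lt. Qed.

Lemma near_gt s c : c < s -> \forall y \near s, c < y.
Proof. by move=> h; apply: (open_nbhs_nbhs (A := [set y | c < y])); split => //; exact: open_gt. Qed.

(** Powers of the positive part are the building blocks of all cut-offs: from the exponent 2 on they
    are C^1, and differentiation stays in the family. *)
Definition pp n (s : R) : R := Num.max s 0 ^+ n.

Lemma pp_ge0 n s : 0 <= pp n s.
Proof. by rewrite /pp exprn_ge0 // le_max lexx orbT. Qed.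

Lemma pp_pos n s : 0 <= s -> pp n s = s ^+ n.
Proof. by move=> h; rewrite /pp; congr (_ ^+ _); apply/max_idPl. Qed.

Lemma pp_neg n s : s <= 0 -> pp n.+1 s = 0.
Proof. by move=> h; rewrite /pp (_ : Num.max s 0 = 0) ?expr0n //; apply/max_idPr. Qed.

Lemma cont_max0 : continuous (fun s : R => Num.max s 0).
Proof.
have -> : (fun s : R => Num.max s 0) = fun s => 1 / 2 * (s + `|s|).
  by apply/funext => s; case: (lerP s 0) => h; [rewrite ler0_norm //|rewrite gtr0_norm //]; lra.
move=> s; apply: cvgM; first exact: cvg_cst.
by apply: cvgD; [exact: cvg_id|exact: norm_continuous].
Qed.

Lemma cont_exp n (F : R -> R) (x : R) : {for x, continuous F} -> {for x, continuous (fun t => F t ^+ n : R)}.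
Proof.
by move=> cF; apply: (@continuous_comp _ _ _ F (fun t : R => t ^+ n)) => //; exact: exprn_continuous.
Qed.

Lemma cont_pp n : continuous (pp n).
Proof. by move=> s; apply: (@cont_exp n (fun s => Num.max s 0)); exact: cont_max0. Qed.

Lemma dv_pp n (s : R) : is_derive s 1 (pp n.+2) (n.+2%:R * pp n.+1 s).
Proof.
have [s0|s0|s0] := ltgtP s 0.
- rewrite (pp_neg _ (ltW s0)) mulr0; apply: dv_near (dvC 0 s).
  apply: filterS (near_lt s0) => y y0.
  by rewrite pp_neg // ltW.
- rewrite (pp_pos _ (ltW s0)); apply: dv_near (dv_eq (dvX n.+2 (dv_id s)) (mulr1 _)).
  apply: filterS (near_gt s0) => y y0.
  by rewrite pp_pos // ltW.
- subst s; rewrite pp_neg // mulr0.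
  (* At 0 the slope function is the next lower power, continuous and zero there. *)
  apply/is_derive1_caratheodory; exists (pp n.+1); split.
  + move=> z; rewrite subr0 [pp _ 0]pp_neg // subr0.
    have [z0|z0] := leP 0 z; last by rewrite !pp_neg ?mul0r // ltW.
    by rewrite !pp_pos // exprSr.
  + exact: cont_pp.
  + by rewrite pp_neg.
Qed.

(** Extension by zero for formulas with sqrt q and divisions that make sense on (0, 1) only.
    Derivatives and continuity survive since F is required to vanish near both ends. *)
Definition cutoff01 (F : R -> R) (q : R) : R := if 0 < q < 1 then F q else 0.

Lemma cutoff01_near (F : R -> R) (r q : R) : 0 < r -> (forall q, 0 < q < 1 -> ~~ (r < q < 1 - r) -> F q = 0) ->
  ~~ (0 < q < 1) -> \forall y \near q, cutoff01 F y = 0.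
Proof.
move=> r0 F0; rewrite negb_and -!leNgt => /orP[q0|q1].
  have qr : q < r by exact: le_lt_trans r0.
  apply: filterS (near_lt qr) => y /= yr.
  rewrite /cutoff01; case: ifP => // h; apply: F0 => //.
  by rewrite negb_and -leNgt ltW.
have qr : 1 - r < q by apply: lt_le_trans q1; rewrite gtrBl.
apply: filterS (near_gt qr) => y /= yr.
rewrite /cutoff01; case: ifP => // h; apply: F0 => //.
by rewrite negb_and -!leNgt (ltW yr) orbT.
Qed.

Lemma cutoff01_in (F : R -> R) (q : R) : 0 < q < 1 -> \forall y \near q, F y = cutoff01 F y.
Proof.
move=> q01; have : `]0, 1[%classic q by rewrite /= in_itv.
move=> h; have := open_nbhs_nbhs (conj (interval_open (a := BRight (0:R)) (b := BLeft 1) isT isT) h).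
by apply: filterS => y; rewrite /= in_itv /= /cutoff01 => ->.
Qed.

Lemma dv_cutoff01 (F F' : R -> R) (r : R) : 0 < r ->
  (forall q, 0 < q < 1 -> ~~ (r < q < 1 - r) -> F q = 0) ->
  (forall q, 0 < q < 1 -> is_derive q 1 F (F' q)) ->
  forall q : R, is_derive q 1 (cutoff01 F) (cutoff01 F' q).
Proof.
move=> r0 F0 hF q; have [h|h] := boolP (0 < q < 1).
  by rewrite {2}/cutoff01 h; exact: dv_near (cutoff01_in F h) (hF q h).
rewrite {2}/cutoff01 (negbTE h); apply: dv_near (dvC 0 q).
by apply: filterS (cutoff01_near r0 F0 h) => y ->.
Qed.

Lemma cont_cutoff01 (F : R -> R) (r : R) : 0 < r ->
  (forall q, 0 < q < 1 -> ~~ (r < q < 1 - r) -> F q = 0) ->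
  (forall q, 0 < q < 1 -> {for q, continuous F}) -> continuous (cutoff01 F).
Proof.
move=> r0 F0 cF q; have [h|h] := boolP (0 < q < 1).
  rewrite /continuous_at {2}/cutoff01 h.
  by apply: cvg_trans (cF q h); apply: near_eq_cvg; exact: cutoff01_in.
rewrite /continuous_at {2}/cutoff01 (negbTE h); apply: cvg_near_cst.
exact: cutoff01_near r0 F0 h.
Qed.

(* [B q], with q = |x|^2, regularises sin (pi |x|) with support in r <= q <= 1 - r; [prof_ineq] says
   that its strip energy is at most pi^2 times its mass up to an exact derivative and an error [c]. *)
Record profile (c r : R) (B B1 K1 : R -> R) : Prop := Profile {
  prof_dv : forall q : R, is_derive q 1 B (B1 q);
  prof_c1 : continuous B1;
  prof_dvK : forall q : R, is_derive q 1 (fun q => B q * B1 q) (K1 q);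
  prof_cK : continuous K1;
  prof_r : 0 < r;
  prof_0 : forall q, ~~ (r < q < 1 - r) -> B q = 0;
  prof_out : forall q, ~~ (0 < q < 1) -> B1 q = 0 /\ K1 q = 0;
  prof_01 : forall q, 0 <= B q <= 1;
  prof_ineq : forall q, 0 < q < 1 ->
    4 * q * B1 q ^+ 2 - pi ^+ 2 * B q ^+ 2 <= 2 * (B q * B1 q) + 4 * q * K1 q + c }.

Lemma profile_le c c' r (B B1 K1 : R -> R) : c <= c' -> profile c r B B1 K1 -> profile c' r B B1 K1.
Proof.
move=> cc [h1 h2 h3 h4 h5 h6 h7 h8 h9]; split => // q q01.
by apply: le_trans (h9 q q01) _; rewrite lerD2l.
Qed.

(** The ground state sin (pi |x|) of the strip as a function of q = |x|^2, a variable that is smooth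
    in x. With q = x2^2 in the strips and q = x1^2 + x2^2 in the bend, one profile serves both. *)
Let S (q : R) : R := sin (pi * Num.sqrt q).

Lemma S_cont : continuous S.
Proof.
move=> q; apply: (@continuous_comp _ _ _ (fun q : R => pi * Num.sqrt q) sin); last exact: continuous_sin.
by apply: cvgM; [exact: cvg_cst|exact: sqrt_continuous].
Qed.

Lemma S_gt0 q : 0 < q < 1 -> 0 < S q.
Proof.
move=> /andP[q0 q1]; apply: sin_gt0_pi; rewrite mulr_gt0 ?pi_gt0 ?sqrtr_gt0 //=.
rewrite -[X in _ < X]mulr1 ltr_pM2l ?pi_gt0 // -[X in _ < X]sqrtr1 ltr_sqrt //.
Qed.

Lemma S_le1 q : S q <= 1. Proof. exact: sin_le1. Qed.

Let S1 (q : R) : R := pi * cos (pi * Num.sqrt q) / (2 * Num.sqrt q).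
Let S2 (q : R) : R := - (pi ^+ 2 * S q) / (4 * q) - S1 q / (2 * q).

Lemma dv_sqrt q : 0 < q -> is_derive (q : R) 1 (@Num.sqrt R) (2 * Num.sqrt q)^-1.
Proof. exact: is_derive1_sqrt. Qed.

Lemma dv_S q : 0 < q -> is_derive q 1 S (S1 q).
Proof.
move=> q0; apply: dv_eq (dv_comp (is_derive_sin _) (dvZ pi (dv_sqrt q0))) _.
by rewrite /S1 mulrA [cos _ * _]mulrC.
Qed.

Lemma dv_S1 q : 0 < q -> is_derive q 1 S1 (S2 q).
Proof.
move=> q0; have sq0 : Num.sqrt q != 0 by rewrite gt_eqF // sqrtr_gt0.
have n2 : 2 * Num.sqrt q != 0 by rewrite mulf_neq0.
have d1 := dvZ pi (dv_comp (is_derive_cos _) (dvZ pi (dv_sqrt q0))).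
apply: dv_eq (dv_div d1 (dvZ 2 (dv_sqrt q0)) n2) _.
rewrite /S2 /S1 /S; have e : q = Num.sqrt q ^+ 2 by rewrite sqr_sqrtr // ltW.
move: sq0 e; move: (Num.sqrt q) => s s0 ->; by field.
Qed.

Lemma S1_sq q : 0 < q -> 4 * q * S1 q ^+ 2 = pi ^+ 2 * (1 - S q ^+ 2).
Proof.
move=> q0; have sq0 : Num.sqrt q != 0 by rewrite gt_eqF // sqrtr_gt0.
rewrite -[X in _ * (X - _)](cos2Dsin2 (pi * Num.sqrt q)); rewrite -/(S q) addrK /S1.
have e : q = Num.sqrt q ^+ 2 by rewrite sqr_sqrtr // ltW.
rewrite [X in 4 * X]e; move: sq0; move: (Num.sqrt q) => s s0.
by field; rewrite s0.
Qed.

(** The equation of sin (pi s), second derivative equal to - pi^2 times the function, in the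
    variable q = s^2. *)
Lemma S2_eq q : 0 < q -> 2 * S1 q + 4 * q * S2 q = - (pi ^+ 2 * S q).
Proof. by move=> q0; rewrite /S2; field; rewrite gt_eqF. Qed.

Section tau.
Variable d : R.
Let P (s : R) := pp 1 (s - d).
(** Truncation of small values: zero below d and convex. The product [kap] of tau and its derivative
    is C^1 although that derivative has a corner at d, which is why [profile] differentiates B B1
    and not B1 alone. *)
Let tau (s : R) := pp 2 (s - d) / s.
Let tau1 (s : R) := P s * (2 * s - P s) / s ^+ 2.
Let kap (s : R) := tau s * tau1 s.
Let kap1 (s : R) := pp 2 (s - d) * (6 * s ^+ 2 - 8 * P s * s + 3 * pp 2 (s - d)) / s ^+ 4.

Lemma ppE n s : pp n s = pp 1 s ^+ n. Proof. by rewrite /pp expr1. Qed.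

Lemma dv_ppd n (s : R) : is_derive s 1 (fun s => pp n.+2 (s - d)) (n.+2%:R * pp n.+1 (s - d)).
Proof.
have h : is_derive s 1 (fun s : R => s - d) 1.
  by apply: dv_eq (dvB (dv_id s) (dvC d s)) _; rewrite subr0.
by apply: dv_eq (dv_comp (dv_pp n _) h) _; rewrite mulr1.
Qed.

Lemma dv_tau s : s != 0 -> is_derive s 1 tau (tau1 s).
Proof.
move=> s0; apply: dv_eq (dv_div (dv_ppd 0 s) (dv_id s) s0) _.
by rewrite /tau1 /P [pp 2 _]ppE; congr (_ / _); ring.
Qed.

Lemma kapE s : s != 0 -> kap s = (2 * s * pp 3 (s - d) - pp 4 (s - d)) / s ^+ 3.
Proof.
by move=> s0; rewrite /kap /tau /tau1 /P !(ppE 2, ppE 3, ppE 4); field.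
Qed.

Lemma dv_kap s : 0 < s -> is_derive s 1 kap (kap1 s).
Proof.
move=> s0; have sn : s != 0 by rewrite gt_eqF.
have s3 : s ^+ 3 != 0 by rewrite expf_neq0.
have h := dv_div (dvB (dvM (dvZ 2 (dv_id s)) (dv_ppd 1 s)) (dv_ppd 2 s)) (dvX 3 (dv_id s)) s3.
apply: dv_near (dv_eq h _).
  apply: filterS (near_gt s0) => y y0.
  by rewrite kapE // gt_eqF.
rewrite /kap1 /P !(ppE 2, ppE 3, ppE 4) /=; by field.
Qed.

Lemma cont_ppd n s : {for s, continuous (fun s => pp n (s - d))}.
Proof.
apply: (@continuous_comp _ _ _ (fun s : R => s - d) (pp n)); last exact: cont_pp.
by apply: cvgB; [exact: cvg_id|exact: cvg_cst].
Qed.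

Lemma cont_tau1 s : s != 0 -> {for s, continuous tau1}.
Proof.
move=> s0; rewrite /tau1.
have i : {for s, continuous (fun s : R => s)} by exact: cvg_id.
apply: cvgM; last by apply: cvgV; [rewrite expf_neq0|exact: (@cont_exp 2 (fun s => s) s i)].
apply: cvgM; first exact: cont_ppd.
apply: cvgB; last exact: cont_ppd.
by apply: cvgM; [exact: cvg_cst|exact: i].
Qed.

Lemma cont_kap1 s : s != 0 -> {for s, continuous kap1}.
Proof.
move=> s0; rewrite /kap1.
have i : {for s, continuous (fun s : R => s)} by exact: cvg_id.
apply: cvgM; last by apply: cvgV; [rewrite expf_neq0|exact: (@cont_exp 4 (fun s => s) s i)].
apply: cvgM; first exact: cont_ppd.
apply: cvgD; last by apply: cvgM; [exact: cvg_cst|exact: cont_ppd].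
apply: cvgB; first by apply: cvgM; [exact: cvg_cst|exact: (@cont_exp 2 (fun s => s) s i)].
by apply: cvgM => //; apply: cvgM; [exact: cvg_cst|exact: cont_ppd].
Qed.

Lemma cont_S1 q : 0 < q -> {for q, continuous S1}.
Proof. by move=> q0; exact: dv_continuous (dv_S1 q0). Qed.

Lemma cont_S2 q : 0 < q -> {for q, continuous S2}.
Proof.
move=> q0; rewrite /S2; have i : {for q, continuous (fun s : R => s)} by exact: cvg_id.
apply: cvgB; apply: cvgM.
- by apply: cvgN; apply: cvgM; [exact: cvg_cst|exact: S_cont].
- by apply: cvgV; [rewrite mulf_neq0 ?gt_eqF|apply: cvgM; [exact: cvg_cst|exact: i]].
- exact: cont_S1.
- by apply: cvgV; [rewrite mulf_neq0 ?gt_eqF|apply: cvgM; [exact: cvg_cst|exact: i]].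
Qed.

Lemma profile_exists_d : 0 < d -> exists r, profile (2 * pi ^+ 2 * d) r
  (cutoff01 (fun q => tau (S q))) (cutoff01 (fun q => tau1 (S q) * S1 q))
  (cutoff01 (fun q => kap1 (S q) * S1 q ^+ 2 + kap (S q) * S2 q)).
Proof.
move=> d0.
(* The sine vanishes at q = 0 and q = 1, so it is at most d near both ends, where the truncation is
   then zero. *)
have [r r0 Sr] : exists2 r, 0 < r & forall q, 0 < q < 1 -> ~~ (r < q < 1 - r) -> S q <= d.
  have S0 : S 0 = 0 by rewrite /S sqrtr0 mulr0 sin0.
  have S10 : S 1 = 0 by rewrite /S sqrtr1 mulr1 sinpi.
  have := @S_cont 0 => /cvgrPdist_lt /(_ _ d0) /nbhs_ballP[e1 /= e10 h1].
  have := @S_cont 1 => /cvgrPdist_lt /(_ _ d0) /nbhs_ballP[e2 /= e20 h2].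
  exists (Num.min e1 e2 / 2); first by rewrite divr_gt0 // lt_min e10.
  have m1 : Num.min e1 e2 <= e1 by rewrite ge_min lexx.
  have m2 : Num.min e1 e2 <= e2 by rewrite ge_min lexx orbT.
  move=> q /andP[q0 q1]; rewrite negb_and -!leNgt => /orP[qr|qr].
    have : `|S 0 - S q| < d by apply: h1; rewrite /ball /= sub0r normrN gtr0_norm //; lra.
    by rewrite S0 sub0r normrN => h; apply: le_trans (ler_norm _) _; exact: ltW.
  have : `|S 1 - S q| < d by apply: h2; rewrite /ball /= ger0_norm ?subr_ge0 ?(ltW q1) //; lra.
  by rewrite S10 sub0r normrN => h; apply: le_trans (ler_norm _) _; exact: ltW.
have P0 n q : 0 < q < 1 -> ~~ (r < q < 1 - r) -> pp n.+1 (S q - d) = 0.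
  by move=> q01 qr; rewrite pp_neg // subr_le0; exact: Sr.
have Sn q : 0 < q < 1 -> S q != 0 by move=> h; rewrite gt_eqF // S_gt0.
have t0 q : 0 < q < 1 -> ~~ (r < q < 1 - r) -> tau (S q) = 0.
  by move=> h1 h2; rewrite /tau P0 // mul0r.
have t10 q : 0 < q < 1 -> ~~ (r < q < 1 - r) -> tau1 (S q) * S1 q = 0.
  by move=> h1 h2; rewrite /tau1 /P P0 // !mul0r.
have k0 q : 0 < q < 1 -> ~~ (r < q < 1 - r) -> kap (S q) * S1 q = 0.
  by move=> h1 h2; rewrite /kap t0 // !mul0r.
have k10 q : 0 < q < 1 -> ~~ (r < q < 1 - r) -> kap1 (S q) * S1 q ^+ 2 + kap (S q) * S2 q = 0.
  by move=> h1 h2; rewrite /kap1 P0 // !mul0r add0r /kap t0 // !mul0r.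
have K_eq : (fun q => cutoff01 (fun q => tau (S q)) q * cutoff01 (fun q => tau1 (S q) * S1 q) q) =
   cutoff01 (fun q => kap (S q) * S1 q).
  by apply/funext => q; rewrite /cutoff01; case: ifP => _; rewrite ?mulr0 // /kap mulrA.
exists r; split => //.
- apply: (dv_cutoff01 r0) => // q /andP[q0 q1].
  by apply: dv_comp (dv_tau _) (dv_S q0); rewrite Sn // q0.
- apply: (cont_cutoff01 r0) => // q /andP[q0 q1].
  apply: cvgM; last exact: cont_S1.
  by apply: continuous_comp; [exact: S_cont|apply: cont_tau1; rewrite Sn // q0].
- rewrite K_eq; apply: (dv_cutoff01 r0) => // q /andP[q0 q1].
  have kS := dv_comp (dv_kap (S_gt0 (introT andP (conj q0 q1)))) (dv_S q0).
  by apply: dv_eq (dvM kS (dv_S1 q0)) _; rewrite expr2 mulrA.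
- apply: (cont_cutoff01 r0) => // q /andP[q0 q1].
  have q01 : 0 < q < 1 by rewrite q0.
  apply: cvgD; apply: cvgM.
  + by apply: continuous_comp; [exact: S_cont|apply: cont_kap1; rewrite Sn].
  + by apply: cont_exp; exact: cont_S1.
  + by apply: continuous_comp; [exact: S_cont|apply: dv_continuous (dv_kap _); exact: S_gt0].
  + exact: cont_S2.
- move=> q qr; rewrite /cutoff01; case: ifP => // h; exact: t0.
- by move=> q; rewrite /cutoff01 => /negbTE ->.
- move=> q; rewrite /cutoff01; case: ifP => [h|]; last by rewrite lexx ler01.
  have s0 := S_gt0 h; have s1 := S_le1 q.
  rewrite /tau; apply/andP; split; first by rewrite divr_ge0 ?pp_ge0 // ltW.
  rewrite ler_pdivrMr // mul1r.
  have [sd|sd] := leP (S q) d; first by rewrite pp_neg ?subr_le0 // ltW.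
  rewrite pp_pos ?subr_ge0 ?ltW //; nra.
- move=> q h; rewrite /cutoff01 h; have /andP[q0 _] := h.
  have s0 := S_gt0 h; have s1 := S_le1 q.
  have e1 := S1_sq q0; have e2 := S2_eq q0.
  set s := S q in s0 s1 e1 e2 *.
  have X0 : 0 <= 4 * q * S1 q ^+ 2 by rewrite mulr_ge0 ?sqr_ge0 // mulr_ge0 // ltW.
  (* With X = 4 q S1^2 and [S2_eq] the inequality to prove reads tau1^2 X - pi^2 tau^2 <= kap1 X -
     pi^2 s kap + 2 pi^2 d; [kt] and [tb] compare it term by term. The first is the convexity of
     tau. *)
  have kt : tau1 s ^+ 2 <= kap1 s.
    rewrite -subr_ge0; have -> : kap1 s - tau1 s ^+ 2 = 2 * (P s * (s - P s)) ^+ 2 / s ^+ 4.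
      by rewrite /kap1 /tau1 /P (ppE 2); field; rewrite gt_eqF.
    by rewrite divr_ge0 ?exprn_ge0 ?(ltW s0) // mulr_ge0 ?sqr_ge0.
  have tb : s * kap s - tau s ^+ 2 <= 2 * d.
    have [sd|sd] := leP s d.
      rewrite /kap /tau pp_neg ?subr_le0 // !mul0r mulr0 expr0n subrr mulr_ge0 //; exact: ltW.
    have Ps : P s = s - d by rewrite /P pp_pos ?expr1 // subr_ge0 ltW.
    have -> : s * kap s - tau s ^+ 2 = (2 * d) * ((s - d) ^+ 3 / s ^+ 2).
      by rewrite /kap /tau /tau1 (ppE 2) -/(P s) Ps; field; rewrite gt_eqF.
    rewrite -[X in _ <= X]mulr1 ler_wpM2l // ?mulr_ge0 ?(ltW d0) //.
    rewrite ler_pdivrMr ?exprn_gt0 // mul1r.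
    have sd0 : 0 <= s - d by rewrite subr_ge0 ltW.
    have a1 : s - d <= 1 by lra.
    have a2 : (s - d) ^+ 2 <= s ^+ 2 by rewrite ler_sqr ?nnegrE // ?ltW //; lra.
    by rewrite exprSr; apply: le_trans a2; rewrite -[X in _ <= X]mulr1 ler_wpM2l // sqr_ge0.
  have pi2 : 0 <= (pi : R) ^+ 2 by exact: sqr_ge0.
  have m1 := ler_wpM2r X0 kt.
  have m2 := ler_wpM2l pi2 tb.
  have -> : 4 * q * (tau1 s * S1 q) ^+ 2 = tau1 s ^+ 2 * (4 * q * S1 q ^+ 2) by ring.
  have -> : 2 * (tau s * (tau1 s * S1 q)) + 4 * q * (kap1 s * S1 q ^+ 2 + kap s * S2 q) =
     kap1 s * (4 * q * S1 q ^+ 2) + kap s * (2 * S1 q + 4 * q * S2 q) by rewrite /kap; ring.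
  rewrite e2; nra.
Qed.

End tau.

(** The radius [h] is fixed before [c]: near q = 1/4, where the sine is 1, every fine truncation
    stays above 1/2. The gain in the bend is thus fixed while the error [c] tends to 0. *)
Lemma profile_exists : exists2 h : R, 0 < h & forall c, 0 < c -> exists r, exists B, exists B1, exists K1,
  profile c r B B1 K1 /\ forall q, `|q - 1 / 4| < h -> 1 / 2 <= B q.
Proof.
have S4 : S (1 / 4) = 1.
  rewrite /S (_ : 1 / 4 = (1 / 2) ^+ 2); last by field.
  by rewrite sqrtr_sqr ger0_norm ?divr_ge0 // mulrA mulr1 sin_pihalf.
have e8 : 0 < 1 / 8 :> R by rewrite divr_gt0.
have := @S_cont (1 / 4) => /cvgrPdist_lt /(_ _ e8) /nbhs_ballP[e /= e0 h].
exists (Num.min e (1 / 8)); first by rewrite lt_min e0.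
move=> c c0; pose d := Num.min (1 / 8) (c / (2 * pi ^+ 2)).
have p0 : 0 < 2 * pi ^+ 2 :> R by rewrite mulr_gt0 // exprn_gt0 // pi_gt0.
have d0 : 0 < d by rewrite lt_min e8 divr_gt0.
have dc : 2 * pi ^+ 2 * d <= c by rewrite mulrC -ler_pdivlMr // ge_min lexx orbT.
have [r pr] := profile_exists_d d0.
exists r; do 3 eexists; split; first exact: profile_le dc pr.
move=> q; rewrite lt_min => /andP[q1 q2].
have q01 : 0 < q < 1 by move: q2; rewrite ltr_norml => /andP[? ?]; apply/andP; split; lra.
rewrite /cutoff01 q01.
have d8 : d <= 1 / 8 by rewrite ge_min lexx.
have := h q; rewrite /ball /= distrC => /(_ q1); rewrite S4 ltr_norml => /andP[_ s1].
have s2 := S_le1 q; have s0 := S_gt0 q01.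
rewrite ler_pdivlMr // pp_pos ?subr_ge0; last by lra.
nra.
Qed.

End Profile.

(** * A trial function with Rayleigh quotient below pi^2 *)

Section Trial.
Variable R : realType.
Implicit Types (f g : R * R -> R).
Local Notation H := (@hersch R).
Local Notation T2 := (measurableTypeR R * measurableTypeR R)%type.

Definition rect (a b c d : R) : set (R * R) := [set x | (a <= x.1 <= b) && (c <= x.2 <= d)].

Lemma rectE a b c d : rect a b c d = (`[a, b]%classic : set R) `*` (`[c, d]%classic : set R).
Proof. by apply/seteqP; split => x /=; rewrite !in_itv /= => /andP. Qed.

Lemma rect_meas a b c d : measurable (rect a b c d : set T2).
Proof. by rewrite rectE; apply: measurableX; exact: measurable_itv. Qed.

Lemma Bc_rect a b c d : Bc (\1_(rect a b c d) : R * R -> R).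
Proof.
split; first exact: (@measurable_indic _ T2 R setT _ (rect_meas a b c d)).
exists (1 + `|a| + `|b| + `|c| + `|d|) => x; split.
  rewrite indicE; case: (_ \in _); rewrite ?normr0 ?normr1 -?addrA ?lerDl ?addr_ge0 //.
move=> h; rewrite indicE memNset // /rect /= => /andP[/andP[h1 h2] /andP[h3 h4]].
have := ler_norm a; have := ler_norm (- a); have := ler_norm b; have := ler_norm (- b).
have := ler_norm c; have := ler_norm (- c); have := ler_norm d; have := ler_norm (- d).
rewrite !normrN => *.
have := normr_ge0 a; have := normr_ge0 b; have := normr_ge0 c; have := normr_ge0 d => *.
have n1 : `|x.1| <= `|a| + `|b| by rewrite ler_norml; apply/andP; split; lra.
have n2 : `|x.2| <= `|c| + `|d| by rewrite ler_norml; apply/andP; split; lra.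
by case: h; lra.
Qed.

Lemma int2_rect a b c d : a <= b -> c <= d -> int2 (\1_(rect a b c d) : R * R -> R) = (b - a) * (d - c).
Proof.
move=> ab cd; apply: EFin_inj; rewrite -EFin_int2; last exact: Bc_rect.
rewrite integral_indic //; last exact: rect_meas.
rewrite setIT rectE.
have m1 := @measurable_itv R `[a, b]%R; have m2 := @measurable_itv R `[c, d]%R.
transitivity (lebesgue_measure (`[a, b]%classic : set R) * lebesgue_measure (`[c, d]%classic : set R))%E.
  exact: (@product_measure1E _ _ (measurableTypeR R) (measurableTypeR R) R lebesgue_measure lebesgue_measure _ _ m1 m2).
rewrite !lebesgue_measure_itv /= !lte_fin EFinM; congr (_ * _)%E.
  by case: ltP => //= ba; rewrite (le_anti (introT andP (conj ab ba))) subrr.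
by case: ltP => //= ba; rewrite (le_anti (introT andP (conj cd ba))) subrr.
Qed.

Lemma lambda1_lt (A : set (R * R)) f f1 f2 c : C1c A f f1 f2 -> energy f1 f2 < c * nrm2 f ->
  0 <= c -> (lambda1 A < c%:E)%E.
Proof.
move=> h lt c0.
have n0 : 0 < nrm2 f.
  rewrite lt_def nrm2_ge0 andbT; apply/eqP => n0; move: lt; rewrite n0 mulr0.
  by rewrite ltNge energy_ge0.
pose k := (Num.sqrt (nrm2 f))^-1.
have k2 : k ^+ 2 = (nrm2 f)^-1 by rewrite exprVn sqr_sqrtr // ltW.
have EZ := energyZ k (C1c_Bc1 h) (C1c_Bc2 h); have NZ := nrm2Z k (C1c_Bc h).
have := lambda1_le (C1cZ k h); rewrite NZ EZ k2 mulVf ?gt_eqF // => /(_ erefl) /le_lt_trans; apply.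
by rewrite lte_fin mulrC ltr_pdivrMr.
Qed.

Lemma sqr_lt1 (t : R) : t ^+ 2 < 1 -> -1 < t < 1.
Proof. by rewrite -real_normK ?num_real // expr_lt1 // ltr_norml. Qed.

Section trial.
Variables (c r M : R) (B B1 K1 : R -> R).
Hypothesis pr : profile c r B B1 K1.
Hypothesis M0 : 0 < M.
Hypothesis c0 : 0 <= c.

(* The strip profile, rotated around the origin in the bend and multiplied there by 1 - x1^2/4, which
   brings the energy below pi^2; [be] cuts the strips off at x1 = M. *)
Let al (t : R) : R := 1 - pp 2 (- t) / 4.
Let al1 (t : R) : R := pp 1 (- t) / 2.
Let be (t : R) : R := pp 2 (1 - pp 2 t / M ^+ 2).
Let be1 (t : R) : R := - (4 * pp 1 (1 - pp 2 t / M ^+ 2) * pp 1 t / M ^+ 2).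
Let Fn t := al t * be t.
Let Fn1 t := al1 t * be t + al t * be1 t.
Let q (x : R * R) : R := pp 2 (- x.1) + x.2 ^+ 2.
Definition trial_u (x : R * R) : R := Fn x.1 * B (q x).
Definition trial_u1 (x : R * R) : R := Fn1 x.1 * B (q x) + Fn x.1 * (B1 (q x) * (- 2 * pp 1 (- x.1))).
Definition trial_u2 (x : R * R) : R := Fn x.1 * (B1 (q x) * (2 * x.2)).

Lemma dv_pp2N (t : R) : is_derive t 1 (fun t : R => pp 2 (- t)) (- 2 * pp 1 (- t)).
Proof.
by apply: dv_eq (dv_comp (dv_pp 0 (- t)) (dvN (dv_id t))) _; rewrite mulrN1 mulNr.
Qed.

Lemma dv_al (t : R) : is_derive t 1 al (al1 t).
Proof.
have h := dvB (dvC 1 t) (dvM (dv_pp2N t) (dvC 4^-1 t)).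
by apply: dv_eq h _; rewrite /al1 mulr0 addr0 sub0r; field.
Qed.

Lemma dv_be (t : R) : is_derive t 1 be (be1 t).
Proof.
have h := dvB (dvC 1 t) (dvM (dv_pp 0 t) (dvC (M ^+ 2)^-1 t)).
apply: dv_eq (dv_comp (dv_pp 0 _) h) _.
by rewrite /be1 mulr0 addr0 sub0r; field; rewrite gt_eqF.
Qed.

Lemma dv_Fn (t : R) : is_derive t 1 Fn (Fn1 t).
Proof. exact: dvM (dv_al t) (dv_be t). Qed.

Lemma cont_fst_comp (F : R -> R) : continuous F -> continuous (fun x : R * R => F x.1).
Proof. by move=> cF x; apply: (@continuous_comp _ _ _ (fun x : R * R => x.1) F); [exact: cvg_fst|exact: cF]. Qed.

Lemma cont_snd_comp (F : R -> R) : continuous F -> continuous (fun x : R * R => F x.2).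
Proof. by move=> cF x; apply: (@continuous_comp _ _ _ (fun x : R * R => x.2) F); [exact: cvg_snd|exact: cF]. Qed.

Lemma cont_ppN n : continuous (fun t : R => pp n (- t)).
Proof. by move=> t; apply: (@continuous_comp _ _ _ (fun t : R => - t) (pp n)); [exact: oppr_continuous|exact: cont_pp]. Qed.

Lemma cont_q : continuous q.
Proof.
apply: contD; first exact: (cont_fst_comp (@cont_ppN 2)).
by apply: (cont_snd_comp (F := fun t => t ^+ 2)); exact: exprn_continuous.
Qed.

Lemma cont_comp1 (F : R -> R) (g : R * R -> R) : continuous F -> continuous g -> continuous (fun x => F (g x)).
Proof. by move=> cF cg x; apply: continuous_comp; [exact: cg|exact: cF]. Qed.

Lemma cont_be1 : continuous be1.
Proof.
have c1 : continuous (fun t : R => 1 - pp 2 t / M ^+ 2).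
  by move=> t; exact: dv_continuous (dvB (dvC 1 t) (dvM (dv_pp 0 t) (dvC (M ^+ 2)^-1 t))).
move=> t; apply: cvgN; apply: cvgM; last exact: cvg_cst.
apply: cvgM; last exact: cont_pp.
apply: cvgM; first exact: cvg_cst.
by apply: (@continuous_comp _ _ _ (fun t : R => 1 - pp 2 t / M ^+ 2) (@pp R 1)); [exact: c1|exact: cont_pp].
Qed.

Lemma cont_Fn1 : continuous Fn1.
Proof.
move=> t; apply: cvgD; apply: cvgM.
- by apply: cvgM; [exact: cont_ppN|exact: cvg_cst].
- exact: dv_continuous (dv_be t).
- exact: dv_continuous (dv_al t).
- exact: cont_be1.
Qed.

Lemma be_0 t : M < t -> be t = 0.
Proof.
move=> Mt; have t0 : 0 < t := lt_trans M0 Mt.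
rewrite /be pp_neg // subr_le0 ler_pdivlMr ?exprn_gt0 // mul1r pp_pos ?(ltW t0) //.
by rewrite ler_sqr ?nnegrE ?ltW.
Qed.

Lemma trial_supp : supp_in H trial_u.
Proof.
have r0 := prof_r pr.
exists [set x | r <= q x <= 1 - r /\ x.1 <= M]; split.
- have sub (x : R * R) : r <= q x <= 1 - r -> x.1 <= M ->
      [/\ - (M + 1) <= x.1, x.1 <= M + 1, - (M + 1) <= x.2 & x.2 <= M + 1].
    move=> /andP[q1 q2] xM; have p2 : 0 <= pp 2 (- x.1) by exact: pp_ge0.
    have s2 := sqr_ge0 x.2; rewrite /q in q1 q2.
    have /sqr_lt1 /andP[a1 a2] : x.2 ^+ 2 < 1 by lra.
    have M0' := M0; split; try lra.
    have [|x0] := leP 0 x.1; first by lra.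
    move: q2; rewrite pp_pos ?sqrrN; last by lra.
    by move=> q2; have /sqr_lt1 /andP[x1 _] : x.1 ^+ 2 < 1; lra.
  apply: (subclosed_compact _ (@compact_box R (M + 1))).
    have -> : [set x | r <= q x <= 1 - r /\ x.1 <= M] =
       (q @^-1` [set t | r <= t] `&` q @^-1` [set t | t <= 1 - r]) `&` (fun x : R * R => x.1) @^-1` [set t | t <= M].
      by apply/seteqP; split => x /= [/andP].
    apply: closedI; first apply: closedI.
    + by apply: closed_comp; [move=> x _; exact: cont_q|exact: closed_ge].
    + by apply: closed_comp; [move=> x _; exact: cont_q|exact: closed_le].
    + by apply: closed_comp; [move=> x _; exact: cvg_fst|exact: closed_le].
  move=> x [qx xM]; have [? ? ? ?] := sub x qx xM.
  by split; rewrite /= in_itv /=; apply/andP.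
- move=> x [/andP[q1 q2] xM]; rewrite /q in q1 q2.
  have [x0|x0] := ltP x.1 0.
    by left; split => //; move: q1 q2; rewrite pp_pos ?sqrrN; lra.
  right; split => //; move: q1 q2; rewrite pp_neg ?add0r; last by lra.
  rewrite -(@real_normK _ x.2) ?num_real // => q1 q2; apply/andP; split.
    by rewrite lt_def normr_ge0 andbT; apply/eqP => e; move: q1; rewrite e expr0n /=; lra.
  by rewrite -(@expr_lt1 _ 2) //; lra.
- move=> x nx; rewrite /trial_u; have [xM|xM] := leP x.1 M.
    rewrite (prof_0 pr) ?mulr0 //; apply/negP => /andP[q1 q2]; apply: nx; split => //.
    by rewrite !ltW.
  by rewrite /Fn be_0 // mulr0 mul0r.
Qed.

Lemma trial_C1c : C1c H trial_u trial_u1 trial_u2.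
Proof.
have cB : continuous B by move=> t; exact: dv_continuous (prof_dv pr t).
have cB1 := prof_c1 pr.
have cFn : continuous Fn by move=> t; exact: dv_continuous (dv_Fn t).
split; last exact: trial_supp.
- apply: contD; apply: contM.
  + exact: (cont_fst_comp cont_Fn1).
  + exact: (cont_comp1 cB cont_q).
  + exact: (cont_fst_comp cFn).
  + apply: contM; first exact: (cont_comp1 cB1 cont_q).
    by apply: contZ; exact: (cont_fst_comp (@cont_ppN 1)).
- apply: contM; first exact: (cont_fst_comp cFn).
  apply: contM; first exact: (cont_comp1 cB1 cont_q).
  by apply: contZ => x; exact: cvg_snd.
- move=> x; have hq : is_derive x.1 1 (fun t : R => q (t, x.2)) (- 2 * pp 1 (- x.1)).
    by apply: dv_eq (dvD (dv_pp2N x.1) (dvC (x.2 ^+ 2) x.1)) _; rewrite addr0.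
  apply: dv_eq (dvM (dv_Fn x.1) (dv_comp (prof_dv pr _) hq)) _.
  by rewrite /trial_u1 /q.
- move=> x; have hq : is_derive x.2 1 (fun t : R => q (x.1, t)) (2 * x.2).
    apply: dv_eq (dvD (dvC (pp 2 (- x.1)) x.2) (dvX 2 (dv_id x.2))) _.
    by rewrite add0r mulr1 /= expr1.
  apply: dv_eq (dvM (dvC (Fn x.1) x.2) (dv_comp (prof_dv pr _) hq)) _.
  by rewrite mul0r add0r /trial_u2 /q.
Qed.

(* the field x w^2 G of the bend, w = 1 - x1^2/4, as a function of q = |x|^2 *)
Let Gm (q : R) : R := 2 * (B q * B1 q) - B q ^+ 2 / (2 * q).
Let Gm1 (q : R) : R := 2 * K1 q - B q * B1 q / q + B q ^+ 2 / (2 * q ^+ 2).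
Let w (x : R * R) : R := 1 - x.1 ^+ 2 / 4.
Let rho2 (x : R * R) : R := x.1 ^+ 2 + x.2 ^+ 2.
Let V1 x := x.1 * w x ^+ 2 * Gm (rho2 x).
Let V2 x := x.2 * w x ^+ 2 * Gm (rho2 x).
Let dV1 x := (w x ^+ 2 + x.1 * (2 * w x * (- x.1 / 2))) * Gm (rho2 x) + x.1 * w x ^+ 2 * (Gm1 (rho2 x) * (2 * x.1)).
Let dV2 x := w x ^+ 2 * Gm (rho2 x) + x.2 * w x ^+ 2 * (Gm1 (rho2 x) * (2 * x.2)).

Lemma Gm_0 t : ~~ (r < t < 1 - r) -> Gm t = 0.
Proof. by move=> h; rewrite /Gm (prof_0 pr h) mul0r mulr0 expr0n mul0r subrr. Qed.

Lemma Gm_near t : t < r -> \forall y \near t, Gm y = 0.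
Proof. by move=> tr; apply: filterS (near_lt tr) => y yr; apply: Gm_0; rewrite negb_and -leNgt ltW. Qed.

Lemma Gm1_near t : t < r -> \forall y \near t, Gm1 y = 0.
Proof.
move=> tr; apply: filterS (near_lt tr) => y yr.
have B0 z : z < r -> B z = 0 by move=> zr; apply: (prof_0 pr); rewrite negb_and -leNgt ltW.
have K0 : K1 y = 0.
  apply: (dv_uniq (prof_dvK pr y)); apply: dv_near (dvC 0 y).
  by apply: filterS (near_lt yr) => z zr; rewrite B0 // mul0r.
by rewrite /Gm1 K0 B0 // expr0n !mul0r mulr0 subrr addr0.
Qed.

Lemma dv_Gm (t : R) : is_derive t 1 Gm (Gm1 t).
Proof.
have r0 := prof_r pr; have [tr|tr] := ltP t r.
  rewrite (nbhs_singleton (Gm1_near tr)); apply: dv_near (dvC 0 t).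
  by apply: filterS (Gm_near tr) => y ->.
have t0 : t != 0 by rewrite gt_eqF //; exact: lt_le_trans tr.
have t2 : 2 * t != 0 by rewrite mulf_neq0.
apply: dv_eq (dvB (dvZ 2 (prof_dvK pr t)) (dv_div (dvX 2 (prof_dv pr t)) (dvZ 2 (dv_id t)) t2)) _.
by rewrite /Gm1 /= expr1; field.
Qed.

Lemma cont_Gm1 : continuous Gm1.
Proof.
move=> t; have r0 := prof_r pr; have [tr|tr] := ltP t r.
  rewrite /continuous_at (nbhs_singleton (Gm1_near tr)); apply: cvg_near_cst.
  exact: Gm1_near.
have t0 : t != 0 by rewrite gt_eqF //; exact: lt_le_trans tr.
have i : {for t, continuous (fun t : R => t)} by exact: cvg_id.
apply: cvgD; first apply: cvgB.
- by apply: cvgM; [exact: cvg_cst|exact: (prof_cK pr)].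
- apply: cvgM; first exact: dv_continuous (prof_dvK pr t).
  by apply: cvgV.
- apply: cvgM; first by apply: cont_exp; exact: dv_continuous (prof_dv pr t).
  apply: cvgV; first by rewrite mulf_neq0 // expf_neq0.
  by apply: cvgM; [exact: cvg_cst|exact: (@cont_exp _ 2 (fun s => s) t i)].
Qed.

Lemma cont_rho2 : continuous rho2.
Proof.
by apply: contD; [apply: (cont_fst_comp (F := fun t => t ^+ 2))|apply: (cont_snd_comp (F := fun t => t ^+ 2))]; exact: exprn_continuous.
Qed.

Lemma cont_w2 : continuous (fun x => w x ^+ 2).
Proof.
apply: (cont_fst_comp (F := fun t => (1 - t ^+ 2 / 4) ^+ 2)) => t.
by apply: dv_continuous (dvX 2 (dvB (dvC 1 t) (dvM (dvX 2 (dv_id t)) (dvC 4^-1 t)))).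
Qed.

Lemma dv_V1 x : pd1 V1 x (dV1 x).
Proof.
have hw : is_derive x.1 1 (fun t : R => 1 - t ^+ 2 / 4) (- x.1 / 2).
  apply: dv_eq (dvB (dvC 1 x.1) (dvM (dvX 2 (dv_id x.1)) (dvC 4^-1 x.1))) _.
  by rewrite /= expr1; field.
have hr : is_derive x.1 1 (fun t : R => rho2 (t, x.2)) (2 * x.1).
  apply: dv_eq (dvD (dvX 2 (dv_id x.1)) (dvC (x.2 ^+ 2) x.1)) _.
  by rewrite addr0 mulr1 /= expr1.
apply: dv_eq (dvM (dvM (dv_id x.1) (dvX 2 hw)) (dv_comp (dv_Gm _) hr)) _.
by rewrite /dV1 /rho2 /w /= expr1; ring.
Qed.

Lemma dv_V2 x : pd2 V2 x (dV2 x).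
Proof.
have hr : is_derive x.2 1 (fun t : R => rho2 (x.1, t)) (2 * x.2).
  apply: dv_eq (dvD (dvC (x.1 ^+ 2) x.2) (dvX 2 (dv_id x.2))) _.
  by rewrite add0r mulr1 /= expr1.
apply: dv_eq (dvM (dvM (dv_id x.2) (dvC (w x ^+ 2) x.2)) (dv_comp (dv_Gm _) hr)) _.
by rewrite /dV2 /rho2 /w /=; ring.
Qed.

Lemma cont_dV1 : continuous dV1.
Proof.
have c1 : continuous (fun x : R * R => x.1) by move=> x; exact: cvg_fst.
have cG : continuous Gm by move=> t; exact: dv_continuous (dv_Gm t).
have cw : continuous w.
  apply: (cont_fst_comp (F := fun t => 1 - t ^+ 2 / 4)) => t.
  by apply: dv_continuous (dvB (dvC 1 t) (dvM (dvX 2 (dv_id t)) (dvC 4^-1 t))).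
apply: contD; apply: contM.
- apply: contD; first exact: cont_w2.
  apply: contM => //; apply: contM; first exact: contZ.
  by apply: (cont_fst_comp (F := fun t => - t / 2)) => t; exact: dv_continuous (dvM (dvN (dv_id t)) (dvC 2^-1 t)).
- exact: (cont_comp1 cG cont_rho2).
- by apply: contM => //; exact: cont_w2.
- by apply: contM; [exact: (cont_comp1 cont_Gm1 cont_rho2)|exact: contZ].
Qed.

Lemma cont_dV2 : continuous dV2.
Proof.
have c2 : continuous (fun x : R * R => x.2) by move=> x; exact: cvg_snd.
have cG : continuous Gm by move=> t; exact: dv_continuous (dv_Gm t).
apply: contD; apply: contM.
- exact: cont_w2.
- exact: (cont_comp1 cG cont_rho2).
- by apply: contM => //; exact: cont_w2.
- by apply: contM; [exact: (cont_comp1 cont_Gm1 cont_rho2)|exact: contZ].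
Qed.

Lemma V_supp h : supp_in setT (fun x => h x * Gm (rho2 x)).
Proof.
exists (`[- 1, 1] `*` `[- 1, 1]); split => //; first exact: compact_box.
move=> x nx; rewrite Gm_0 ?mulr0 //; apply/negP => /andP[_ h1]; apply: nx.
have r0 := prof_r pr; have s1 := sqr_ge0 x.1; have s2 := sqr_ge0 x.2.
rewrite /rho2 in h1.
by split; rewrite /= in_itv /=; apply/andP; split; nra.
Qed.

(** The divergence of (V1, V2) reproduces w^2 times the exact part of [prof_ineq], cancels the cross
    term of the energy and leaves x1^2 B^2 w / (2 |x|^2) >= 3 x1^2 B^2 / 8, since w >= 3/4 and |x| <
    1. The factor w costs only (w')^2 B^2 = x1^2 B^2 / 4; the difference is the gain with 1/8. *)
Lemma bend_pointwise x : x.1 < 0 ->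
  trial_u1 x ^+ 2 + trial_u2 x ^+ 2 - pi ^+ 2 * trial_u x ^+ 2 <=
  dV1 x + dV2 x + c * \1_(rect (-1) 1 (-1) 1) x - x.1 ^+ 2 * B (rho2 x) ^+ 2 / 8.
Proof.
move=> x0; have qE : q x = rho2 x by rewrite /q /rho2 pp_pos ?sqrrN //; lra.
have p1 : pp 1 (- x.1) = - x.1 by rewrite pp_pos ?expr1 //; lra.
have p2 : pp 2 (- x.1) = x.1 ^+ 2 by rewrite pp_pos ?sqrrN //; lra.
have b1 : be x.1 = 1 by rewrite /be [pp 2 x.1]pp_neg ?(ltW x0) // mul0r subr0 pp_pos // expr1n.
have b2 : be1 x.1 = 0 by rewrite /be1 [pp 1 x.1]pp_neg ?(ltW x0) // mulr0 mul0r oppr0.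
have a1 : al x.1 = w x by rewrite /al p2.
have a2 : al1 x.1 = - x.1 / 2 by rewrite /al1 p1.
rewrite /trial_u /trial_u1 /trial_u2 /Fn /Fn1 b1 b2 a1 a2 p1 qE !(mulr1, mulr0, addr0).
have [h|h] := boolP (0 < rho2 x < 1); last first.
  have B0 : B (rho2 x) = 0.
    apply: (prof_0 pr); apply: contra h => /andP[h1 h2]; have := prof_r pr => r0.
    by apply/andP; split; lra.
  have [B10 K10] := prof_out pr h.
  rewrite /dV1 /dV2 /Gm /Gm1 B0 B10 K10 expr0n /= !(mulr0, mul0r, subr0, addr0, expr0n) /= ?subr0.
  by rewrite add0r mulr_ge0 // indicE ler0n.
have /andP[h0 h1] := h; have qn : rho2 x != 0 by rewrite gt_eqF.
have s1 := sqr_ge0 x.1; have s2 := sqr_ge0 x.2.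
have -> : \1_(rect (-1) 1 (-1) 1) x = 1 :> R.
  rewrite indicE mem_set //= /rect /=; rewrite /rho2 in h1.
  by apply/andP; split; apply/andP; split; nra.
rewrite mulr1.
have key : dV1 x + dV2 x = w x ^+ 2 * (2 * (B (rho2 x) * B1 (rho2 x)) + 4 * rho2 x * K1 (rho2 x))
    - 2 * x.1 ^+ 2 * w x * (B (rho2 x) * B1 (rho2 x)) + x.1 ^+ 2 * B (rho2 x) ^+ 2 * (w x / (2 * rho2 x)).
  have -> : dV1 x + dV2 x = (w x ^+ 2 - x.1 ^+ 2 * w x) * Gm (rho2 x) + w x ^+ 2 * Gm (rho2 x) + 2 * rho2 x * (w x ^+ 2 * Gm1 (rho2 x)).
    rewrite /dV1 /dV2; move: (Gm (rho2 x)) (Gm1 (rho2 x)) => G G1; rewrite /rho2; by field.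
  by rewrite /Gm /Gm1; field.
have wx : 3 / 4 <= w x <= 1 by rewrite /w; rewrite /rho2 in h1; apply/andP; split; lra.
have /andP[w1 w2] := wx.
have zz : 3 / 8 <= w x / (2 * rho2 x) by rewrite ler_pdivlMr ?mulr_gt0 //; lra.
have in1 := prof_ineq pr h.
rewrite key -subr_ge0.
set b := B (rho2 x) in in1 *; set b1' := B1 (rho2 x) in in1 *; set k1 := K1 (rho2 x) in in1 *.
have e1 : 0 <= w x ^+ 2 * (2 * (b * b1') + 4 * rho2 x * k1 + c - (4 * rho2 x * b1' ^+ 2 - pi ^+ 2 * b ^+ 2)).
  by rewrite mulr_ge0 ?sqr_ge0 // subr_ge0.
have e2 : 0 <= c * (1 - w x ^+ 2) by rewrite mulr_ge0 // subr_ge0; nra.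
have e3 : 0 <= x.1 ^+ 2 * b ^+ 2 * (w x / (2 * rho2 x) - 3 / 8).
  by rewrite mulr_ge0 ?subr_ge0 // mulr_ge0 ?sqr_ge0.
have := addr_ge0 (addr_ge0 e1 e2) e3; congr (0 <= _).
by move: (w x / (2 * rho2 x)) => Z; rewrite /rho2; field.
Qed.

(** [be] is 1 on the whole half-line t <= 0. The second factor makes [dP] compactly supported, and
    it is 1 for t >= 0, where [dP] is evaluated. *)
Let be' (t : R) : R := be t * pp 2 (1 - pp 2 (- t)).
(** The x2-derivative of be'(x1)^2 times 2 x2 (B B1)(x2^2). *)
Let dP (x : R * R) : R := be' x.1 ^+ 2 * (2 * (B (x.2 ^+ 2) * B1 (x.2 ^+ 2)) + 4 * x.2 ^+ 2 * K1 (x.2 ^+ 2)).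

Lemma be'_pos t : 0 <= t -> be' t = be t.
Proof. by move=> t0; rewrite /be' [pp 2 (- t)]pp_neg ?oppr_le0 // subr0 [pp 2 1]pp_pos // expr1n mulr1. Qed.

Lemma cont_be' : continuous be'.
Proof.
move=> t; apply: cvgM; first exact: dv_continuous (dv_be t).
apply: (@continuous_comp _ _ _ (fun t : R => 1 - pp 2 (- t)) (@pp R 2)); last exact: cont_pp.
by apply: cvgB; [exact: cvg_cst|exact: cont_ppN].
Qed.

Lemma dv_x2 (F F' : R -> R) : (forall t : R, is_derive t 1 F (F' t)) ->
  forall t : R, is_derive t 1 (fun t => F (t ^+ 2)) (F' (t ^+ 2) * (2 * t)).
Proof.
move=> h t; apply: dv_eq (dv_comp (h _) (dvX 2 (dv_id t))) _.
by rewrite mulr1 /= expr1.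
Qed.

Lemma cont_x2 (F : R -> R) : continuous F -> continuous (fun x : R * R => F (x.2 ^+ 2)).
Proof.
move=> cF; apply: (cont_snd_comp (F := fun t => F (t ^+ 2))) => t.
by apply: (@continuous_comp _ _ _ (fun t : R => t ^+ 2) F); [exact: exprn_continuous|exact: cF].
Qed.

Lemma cont_dP : continuous dP.
Proof.
have cB : continuous B by move=> t; exact: dv_continuous (prof_dv pr t).
apply: contM.
  apply: (cont_fst_comp (F := fun t => be' t ^+ 2)) => t; apply: (@cont_exp _ 2 be'); exact: cont_be'.
apply: contD.
  by apply: contZ; apply: contM; apply: cont_x2 => //; exact: (prof_c1 pr).
apply: contM; last by apply: cont_x2; exact: (prof_cK pr).
by apply: contZ; apply: (cont_snd_comp (F := fun t => t ^+ 2)); exact: exprn_continuous.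
Qed.

Lemma BK0 t : ~~ (0 < t < 1) -> [/\ B t = 0, B1 t = 0 & K1 t = 0].
Proof.
move=> h; have [B10 K10] := prof_out pr h; split => //.
apply: (prof_0 pr); apply: contra h => /andP[h1 h2]; have := prof_r pr => r0.
by apply/andP; split; lra.
Qed.

Lemma dP_supp : supp_in setT dP.
Proof.
exists (`[- (M + 1), M + 1] `*` `[- (M + 1), M + 1]); split => //; first exact: compact_box.
suff H0 (x : R * R) : ~ [/\ - (M + 1) <= x.1, x.1 <= M + 1, - (M + 1) <= x.2 & x.2 <= M + 1] -> dP x = 0.
  move=> x nx; apply: H0 => -[a1 a2 a3 a4]; apply: nx.
  by split; rewrite /= in_itv /=; apply/andP.
move=> nx; rewrite /dP.
have [h|h] := boolP (0 < x.2 ^+ 2 < 1); last first.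
  by have [-> -> ->] := BK0 h; rewrite !(mulr0, addr0).
have [h1|h1] := ltP M x.1; first by rewrite /be' be_0 // mul0r expr0n mul0r.
have [h2|h2] := ltP x.1 (-1).
  rewrite /be' [pp 2 (1 - _)]pp_neg ?mulr0 ?expr0n ?mul0r //.
  by rewrite subr_le0 pp_pos; nra.
by exfalso; apply: nx; have M0' := M0; case/andP: h => _ /sqr_lt1 /andP[? ?]; split; lra.
Qed.

Lemma Bc_dP : Bc dP. Proof. exact: Bc_cont cont_dP dP_supp. Qed.

Lemma int_dP : int2 (fun x => (0 <= x.1)%R%:R * dP x) = 0.
Proof.
apply: (@int2_pd2_slices _ (fun t => 0 <= t)); first exact: (Bc_pos Bc_dP).
move=> a _; exists (fun t => be' a ^+ 2 * (2 * t * (B (t ^+ 2) * B1 (t ^+ 2)))), 1; split.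
- move=> t; apply: dv_eq (dvZ _ (dvM (dvZ 2 (dv_id t)) (dv_x2 (prof_dvK pr) t))) _.
  by rewrite /dP /=; ring.
- by move=> t; exact: (@cont_slice2 R dP a cont_dP t).
- move=> t t1; have [-> _ _] : [/\ B (t ^+ 2) = 0, B1 (t ^+ 2) = 0 & K1 (t ^+ 2) = 0].
    apply: BK0; rewrite negb_and -!leNgt; apply/orP; right.
    by rewrite -real_normK ?num_real // expr_ge1 ?(ltW t1).
  by rewrite mul0r !mulr0.
Qed.

(** The profile contributes [dP] up to the error [c], and 16 / M^2 bounds the squared derivative of
    the cut-off (1 - x1^2 / M^2)^2 on [0, M]. *)
Lemma strip_pointwise x : 0 <= x.1 ->
  trial_u1 x ^+ 2 + trial_u2 x ^+ 2 - pi ^+ 2 * trial_u x ^+ 2 <=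
  dP x + (16 / M ^+ 2 + c) * \1_(rect 0 M (-1) 1) x.
Proof.
move=> x0; have qE : q x = x.2 ^+ 2 by rewrite /q pp_neg ?add0r //; lra.
have p1 : pp 1 (- x.1) = 0 by rewrite pp_neg //; lra.
have a1 : al x.1 = 1 by rewrite /al pp_neg ?mul0r ?subr0 //; lra.
have a2 : al1 x.1 = 0 by rewrite /al1 p1 mul0r.
have m0 : 0 < M ^+ 2 by rewrite exprn_gt0.
have cc : 0 <= 16 / M ^+ 2 + c by rewrite addr_ge0 // divr_ge0 // ltW.
rewrite /trial_u /trial_u1 /trial_u2 /Fn /Fn1 a1 a2 p1 qE /dP be'_pos // !(mul1r, mul0r, mulr0, addr0, add0r).
have [h|h] := boolP (0 < x.2 ^+ 2 < 1); last first.
  have [-> -> ->] := BK0 h.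
  have : 0 <= (16 / M ^+ 2 + c) * \1_(rect 0 M (-1) 1) x by rewrite mulr_ge0 // indicE ler0n.
  by move: ((16 / M ^+ 2 + c) * _) => Z Z0; lra.
have [xM|xM] := ltP M x.1.
  have b0 := be_0 xM.
  have b1 : be1 x.1 = 0.
    rewrite /be1 [pp 1 (1 - _)]pp_neg ?mulr0 ?mul0r ?oppr0 //.
    by rewrite subr_le0 ler_pdivlMr // mul1r pp_pos //; have M0' := M0; nra.
  rewrite b0 b1.
  have : 0 <= (16 / M ^+ 2 + c) * \1_(rect 0 M (-1) 1) x by rewrite mulr_ge0 // indicE ler0n.
  by move: ((16 / M ^+ 2 + c) * _) => Z Z0; lra.
have -> : \1_(rect 0 M (-1) 1) x = 1 :> R.
  rewrite indicE mem_set //= /rect /= x0 xM /=; case/andP: h => _ h.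
  by apply/andP; split; nra.
have pM : pp 2 x.1 / M ^+ 2 <= 1.
  by rewrite ler_pdivrMr // mul1r pp_pos // ler_sqr ?nnegrE // ltW.
have p0 : 0 <= pp 2 x.1 / M ^+ 2 by rewrite divr_ge0 ?pp_ge0 // ltW.
have P1 : 0 <= 1 - pp 2 x.1 / M ^+ 2 <= 1 by apply/andP; split; lra.
have beE : be x.1 = (1 - pp 2 x.1 / M ^+ 2) ^+ 2 by rewrite /be pp_pos //; case/andP: P1.
have be_le : 0 <= be x.1 ^+ 2 <= 1.
  rewrite sqr_ge0 beE -exprM /=; apply: exprn_ile1; case/andP: P1 => //.
have b1_le : be1 x.1 ^+ 2 <= 16 / M ^+ 2.
  rewrite /be1 sqrrN [pp 1 x.1]pp_pos // expr1 pp_pos ?expr1; last by case/andP: P1.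
  set p := 1 - _ in P1 *; have -> : (4 * p * x.1 / M ^+ 2) ^+ 2 = 16 / M ^+ 2 * (p ^+ 2 * (x.1 / M) ^+ 2).
    by field; rewrite gt_eqF.
  rewrite -[X in _ <= X]mulr1 ler_wpM2l ?divr_ge0 ?(ltW m0) //.
  have xM1 : 0 <= x.1 / M <= 1 by rewrite divr_ge0 ?(ltW M0) //= ler_pdivrMr // mul1r.
  have y2 : (x.1 / M) ^+ 2 <= 1 by apply: exprn_ile1; case/andP: xM1.
  have y1 : p ^+ 2 <= 1 by apply: exprn_ile1; case/andP: P1.
  by rewrite mulr_ile1 ?sqr_ge0.
have := prof_ineq pr h; have /andP[B0 B11] := prof_01 pr (x.2 ^+ 2).
move: B0 B11; move: (B (x.2 ^+ 2)) (B1 (x.2 ^+ 2)) (K1 (x.2 ^+ 2)) => Bq B1q K1q B0 B11 in1.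
have e1 := mulr_ge0 (proj1 (andP be_le)) (etrans (subr_ge0 _ _) in1).
have e2 : be1 x.1 ^+ 2 * Bq ^+ 2 <= 16 / M ^+ 2.
  apply: le_trans b1_le; rewrite -[X in _ <= X]mulr1 ler_wpM2l ?sqr_ge0 //.
  by apply: exprn_ile1.
have e3 : be x.1 ^+ 2 * c <= c by rewrite -[X in _ <= X]mul1r ler_wpM2r //; case/andP: be_le.
move: e1 e2 e3; rewrite mulr1; move: (16 / M ^+ 2) (be x.1) (be1 x.1) (x.2) (pi : R) => Z b b1 y p e1 e2 e3.
by nra.
Qed.

(** The errors are densities times the areas 4 and 2 M of two rectangles. The gain is 1/512 = 1/8
    times 1/16 times 1/4 on the square of side 2 h around (-1/2, 0), where x1^2 >= 1/16 and B >=
    1/2; there |x|^2 differs from 1/4 by at most h (1 + 2 h). *)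
Lemma trial_energy h : 0 < h <= 1 / 4 -> (forall t, `|t - 1 / 4| <= h * (1 + 2 * h) -> 1 / 2 <= B t) ->
  energy trial_u1 trial_u2 - pi ^+ 2 * nrm2 trial_u <= 4 * c + 32 / M + 2 * M * c - h ^+ 2 / 128.
Proof.
move=> /andP[h0 h4] hB.
have hu := trial_C1c; have bu := C1c_Bc hu; have bu1 := C1c_Bc1 hu; have bu2 := C1c_Bc2 hu.
have [bg Qe] := Qf_int (pi ^+ 2) bu bu1 bu2.
rewrite -[energy _ _ - _]/(Qf (pi ^+ 2) trial_u trial_u1 trial_u2) Qe (int2_split bg).
have bV1 : Bc dV1 := Bc_cont cont_dV1 (pd1_supp dv_V1 (V_supp _)).
have bV2 : Bc dV2 := Bc_cont cont_dV2 (pd2_supp dv_V2 (V_supp _)).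
have iV1 : int2 (fun x => (x.1 < 0)%R%:R * dV1 x) = 0.
  by apply: (int2_pd1_neg cont_dV1 dv_V1 (V_supp _)) => b; rewrite /V1 mul0r mul0r.
have iV2 : int2 (fun x => (x.1 < 0)%R%:R * dV2 x) = 0.
  apply: (@int2_pd2_slices _ (fun t => t < 0)); first exact: (Bc_neg bV2).
  have [N hN] := supp_bounded (V_supp (fun x => x.2 * w x ^+ 2)).
  move=> a _; exists (fun t => V2 (a, t)), N; split.
  + by move=> t; exact: (dv_V2 (a, t)).
  + by move=> t; exact: (@cont_slice2 R dV2 a cont_dV2 t).
  + by move=> t tN; apply: (hN (a, t)); right.
have br1 := BcZ c (Bc_rect (-1) 1 (-1) 1).
have br2 := BcZ (1 / 512) (Bc_rect (- (1 / 2) - h) (- (1 / 2) + h) (- h) h).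
have br3 := BcZ (16 / M ^+ 2 + c) (Bc_rect 0 M (-1) 1).
have neg : int2 (fun x => (x.1 < 0)%R%:R * (trial_u1 x ^+ 2 + trial_u2 x ^+ 2 - pi ^+ 2 * trial_u x ^+ 2)) <=
    4 * c - h ^+ 2 / 128.
  have bn1 := Bc_neg bV1; have bn2 := Bc_neg bV2.
  apply: le_trans (_ : int2 (fun x => (x.1 < 0)%R%:R * dV1 x + (x.1 < 0)%R%:R * dV2 x + c * \1_(rect (-1) 1 (-1) 1) x
      - (1 / 512) * \1_(rect (- (1 / 2) - h) (- (1 / 2) + h) (- h) h) x) <= _); last first.
    rewrite (int2_B (BcD (BcD bn1 bn2) br1) br2) (int2_D (BcD bn1 bn2) br1) (int2_D bn1 bn2) iV1 iV2.
    have -> : int2 (fun x => c * \1_(rect (-1) 1 (-1) 1) x) = 4 * c.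
      by rewrite (int2_Z _ (Bc_rect _ _ _ _)) int2_rect; [ring|lra|lra].
    have -> : int2 (fun x => 1 / 512 * \1_(rect (- (1 / 2) - h) (- (1 / 2) + h) (- h) h) x) = h ^+ 2 / 128.
      by rewrite (int2_Z _ (Bc_rect _ _ _ _)) int2_rect; [field|lra|lra].
    by rewrite !add0r.
  apply: int2_le; [exact: Bc_neg|exact: BcB (BcD (BcD bn1 bn2) br1) br2|].
  move=> x; have [x0|x0] := ltP x.1 0; last first.
    rewrite !mul0r !add0r [X in _ - _ * X]indicE memNset; last first.
      by rewrite /rect /= => /andP[/andP[_ h1] _]; lra.
    by rewrite mulr0 subr0 mulr_ge0 // indicE ler0n.
  rewrite !mul1r; apply: le_trans (bend_pointwise x0) _; rewrite lerD2l lerN2.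
  rewrite indicE; case: (boolP (x \in _)) => [|_]; last first.
    by rewrite mulr0 divr_ge0 // mulr_ge0 ?sqr_ge0.
  rewrite inE /rect /= => /andP[/andP[x1 x2] /andP[x3 x4]].
  have Bh : 1 / 2 <= B (rho2 x).
    by apply: hB; rewrite /rho2 ler_norml; apply/andP; split; nra.
  have xx : 1 / 16 <= x.1 ^+ 2 by nra.
  have B2 : 1 / 4 <= B (rho2 x) ^+ 2 by nra.
  by nra.
have pos : int2 (fun x => (0 <= x.1)%R%:R * (trial_u1 x ^+ 2 + trial_u2 x ^+ 2 - pi ^+ 2 * trial_u x ^+ 2)) <=
    32 / M + 2 * M * c.
  apply: le_trans (_ : int2 (fun x => (0 <= x.1)%R%:R * dP x + (16 / M ^+ 2 + c) * \1_(rect 0 M (-1) 1) x) <= _); last first.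
    rewrite (int2_D (Bc_pos Bc_dP) br3) int_dP (int2_Z _ (Bc_rect _ _ _ _)) int2_rect; [|exact: ltW|lra].
    by rewrite le_eqVlt; apply/orP; left; apply/eqP; field; rewrite gt_eqF.
  apply: int2_le; [exact: Bc_pos|exact: BcD (Bc_pos Bc_dP) br3|].
  move=> x; have [x0|x0] := leP 0 x.1; last first.
    rewrite !mul0r add0r mulr_ge0 ?indicE ?ler0n // addr_ge0 // divr_ge0 // exprn_ge0 //; exact: ltW.
  by rewrite !mul1r; exact: strip_pointwise.
by apply: le_trans (lerD neg pos) _; lra.
Qed.

End trial.

Lemma lambda1_hersch_lt : (lambda1 H < (pi ^+ 2)%:E)%E.
Proof.
have [h0 h00 hprof] := @profile_exists R.
pose h := Num.min (1 / 4) (h0 / 2).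
have h_0 : 0 < h by rewrite lt_min !divr_gt0.
have h_4 : h <= 1 / 4 by rewrite ge_min lexx.
have h_2 : h <= h0 / 2 by rewrite ge_min lexx orbT.
have h2 : 0 < h ^+ 2 by rewrite exprn_gt0.
(* With this M and the c below, the errors 32 / M and (4 + 2 M) c are h^2 / 512 each, together half
   of the gain h^2 / 128. *)
pose M := 128 * 128 / h ^+ 2; have M0 : 0 < M by rewrite divr_gt0 // mulr_gt0.
pose c := h ^+ 2 / (8 * 64) / (4 + 2 * M).
have m0 : 0 < 4 + 2 * M by lra.
have c0 : 0 < c by apply: divr_gt0 => //; apply: divr_gt0 => //; rewrite mulr_gt0.
have [r [B [B1 [K1 [pr hB]]]]] := hprof c c0.
have hB' t : `|t - 1 / 4| <= h * (1 + 2 * h) -> 1 / 2 <= B t.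
  by move=> ht; apply: hB; apply: le_lt_trans ht _; nra.
have hh : 0 < h <= 1 / 4 by rewrite h_0.
have := trial_energy pr M0 (ltW c0) hh hB'.
have e1 : 4 * c + 2 * M * c = h ^+ 2 / 512 by rewrite /c; field; rewrite gt_eqF.
have e2 : 32 / M = h ^+ 2 / 512 by rewrite /M; field; rewrite gt_eqF.
have hC := trial_C1c pr M0; have pi2 : 0 <= pi ^+ 2 :> R by exact: sqr_ge0.
move=> le1; have lt1 : energy (trial_u1 M B B1) (trial_u2 M B1) < pi ^+ 2 * nrm2 (trial_u M B) by lra.
exact: lambda1_lt hC lt1 pi2.
Qed.

Lemma lambda1_hersch_fin : exists2 l : R, lambda1 H = l%:E & 1 / 4 <= l < pi ^+ 2.
Proof.
have lt := lambda1_hersch_lt; have ge := lambda1_ge0 H.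
have fl : lambda1 H \is a fin_num by rewrite ge0_fin_numE // (lt_trans lt) // ltry.
exists (fine (lambda1 H)); first by rewrite fineK.
apply/andP; split; last by rewrite -lte_fin fineK.
rewrite -lee_fin fineK //; apply: le_ereal_inf_tmp => _ [f [cf nf] <-].
have hf := Cc1_C1c cf; rewrite (int_energy hf) lee_fin.
have := poincare_quarter hf.
have -> : nrm2 f = 1 by apply: EFin_inj; rewrite -(int_nrm2 hf).
by rewrite mulr1.
Qed.

End Trial.

(** * Nonnegative near-minimisers charge a fixed cell below the lid *)

Section Lower.
Variable R : realType.
Local Notation H := (@hersch R).
Local Notation T2 := (measurableTypeR R * measurableTypeR R)%type.

(** The function sqrt (s^2 + d^2) - d is a C^1 absolute value: zero at 0, so supports are kept; of
    slope at most 1, so energies do not grow; and its square falls short of s^2 by at most 2 d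
    |s|. *)
Lemma soft_abs (d : R) : 0 < d -> exists T T' : R -> R,
  [/\ forall t : R, is_derive t 1 T (T' t), continuous T', T 0 = 0, forall s, 0 <= T s &
   forall s, T' s ^+ 2 <= 1 /\ s ^+ 2 - 2 * d * `|s| <= T s ^+ 2].
Proof.
move=> d0.
have qp s : 0 < s ^+ 2 + d ^+ 2 :> R by rewrite ltr_wpDl ?sqr_ge0 ?exprn_gt0.
pose q (s : R) : R := Num.sqrt (s ^+ 2 + d ^+ 2).
have q0 s : 0 < q s by rewrite sqrtr_gt0.
have qq s : q s ^+ 2 = s ^+ 2 + d ^+ 2 by rewrite sqr_sqrtr // ltW.
have dq (s : R) : is_derive s 1 q (s / q s).
  have h := dvD (dvX 2 (dv_id s)) (dvC (d ^+ 2) s).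
  have h1 := @dv_comp R (@Num.sqrt R) _ s _ _ (dv_sqrt (qp s)) h.
  apply: (dv_eq h1).
  rewrite /= expr1 addr0 mulr1 -/(q s); have := lt0r_neq0 (q0 s); move: (q s) => z z0.
  by field.
have qd s : d <= q s   by have := qq s; have := q0 s; have := sqr_ge0 s; have := d0; move: (q s) => z; nra.
exists (fun s => q s - d), (fun s => s / q s); split.
- by move=> t; apply: (dv_eq (dvB (dq t) (dvC d t))); rewrite subr0.
- move=> t; apply: (dv_continuous (dv_div (dv_id t) (dq t) (lt0r_neq0 (q0 t)))).
- by rewrite /q expr0n add0r sqrtr_sqr gtr0_norm // subrr.
- by move=> s; rewrite subr_ge0.
- move=> s; split.
    by rewrite expr_div_n qq ler_pdivrMr ?qp // mul1r lerDl sqr_ge0.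
  have h : q s <= `|s| + d.
    have := qq s; have := q0 s; have := normr_ge0 s; have := d0; have := real_normK (num_real s).
    by move: `|s| => a; move: (q s) => z; nra.
  have := qq s; move: (q s) h => z h e.
  have : d * z <= d * (`|s| + d) by rewrite ler_pM2l.
  move: `|s| => a; nra.
Qed.

(** A softened absolute value does not raise the energy of a near-minimiser and barely lowers its
    mass; it remains to renormalise. *)
Lemma near_min_nneg (A : set (R * R)) (l d : R) : lambda1 A = l%:E -> 0 <= l -> 0 < d ->
  exists f, exists f1, exists f2, [/\ C1c A f f1 f2, nrm2 f = 1, forall x, 0 <= f x & energy f1 f2 < l + d].
Proof.
move=> lA l0 d0; have d20 : 0 < d / 2 by rewrite divr_gt0.
have [f [f1 [f2 [cf nf ef]]]] := near_min lA d20.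
pose F := int2 (fun x => `|f x|).
have F0 : 0 <= F by apply: int2_ge0.
have D0 : 0 < 4 * (F + 1) * (l + d) by rewrite !mulr_gt0 // ?ltr_wpDl.
(* The mass lost is at most 2 e F, and this e keeps 2 e F (l + d) below d / 2. *)
pose e := d / (4 * (F + 1) * (l + d)).
have e0 : 0 < e by rewrite divr_gt0.
have [T [T' [dT cT T0 Tge hT]]] := soft_abs e0.
have cg := C1c_comp dT cT T0 cf.
have [bf b1 b2] := And3 (C1c_Bc cf) (C1c_Bc1 cf) (C1c_Bc2 cf).
have [bg bg1 bg2] := And3 (C1c_Bc cg) (C1c_Bc1 cg) (C1c_Bc2 cg).
have ng : 1 - 2 * e * F <= nrm2 (fun x => T (f x)).
  rewrite -[X in X - _]nf /nrm2 -int2_Z; last exact: Bc_abs.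
  rewrite -int2_B; [|exact: Bc_sqr|by apply: BcZ; exact: Bc_abs].
  apply: int2_le; [apply: BcB; [exact: Bc_sqr|by apply: BcZ; exact: Bc_abs]|exact: Bc_sqr|].
  by move=> x; have [] := hT (f x).
have eg : energy (fun x => T' (f x) * f1 x) (fun x => T' (f x) * f2 x) <= energy f1 f2.
  apply: int2_le; [exact: Bc_en|exact: Bc_en|].
  move=> x; have [h _] := hT (f x); rewrite !exprMn -mulrDr ler_piMl //.
  by rewrite addr_ge0 ?sqr_ge0.
have key : l + d / 2 <= (1 - 2 * e * F) * (l + d).
  have : e * (4 * (F + 1) * (l + d)) = d by rewrite /e mulfVK // lt0r_neq0.
  have : 0 < e * (l + d) by rewrite mulr_gt0 // ltr_wpDl.
  by move: (e) (F) => a b; nra.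
have n0 : 0 < nrm2 (fun x => T (f x)).
  rewrite (lt_le_trans _ ng) //; rewrite -(pmulr_lgt0 _ (_ : 0 < l + d)) ?ltr_wpDl //.
  by rewrite (lt_le_trans _ key) // ltr_wpDl.
set n := nrm2 _ in n0 ng.
have sn : (Num.sqrt n)^-1 ^+ 2 = n^-1 by rewrite exprVn sqr_sqrtr // ltW.
exists (fun x => (Num.sqrt n)^-1 * T (f x)), (fun x => (Num.sqrt n)^-1 * (T' (f x) * f1 x)),
  (fun x => (Num.sqrt n)^-1 * (T' (f x) * f2 x)); split.
- exact: C1cZ.
- by rewrite nrm2Z // sn mulVf // lt0r_neq0.
- by move=> x; rewrite mulr_ge0 ?invr_ge0 ?sqrtr_ge0.
- rewrite energyZ // sn mulrC ltr_pdivrMr //.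
  apply: (le_lt_trans eg); apply: (lt_le_trans ef); apply: (le_trans key).
  by rewrite mulrC ler_pM2l // ltr_wpDl.
Qed.


(* int v'^2 controls the maximum of v: v <= k/2 int v'^2 + 2/k; multiply by v and integrate. *)
Lemma slice_interp (v dv : R -> R) (k W : R) : (forall t : R, is_derive t 1 v (dv t)) -> continuous dv ->
  (forall t, 1 < `|t| -> v t = 0) -> (forall t, 0 <= v t) -> 0 < k ->
  (\int[lebesgue_measure]_t (v t)%:E <= W%:E)%E ->
  (0 <= \int[lebesgue_measure]_t (k / 2 * W * dv t ^+ 2 + 2 / k * v t - v t ^+ 2)%:E)%E.
Proof.
move=> dvv cdv v0 vge k0 hW.
have cv : continuous v by move=> t; apply: (dv_continuous (dvv t)).
have dv0 t : 1 < `|t| -> dv t = 0 by apply: dv_zero_out.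
have c2 : continuous (fun t => dv t ^+ 2 : R) by move=> t; apply: cont_exp; exact: cdv.
have cv2 : continuous (fun t => v t ^+ 2 : R) by move=> t; apply: cont_exp; exact: cv.
have i1 := cont_bdd_integrable1 cv v0.
have i2 : lebesgue_measure.-integrable setT (EFin \o (fun t => dv t ^+ 2)).
  by apply: (cont_bdd_integrable1 c2 (M := 1)) => t /dv0 ->; rewrite expr0n.
have i3 : lebesgue_measure.-integrable setT (EFin \o (fun t => v t ^+ 2)).
  by apply: (cont_bdd_integrable1 cv2 (M := 1)) => t /v0 ->; rewrite expr0n.
pose U := \int[@lebesgue_measure R]_t v t; pose I := \int[@lebesgue_measure R]_t (dv t ^+ 2).
have EU : (\int[lebesgue_measure]_t (v t)%:E = U%:E)%E.
  by rewrite /U /Rintegral fineK //; apply: integrable_fin_num.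
have EI : (\int[lebesgue_measure]_t (dv t ^+ 2)%:E = I%:E)%E.
  by rewrite /I /Rintegral fineK //; apply: integrable_fin_num.
have I0 : 0 <= I by rewrite -lee_fin -EI; apply: integral_ge0 => t _; rewrite lee_fin sqr_ge0.
have UW : U <= W by rewrite -lee_fin -EU.
have U0 : 0 <= U by rewrite -lee_fin -EU; apply: integral_ge0 => t _; rewrite lee_fin.
have vb t : v t <= k / 2 * I + 2 / k.
  have [t1|/v0 ->] := leP `|t| 1; last first.
    by have k1 := ltW k0; rewrite addr_ge0 // !mulr_ge0 // invr_ge0.
  (* The derivative is integrated from -2, where v is zero, with dv <= k/2 dv^2 + 1/(2 k); the
     interval has length at most 3. *)
  have t2 : -2 < t by move: t1; rewrite ler_norml => /andP[]; lra.
  have v2 : v (-2) = 0 by apply: v0; rewrite normrN ger0_norm // ltr1n.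
  have mD : measurable (`[-2, t]%classic : set (measurableTypeR R)) by exact: measurable_itv.
  have j1 : lebesgue_measure.-integrable (`[-2, t]%classic : set (measurableTypeR R)) (EFin \o dv).
    by apply: continuous_compact_integrable; [exact: segment_compact|exact: continuous_subspaceT].
  have j2 : lebesgue_measure.-integrable (`[-2, t]%classic : set (measurableTypeR R)) (EFin \o (fun t => dv t ^+ 2)).
    by apply: integrableS i2.
  have j3 : lebesgue_measure.-integrable (`[-2, t]%classic : set (measurableTypeR R)) (EFin \o (fun t => k / 2 * dv t ^+ 2)).
    by apply: eq_integrable (integrableZl mD (k / 2) j2) => // x _; rewrite /= EFinM.
  have j4 : lebesgue_measure.-integrable (`[-2, t]%classic : set (measurableTypeR R)) (EFin \o (fun t => (2 * k)^-1)).
    by apply: continuous_compact_integrable; [exact: segment_compact|apply: continuous_subspaceT; exact: cst_continuous].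
  have e1 : v t = \int[@lebesgue_measure R]_(x in `[-2, t]) dv x.
    by rewrite /Rintegral int_segment_derive // v2 subr0.
  have e2 : \int[@lebesgue_measure R]_(x in `[-2, t]) (dv x ^+ 2) <= I.
    rewrite -lee_fin -EI /Rintegral fineK; last exact: integrable_fin_num.
    apply: ge0_subset_integral => //; [by case/integrableP : i2|by move=> x _; rewrite lee_fin sqr_ge0].
  have e3 : \int[@lebesgue_measure R]_(x in `[-2, t]) ((2 * k)^-1) <= 2 / k.
    have m : @lebesgue_measure R `[-2, t]%classic = (t + 2)%:E.
      by rewrite lebesgue_measure_itv /= lte_fin t2 -EFinB opprK.
    rewrite Rintegral_cst // [fine _](_ : _ = t + 2); last by exact: (congr1 fine m).
    move: t1; rewrite ler_norml => /andP[_ t1]; rewrite invfM mulrC mulrA ler_wpM2r ?invr_ge0 ?ltW //.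
    lra.
  rewrite e1 (le_trans (le_Rintegral mD j1 (integrableD mD j3 j4) _)) //.
    move=> x _; have : 0 <= (k * dv x - 1) ^+ 2 / (2 * k) by rewrite divr_ge0 ?sqr_ge0 // mulr_ge0 // ltW.
    have kn := lt0r_neq0 k0; move: (dv x) => z.
    suff -> : (k * z - 1) ^+ 2 / (2 * k) = k / 2 * z ^+ 2 + (2 * k)^-1 - z by rewrite subr_ge0.
    by field.
  rewrite RintegralD // RintegralZl //.
  by apply: lerD => //; rewrite ler_wpM2l // divr_ge0 // ltW.
have eq1 : (\int[lebesgue_measure]_t (v t ^+ 2)%:E <= ((k / 2 * I + 2 / k) * U)%:E)%E.
  rewrite EFinM -EU -integralZl //; apply: le_integral => //.
    exact: integrableZl.
  by move=> t _; rewrite -EFinM lee_fin expr2 ler_wpM2r.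
have i4 : lebesgue_measure.-integrable setT (EFin \o (fun t => k / 2 * W * dv t ^+ 2)).
  by apply: eq_integrable (integrableZl measurableT (k / 2 * W) i2) => // x _; rewrite /= EFinM.
have i5 : lebesgue_measure.-integrable setT (EFin \o (fun t => 2 / k * v t)).
  by apply: eq_integrable (integrableZl measurableT (2 / k) i1) => // x _; rewrite /= EFinM.
have i6 : lebesgue_measure.-integrable setT (EFin \o (fun t => k / 2 * W * dv t ^+ 2 + 2 / k * v t)).
  by apply: eq_integrable (integrableD measurableT i4 i5) => // x _; rewrite /= EFinD.
rewrite integralB_EFin // integralD_EFin //.
have e4 : (\int[lebesgue_measure]_t (k / 2 * W * dv t ^+ 2)%:E = (k / 2 * W)%:E * I%:E)%E.
  by rewrite -EI -integralZl //; apply: eq_integral => t _; rewrite EFinM.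
have e5 : (\int[lebesgue_measure]_t (2 / k * v t)%:E = (2 / k)%:E * U%:E)%E.
  by rewrite -EU -integralZl //; apply: eq_integral => t _; rewrite EFinM.
rewrite e4 e5 sube_ge0; last by rewrite (integrable_fin_num measurableT i3) ?orbT.
apply: (le_trans eq1); rewrite -!EFinM -EFinD lee_fin mulrDl lerD2r -!mulrA.
rewrite (ler_pM2l k0) ler_pM2l ?invr_gt0 //.
by rewrite mulrC ler_wpM2r.
Qed.


(** By [strip_wirtinger] the strips hold at most energy / pi^2 of the unit mass. *)
Lemma bend_mass f f1 f2 : C1c H f f1 f2 -> nrm2 f = 1 ->
  1 - energy f1 f2 / pi ^+ 2 <= int2 (fun x => (x.1 < 0)%R%:R * f x ^+ 2).
Proof.
move=> cf nf; have [bf b1 b2] := And3 (C1c_Bc cf) (C1c_Bc1 cf) (C1c_Bc2 cf).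
have p0 : 0 < pi ^+ 2 :> R by rewrite exprn_gt0 // pi_gt0.
have h := strip_wirtinger cf.
have eq := int2_split (Bc_sqr bf); rewrite -/(nrm2 f) nf in eq.
suff : pi ^+ 2 * int2 (fun x => (0 <= x.1)%R%:R * f x ^+ 2) <= energy f1 f2.
  by rewrite -ler_pdivlMl // mulrC; lra.
rewrite -int2_Z; last by apply: Bc_pos; exact: Bc_sqr.
have bd : Bc (fun x => (0 <= x.1)%R%:R * (f2 x ^+ 2 - pi ^+ 2 * f x ^+ 2)).
  by apply: Bc_pos; apply: BcB; [|apply: BcZ]; exact: Bc_sqr.
have bz : Bc (fun x => pi ^+ 2 * ((0 <= x.1)%R%:R * f x ^+ 2)).
  by apply: BcZ; apply: Bc_pos; exact: Bc_sqr.
rewrite -[leLHS]addr0 (le_trans (lerD (lexx _) h)) // -int2_D //.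
apply: int2_le; [exact: BcD|exact: Bc_en|].
move=> x; have := sqr_ge0 (f1 x); have := sqr_ge0 (f2 x).
case: (0 <= x.1)%R => /=; rewrite ?mul1r ?mul0r ?mulr0; move: (f1 x ^+ 2) (f2 x ^+ 2) => a b; lra.
Qed.

(** Integrating f1 along rows from the far left bounds the integral of f over a vertical line by
    that of |f1| over the bend. Then |f1| <= (f1^2 + 1) / 2, and 4 is the area of a square around
    the bend. *)
Lemma bend_W f f1 f2 : C1c H f f1 f2 -> (forall x, 0 <= f x) -> forall a : R, a < 0 ->
  (\int[lebesgue_measure]_b (f (a, b))%:E <= ((energy f1 f2 + 4) / 2)%:E)%E.
Proof.
move=> cf f0 a a0; have [bf b1 b2] := And3 (C1c_Bc cf) (C1c_Bc1 cf) (C1c_Bc2 cf).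
have [c1 _ p1 _ sf] := cf.
pose g (x : R * R) : R := (x.1 < 0)%R%:R * `|f1 x|.
have bg : Bc g by apply: Bc_neg; exact: Bc_abs.
have gW : int2 g <= (energy f1 f2 + 4) / 2.
  have -> : (energy f1 f2 + 4) / 2 = int2 (fun x => 2^-1 * (f1 x ^+ 2 + f2 x ^+ 2) + 2^-1 * \1_(rect (-1) 1 (-1) 1) x).
    have br := @Bc_rect R (-1) 1 (-1) 1; have be := Bc_en b1 b2.
    rewrite int2_D; [|exact: BcZ|exact: BcZ].
    rewrite int2_Z // int2_Z // int2_rect; [|lra|lra].
    by rewrite /energy; move: (int2 _) => z; lra.
  apply: int2_le => //.
    by apply: BcD; apply: BcZ; [exact: Bc_en|exact: Bc_rect].
  move=> x; rewrite /g indicE.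
  have h0 : f1 x = 0 \/ H x.
    have [K [_ KH K0]] := pd1_supp p1 sf.
    by have [/KH|/K0] := pselect (K x); [right|left].
  have [hx|] := ltP x.1 0; last by rewrite mul0r => _; rewrite addr_ge0 // mulr_ge0 ?addr_ge0 ?sqr_ge0 ?invr_ge0.
  case: h0 => [->|Hx].
    by rewrite normr0 mulr0; rewrite addr_ge0 // mulr_ge0 ?addr_ge0 ?sqr_ge0 ?invr_ge0.
  rewrite mem_set; last first.
    case: Hx => [[h _]|[_]]; last by rewrite leNgt hx.
    have h1 : x.1 ^+ 2 < 1 by apply: le_lt_trans h; rewrite lerDl sqr_ge0.
    have h2 : x.2 ^+ 2 < 1 by apply: le_lt_trans h; rewrite lerDr sqr_ge0.
    have /andP[/ltW ? /ltW ?] := sqr_lt1 h1; have /andP[/ltW ? /ltW ?] := sqr_lt1 h2.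
    by rewrite /rect /=; apply/andP; split; apply/andP.
  have := sqr_ge0 (f2 x); have := sqr_ge0 (`|f1 x| - 1); have := real_normK (num_real (f1 x)).
  by rewrite /= mul1r mulr1; move: (f2 x ^+ 2) (f1 x) `|f1 x| => p q r; nra.
apply: (@le_trans _ _ (\int[lebesgue_measure]_b \int[lebesgue_measure]_t (g (t, b))%:E)%E); last first.
  by rewrite -int2_fubini2 // lee_fin.
have g0 x : (0 <= (g x)%:E)%E by rewrite lee_fin mulr_ge0.
have mg : measurable_fun (setT : set T2) (EFin \o g) by apply/measurable_EFinP; exact: Bc_meas.
have cf' := C1c_cont cf.
have [M [M0 hM]] : exists M, 0 <= M /\ forall x, M < `|x.1| -> f x = 0.
  have [M hM] := supp_bounded sf; exists `|M|; split => // x hx; apply: hM; left.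
  by apply: le_lt_trans hx; exact: ler_norm.
pose N := M + 1 - a.
have Na : - N < a by rewrite /N; lra.
have key b : ((f (a, b))%:E <= \int[lebesgue_measure]_t (g (t, b))%:E)%E.
  have dF (t : R) : is_derive t 1 (fun t => f (t, b)) (f1 (t, b)) := p1 (t, b).
  have cF : continuous (fun t => f1 (t, b)) by move=> t; exact: (@cont_slice1 R f1 b c1 t).
  have e := int_segment_derive Na dF cF.
  rewrite (_ : (f (- N, b)) = 0) ?subr0 in e; last first.
    by apply: hM; rewrite /= normrN /N ger0_norm; lra.
  rewrite -e.
  have mD : measurable (`[- N, a]%classic : set (measurableTypeR R)) by exact: measurable_itv.
  have j1 : lebesgue_measure.-integrable (`[- N, a]%classic : set (measurableTypeR R)) (EFin \o (fun t => f1 (t, b))).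
    by apply: continuous_compact_integrable; [exact: segment_compact|exact: continuous_subspaceT].
  have mgb : measurable_fun (setT : set (measurableTypeR R)) (fun t => (g (t, b))%:E).
    exact: (@measurable_fun_pair1 _ _ _ (measurableTypeR R) (measurableTypeR R) _ _ b mg).
  apply: (@le_trans _ _ (\int[lebesgue_measure]_(t in `[(- N)%R, a]) (g (t, b))%:E)%E); last first.
    by apply: ge0_subset_integral.
  apply: (@le_trans _ _ (\int[lebesgue_measure]_(t in `[(- N)%R, a]) `|(f1 (t, b))%:E|)%E).
    apply: le_integral => //; first exact: integrable_abse j1.
    by move=> t _; rewrite lee_fin ler_norm.
  rewrite le_eqVlt; apply/orP; left; apply/eqP; apply: eq_integral => t.
  by rewrite inE /= in_itv /= => /andP[_ ta]; rewrite /g /= (le_lt_trans ta a0) mul1r.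
have cfa : continuous (fun b => f (a, b)) by move=> t; exact: (@cont_slice2 R f a cf' t).
have [M2 M20] := supp_bounded sf.
have jf : lebesgue_measure.-integrable setT (EFin \o (fun b => f (a, b))).
  by apply: (cont_bdd_integrable1 cfa (M := M2)) => t ht; apply: M20; right.
have mG := @measurable_fubini_G _ _ (measurableTypeR R) (measurableTypeR R) R lebesgue_measure lebesgue_measure _ (Bc_integrable bg).
apply: ge0_le_integral => //; [by move=> b _; rewrite lee_fin|by case/integrableP : jf].
Qed.

(** [slice_interp] on every vertical line of the bend, with the line integral bounded uniformly by
    [bend_W]: the quadratic mass is at most a small multiple of the energy terms plus a large
    multiple of the linear mass. *)
Lemma bend_interp f f1 f2 k : C1c H f f1 f2 -> (forall x, 0 <= f x) -> 0 < k ->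
  int2 (fun x => (x.1 < 0)%R%:R * f x ^+ 2) <=
  k / 2 * ((energy f1 f2 + 4) / 2) * energy f1 f2 + 2 / k * int2 (fun x => (x.1 < 0)%R%:R * f x).
Proof.
move=> cf f0 k0; have [bf b1 b2] := And3 (C1c_Bc cf) (C1c_Bc1 cf) (C1c_Bc2 cf).
have [c1 c2 p1 p2 sf] := cf; set W := (energy f1 f2 + 4) / 2.
have W0 : 0 <= W by rewrite divr_ge0 // addr_ge0 // energy_ge0.
have E2 : int2 (fun x => f2 x ^+ 2) <= energy f1 f2.
  apply: int2_le; [exact: Bc_sqr|exact: Bc_en|by move=> x; rewrite lerDr sqr_ge0].
have bm : Bc (fun x => k / 2 * W * f2 x ^+ 2 + 2 / k * f x - f x ^+ 2).
  by apply: BcB; [apply: BcD; apply: BcZ => //|]; exact: Bc_sqr.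
have bn := Bc_neg bm.
have : 0 <= int2 (fun x => (x.1 < 0)%R%:R * (k / 2 * W * f2 x ^+ 2 + 2 / k * f x - f x ^+ 2)).
  apply: int2_ge0_slice2 => // a /=; case: ltP => a0; last first.
    by rewrite integral0_eq // => b _; rewrite mul0r.
  have dF (t : R) : is_derive t 1 (fun t => f (a, t)) (f2 (a, t)) := p2 (a, t).
  have cF : continuous (fun t => f2 (a, t)) by move=> t; exact: (@cont_slice2 R f2 a c2 t).
  have := @slice_interp _ _ k W dF cF _ _ k0 (bend_W cf f0 a0).
  under [X in _ -> (_ <= X)%E]eq_integral do rewrite /= mul1r; apply => t; last exact: f0.
  move=> t1; apply: contrapT => ft.
  have : H (a, t) by case: sf => K [_ KH K0]; apply: KH; apply: contrapT => /K0.
  move=> /hersch_x2 /=; rewrite -(real_normK (num_real t)).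
  by move: t1; move: `|t| => z; nra.
have bs := Bc_sqr b2; have bs' := Bc_sqr bf.
have bi : Bc (fun x => k / 2 * W * ((x.1 < 0)%R%:R * f2 x ^+ 2)) by apply: BcZ; exact: Bc_neg.
have bj : Bc (fun x => 2 / k * ((x.1 < 0)%R%:R * f x)) by apply: BcZ; exact: Bc_neg.
have bl : Bc (fun x => (x.1 < 0)%R%:R * f x ^+ 2) by exact: Bc_neg.
have -> : (fun x => (x.1 < 0)%R%:R * (k / 2 * W * f2 x ^+ 2 + 2 / k * f x - f x ^+ 2)) =
  (fun x => k / 2 * W * ((x.1 < 0)%R%:R * f2 x ^+ 2) + 2 / k * ((x.1 < 0)%R%:R * f x) - (x.1 < 0)%R%:R * f x ^+ 2).
  by apply/funext => x; rewrite mulrBr mulrDr mulrCA (mulrCA _ (2 / k)).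
rewrite int2_B //; last exact: BcD.
rewrite int2_D // subr_ge0 int2_Z; last exact: Bc_neg.
rewrite int2_Z; last exact: Bc_neg.
move=> h; apply: (le_trans h); rewrite lerD2r ler_wpM2l //.
  by rewrite mulr_ge0 // divr_ge0 // ltW.
apply: le_trans E2; apply: int2_le; [exact: Bc_neg|by []|].
by move=> x; case: ltP => _; rewrite ?mul1r ?mul0r ?sqr_ge0.
Qed.

(** The Harnack chain transports integrals of f, whereas the energy controls integrals of f^2. This
    bound connects the two, uniformly over nonnegative near-minimisers. *)
Lemma bend_L1 (l : R) : 0 <= l -> l < pi ^+ 2 -> exists c d : R, [/\ 0 < c, 0 < d & forall f f1 f2,
  C1c H f f1 f2 -> (forall x, 0 <= f x) -> nrm2 f = 1 -> energy f1 f2 <= l + d ->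
  c <= int2 (fun x => (x.1 < 0)%R%:R * f x)].
Proof.
move=> l0 lp; pose P : R := pi ^+ 2; have P0 : 0 < P by rewrite exprn_gt0 // pi_gt0.
(* [m] bounds the quadratic mass of the bend from below once the energy is at most (P + l) / 2; the
   [k] below makes the energy term of [bend_interp] at most m / 2. *)
pose m := (P - l) / (2 * P); have m0 : 0 < m by rewrite divr_gt0 ?subr_gt0 // mulr_gt0.
pose W := (P + 4) / 2; have W0 : 0 < W by rewrite divr_gt0 // addr_gt0.
pose k := m / (W * P); have k0 : 0 < k by rewrite divr_gt0 // mulr_gt0.
exists (k * m / 4), ((P - l) / 2); split; [|by rewrite divr_gt0 // subr_gt0|].
  by rewrite divr_gt0 // mulr_gt0.
move=> f f1 f2 cf f0 nf ef.
have eP : energy f1 f2 <= P by apply: (le_trans ef); move: lp; rewrite -/P; lra.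
have h1 := bend_mass cf nf; have h2 := bend_interp cf f0 k0.
set u := int2 _ in h1 h2; set v := int2 _ in h2 *.
have hm : m <= u.
  apply: le_trans h1; rewrite -/P /m.
  have : energy f1 f2 / P <= (l + (P - l) / 2) / P by rewrite ler_pM2r ?invr_gt0.
  suff -> : (P - l) / (2 * P) = 1 - (l + (P - l) / 2) / P by lra.
  by have := lt0r_neq0 P0; move: (P) => z zn; field.
have e0 := energy_ge0 f1 f2.
have h3 : k / 2 * ((energy f1 f2 + 4) / 2) * energy f1 f2 <= k / 2 * W * P.
  have k2 : 0 < k / 2 by apply: divr_gt0.
  rewrite -2!(mulrA (k / 2)) (ler_pM2l k2).
  by rewrite /W ler_pM // ?divr_ge0 ?addr_ge0 // ler_wpM2r ?invr_ge0 // lerD2r.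
have h4 : k / 2 * W * P = m / 2.
  rewrite /k; have := lt0r_neq0 W0; have := lt0r_neq0 P0; move: (W) (P) => w p wn pn.
  by field; rewrite wn.
have h5 : m / 2 <= 2 / k * v by move: hm h2 h3; rewrite h4; lra.
have : k / 2 * (m / 2) <= k / 2 * (2 / k * v) by rewrite ler_pM2l // divr_gt0.
have -> : k / 2 * (2 / k * v) = v by have := lt0r_neq0 k0; move: (k) => z zn; field.
by rewrite -mulrA; lra.
Qed.

End Lower.

HB.instance Definition _ (T U : ptopologicalType) := Pointed.on (T * U)%type.

(** * Green's formula and a Harnack inequality for near-minimisers *)

Section Harnack.
Variable R : realType.
Local Notation H := (@hersch R).
Local Notation T2 := (measurableTypeR R * measurableTypeR R)%type.
Implicit Types (A : set (R * R)).

Lemma supp_mul A (u g : R * R -> R) : supp_in A u -> supp_in A (fun x => u x * g x).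
Proof. by apply: supp_in_0 => x ->; rewrite mul0r. Qed.

Lemma near_slice1 (f : R * R -> R) (x : R * R) : (\forall y \near x, f y = 0) -> \forall t \near x.1, f (t, x.2) = 0.
Proof.
move=> /nbhs_ballP[e /= e0 he]; apply/nbhs_ballP; exists e => // t ht; apply: he; split => //=; exact: ballxx.
Qed.

Lemma near_slice2 (f : R * R -> R) (x : R * R) : (\forall y \near x, f y = 0) -> \forall t \near x.2, f (x.1, t) = 0.
Proof.
move=> /nbhs_ballP[e /= e0 he]; apply/nbhs_ballP; exists e => // t ht; apply: he; split => //=; exact: ballxx.
Qed.

Lemma pd1_comp (F F' : R -> R) g (x : R * R) a : (forall t : R, is_derive t 1 F (F' t)) -> pd1 g x a ->
  pd1 (fun x => F (g x)) x (F' (g x) * a).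
Proof.
move=> hF hg; have h := hF (g x); rewrite [x in g x]surjective_pairing in h.
by have := dv_comp h hg; rewrite /pd1 -surjective_pairing.
Qed.

Lemma pd2_comp (F F' : R -> R) g (x : R * R) a : (forall t : R, is_derive t 1 F (F' t)) -> pd2 g x a ->
  pd2 (fun x => F (g x)) x (F' (g x) * a).
Proof.
move=> hF hg; have h := hF (g x); rewrite [x in g x]surjective_pairing in h.
by have := dv_comp h hg; rewrite /pd2 -surjective_pairing.
Qed.

Lemma pd1M f g (x : R * R) a b : pd1 f x a -> pd1 g x b -> pd1 (fun x => f x * g x) x (a * g x + f x * b).
Proof. by move=> hf hg; have := dvM hf hg; rewrite /pd1 -surjective_pairing. Qed.

Lemma pd2M f g (x : R * R) a b : pd2 f x a -> pd2 g x b -> pd2 (fun x => f x * g x) x (a * g x + f x * b).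
Proof. by move=> hf hg; have := dvM hf hg; rewrite /pd2 -surjective_pairing. Qed.

Lemma pd1_eq f (x : R * R) a b : pd1 f x a -> a = b -> pd1 f x b.
Proof. by move=> ? <-. Qed.

Lemma pd2_eq f (x : R * R) a b : pd2 f x a -> a = b -> pd2 f x b.
Proof. by move=> ? <-. Qed.

Lemma cont_fst2 : continuous (fun x : R * R => x.1).
Proof. by move=> x; exact: cvg_fst. Qed.

Lemma cont_snd2 : continuous (fun x : R * R => x.2).
Proof. by move=> x; exact: cvg_snd. Qed.

Lemma cont_disc (q : R * R) : continuous (fun x : R * R => (x.1 - q.1) ^+ 2 + (x.2 - q.2) ^+ 2).
Proof.
by apply: contD; apply: contX; apply: cont_addc; [exact: cont_fst2|exact: cont_snd2].
Qed.

Lemma near_pd1_0 (u u1 : R * R -> R) (x : R * R) : (forall x, pd1 u x (u1 x)) -> (\forall y \near x, u y = 0) ->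
  \forall y \near x, u1 y = 0.
Proof.
move=> hu /near_join; apply: filterS => y hy; apply: (dv_uniq (hu y)).
by apply: dv_near (dvC 0 y.1); apply: filterS (near_slice1 hy) => t ->.
Qed.

Lemma near_pd2_0 (u u2 : R * R -> R) (x : R * R) : (forall x, pd2 u x (u2 x)) -> (\forall y \near x, u y = 0) ->
  \forall y \near x, u2 y = 0.
Proof.
move=> hu /near_join; apply: filterS => y hy; apply: (dv_uniq (hu y)).
by apply: dv_near (dvC 0 y.2); apply: filterS (near_slice2 hy) => t ->.
Qed.

(** The factor g may be singular off [A]: u vanishes near every such point, and so does the product.
    Poles are multiplied by their cut-offs in this way. *)
Lemma cont_mul_loc A (u g : R * R -> R) : continuous u -> (forall x, ~ A x -> \forall y \near x, u y = 0) ->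
  (forall x, A x -> {for x, continuous g}) -> continuous (fun x => u x * g x).
Proof.
move=> cu su cg x; have [Ax|/su h] := pselect (A x); first by apply: cvgM; [exact: cu|exact: cg].
rewrite /continuous_at (nbhs_singleton h) mul0r.
by apply: cvg_near_cst; apply: filterS h => y ->; rewrite mul0r.
Qed.

Lemma pd1_mul_loc A (u u1 g g1 : R * R -> R) : (forall x, pd1 u x (u1 x)) ->
  (forall x, ~ A x -> \forall y \near x, u y = 0) ->
  (forall x, A x -> pd1 g x (g1 x)) -> forall x, pd1 (fun x => u x * g x) x (u1 x * g x + u x * g1 x).
Proof.
move=> hu su hg x; have [Ax|nA] := pselect (A x); first exact: pd1M (hu x) (hg x Ax).
have n0 := su x nA; have n1 := near_pd1_0 hu n0.
rewrite (nbhs_singleton n0) (nbhs_singleton n1) !mul0r addr0 /pd1.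
by apply: dv_near (dvC 0 x.1); apply: filterS (near_slice1 n0) => t ->; rewrite mul0r.
Qed.

Lemma pd2_mul_loc A (u u2 g g2 : R * R -> R) : (forall x, pd2 u x (u2 x)) ->
  (forall x, ~ A x -> \forall y \near x, u y = 0) ->
  (forall x, A x -> pd2 g x (g2 x)) -> forall x, pd2 (fun x => u x * g x) x (u2 x * g x + u x * g2 x).
Proof.
move=> hu su hg x; have [Ax|nA] := pselect (A x); first exact: pd2M (hu x) (hg x Ax).
have n0 := su x nA; have n1 := near_pd2_0 hu n0.
rewrite (nbhs_singleton n0) (nbhs_singleton n1) !mul0r addr0 /pd2.
by apply: dv_near (dvC 0 x.2); apply: filterS (near_slice2 n0) => t ->; rewrite mul0r.
Qed.

Lemma cont_mul_supp A (u g : R * R -> R) : continuous u -> supp_in A u ->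
  (forall x, A x -> {for x, continuous g}) -> continuous (fun x => u x * g x).
Proof. by move=> cu su; apply: cont_mul_loc => // x; exact: supp_in_near. Qed.

Lemma pd1_mul_supp A (u u1 g g1 : R * R -> R) : (forall x, pd1 u x (u1 x)) -> supp_in A u ->
  (forall x, A x -> pd1 g x (g1 x)) -> forall x, pd1 (fun x => u x * g x) x (u1 x * g x + u x * g1 x).
Proof. by move=> hu su; apply: pd1_mul_loc => // x; exact: supp_in_near. Qed.

Lemma pd2_mul_supp A (u u2 g g2 : R * R -> R) : (forall x, pd2 u x (u2 x)) -> supp_in A u ->
  (forall x, A x -> pd2 g x (g2 x)) -> forall x, pd2 (fun x => u x * g x) x (u2 x * g x + u x * g2 x).
Proof. by move=> hu su; apply: pd2_mul_loc => // x; exact: supp_in_near. Qed.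

(** The field (g1, g2) is differentiable on [A] only. The compact support of u in [A] makes the
    products global functions, and no boundary term arises. *)
Lemma green A u u1 u2 (g1 g2 g11 g22 : R * R -> R) : C1c A u u1 u2 ->
  (forall x, A x -> pd1 g1 x (g11 x)) -> (forall x, A x -> pd2 g2 x (g22 x)) ->
  (forall x, A x -> [/\ {for x, continuous g1}, {for x, continuous g2}, {for x, continuous g11} &
    {for x, continuous g22}]) ->
  [/\ Bc (fun x => u x * (g11 x + g22 x)), Bc (fun x => u1 x * g1 x + u2 x * g2 x) &
    int2 (fun x => u1 x * g1 x + u2 x * g2 x) = - int2 (fun x => u x * (g11 x + g22 x))].
Proof.
move=> cu h1 h2 hc; have cu0 := C1c_cont cu; have [c1 c2 p1 p2 su] := cu.
have su1 := pd1_supp p1 su; have su2 := pd2_supp p2 su.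
have k1 : continuous (fun x => u1 x * g1 x) by apply: cont_mul_supp su1 _ => // x /hc[].
have k2 : continuous (fun x => u2 x * g2 x) by apply: cont_mul_supp su2 _ => // x /hc[].
have k11 : continuous (fun x => u x * g11 x) by apply: cont_mul_supp su _ => // x /hc[].
have k22 : continuous (fun x => u x * g22 x) by apply: cont_mul_supp su _ => // x /hc[].
have b1 := Bc_cont k1 (supp_mul g1 su1); have b2 := Bc_cont k2 (supp_mul g2 su2).
have b11 := Bc_cont k11 (supp_mul g11 su); have b22 := Bc_cont k22 (supp_mul g22 su).
have e : (fun x => u x * (g11 x + g22 x)) = (fun x => u x * g11 x + u x * g22 x).
  by apply/funext => x; rewrite mulrDr.
split; [by rewrite e; exact: BcD|exact: BcD|].
have e1 := int2_pd1 (contD k1 k11) (pd1_mul_supp p1 su h1) (supp_mul g1 su).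
have e2 := int2_pd2 (contD k2 k22) (pd2_mul_supp p2 su h2) (supp_mul g2 su).
rewrite e !int2_D // in e1 e2 *.
by rewrite -[LHS]subr0 -e1 -[LHS]subr0 -e2; lra.
Qed.

Lemma closed_disc_compact (q : R * R) (r : R) : compact [set x | (x.1 - q.1) ^+ 2 + (x.2 - q.2) ^+ 2 <= r ^+ 2].
Proof.
have cd := @cont_disc q.
apply: (subclosed_compact _ (@compact_box R (`|q.1| + `|q.2| + `|r|))).
  have -> : [set x | (x.1 - q.1) ^+ 2 + (x.2 - q.2) ^+ 2 <= r ^+ 2] =
    (fun x : R * R => (x.1 - q.1) ^+ 2 + (x.2 - q.2) ^+ 2) @^-1` [set t | t <= r ^+ 2] by [].
  by apply: closed_comp; [move=> x _; exact: cd|exact: closed_le].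
move=> x /= h.
have bnd (a b c : R) : 0 <= c -> (a - b) ^+ 2 + c <= r ^+ 2 -> `|a| <= `|b| + `|r|.
  move=> c0 hc; have : `|a - b| <= `|r|.
    by rewrite -ler_sqr ?nnegrE // !real_normK ?num_real //; lra.
  by have := ler_normD (a - b) b; rewrite subrK; lra.
have h1 := bnd x.1 q.1 _ (sqr_ge0 (x.2 - q.2)) h.
have h2 := bnd x.2 q.2 _ (sqr_ge0 (x.1 - q.1)); rewrite addrC in h2; have {}h2 := h2 h.
have n1 := normr_ge0 q.1; have n2 := normr_ge0 q.2.
by split; rewrite /= in_itv /= -ler_norml; lra.
Qed.

Section ball.
Variables (A : set (R * R)) (l : R) (q : R * R) (r : R).
Hypothesis l0 : 0 <= l.
Hypothesis hl : forall h h1 h2, C1c A h h1 h2 -> 0 <= Qf l h h1 h2.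
Hypothesis r0 : 0 < r.
Hypothesis hA : [set x | (x.1 - q.1) ^+ 2 + (x.2 - q.2) ^+ 2 <= r ^+ 2] `<=` A.

Let s (x : R * R) : R := r ^+ 2 - ((x.1 - q.1) ^+ 2 + (x.2 - q.2) ^+ 2).
Variable m : nat.
Let n := m.+3.
Let f (x : R * R) : R := pp m.+4 (s x).
Let f1 (x : R * R) : R := m.+4%:R * pp m.+3 (s x) * (- 2 * (x.1 - q.1)).
Let f2 (x : R * R) : R := m.+4%:R * pp m.+3 (s x) * (- 2 * (x.2 - q.2)).
Let f11 (x : R * R) : R := m.+4%:R * (m.+3%:R * pp m.+2 (s x) * (- 2 * (x.1 - q.1)) * (- 2 * (x.1 - q.1)) - 2 * pp m.+3 (s x)).
Let f22 (x : R * R) : R := m.+4%:R * (m.+3%:R * pp m.+2 (s x) * (- 2 * (x.2 - q.2)) * (- 2 * (x.2 - q.2)) - 2 * pp m.+3 (s x)).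

Lemma cont_s : continuous s.
Proof. by apply: contD; [exact: cst_continuous|apply: contN; exact: cont_disc]. Qed.

Lemma dv_s1 x : pd1 s x (- 2 * (x.1 - q.1)).
Proof.
apply: (dv_eq (dvB (dvC (r ^+ 2) x.1) (dvD (dvX 2 (dvB (dv_id x.1) (dvC q.1 x.1))) (dvC ((x.2 - q.2) ^+ 2) x.1)))).
by rewrite /=; ring.
Qed.

Lemma dv_s2 x : pd2 s x (- 2 * (x.2 - q.2)).
Proof.
apply: (dv_eq (dvB (dvC (r ^+ 2) x.2) (dvD (dvC ((x.1 - q.1) ^+ 2) x.2) (dvX 2 (dvB (dv_id x.2) (dvC q.2 x.2)))))).
by rewrite /=; ring.
Qed.

Lemma cont_pps k : continuous (fun x => pp k (s x)).
Proof. by apply: cont_comp1; [exact: cont_pp|exact: cont_s]. Qed.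

Lemma cont_lin1 : continuous (fun x : R * R => - 2 * (x.1 - q.1)).
Proof. by apply: contZ; apply: cont_addc; exact: cont_fst2. Qed.

Lemma cont_lin2 : continuous (fun x : R * R => - 2 * (x.2 - q.2)).
Proof. by apply: contZ; apply: cont_addc; exact: cont_snd2. Qed.

Lemma cont_f1 : continuous f1.
Proof. by apply: contM; [apply: contZ; exact: cont_pps|exact: cont_lin1]. Qed.

Lemma cont_f2 : continuous f2.
Proof. by apply: contM; [apply: contZ; exact: cont_pps|exact: cont_lin2]. Qed.

Lemma cont_f11 : continuous f11.
Proof.
apply: contZ; apply: contD.
  by apply: contM; [apply: contM; [apply: contZ; exact: cont_pps|]|]; exact: cont_lin1.
by apply: contN; apply: contZ; exact: cont_pps.
Qed.

Lemma cont_f22 : continuous f22.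
Proof.
apply: contZ; apply: contD.
  by apply: contM; [apply: contM; [apply: contZ; exact: cont_pps|]|]; exact: cont_lin2.
by apply: contN; apply: contZ; exact: cont_pps.
Qed.

Lemma ball_C1c : C1c A f f1 f2.
Proof.
split; [exact: cont_f1|exact: cont_f2| | |].
- by move=> x; exact: (pd1_comp (dv_pp m.+2) (dv_s1 x)).
- by move=> x; exact: (pd2_comp (dv_pp m.+2) (dv_s2 x)).
- exists [set x | (x.1 - q.1) ^+ 2 + (x.2 - q.2) ^+ 2 <= r ^+ 2]; split => //; first exact: closed_disc_compact.
  by move=> x /= h; rewrite /f pp_neg // /s subr_le0 ltW // ltNge; apply/negP.
Qed.

Lemma dv_f1 x : pd1 f1 x (f11 x).
Proof.
have h : pd1 (fun x => m.+4%:R * pp m.+3 (s x)) x (m.+4%:R * (m.+3%:R * pp m.+2 (s x) * (- 2 * (x.1 - q.1)))).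
  by apply: (dvZ m.+4%:R); exact: (pd1_comp (dv_pp m.+1) (dv_s1 x)).
have h2 : pd1 (fun x => - 2 * (x.1 - q.1)) x (- 2).
  by apply: (dv_eq (dvZ (- 2) (dvB (dv_id x.1) (dvC q.1 x.1)))); rewrite subr0 mulr1.
by apply: pd1_eq (pd1M h h2) _; rewrite /f11; ring.
Qed.

Lemma dv_f2 x : pd2 f2 x (f22 x).
Proof.
have h : pd2 (fun x => m.+4%:R * pp m.+3 (s x)) x (m.+4%:R * (m.+3%:R * pp m.+2 (s x) * (- 2 * (x.2 - q.2)))).
  by apply: (dvZ m.+4%:R); exact: (pd2_comp (dv_pp m.+1) (dv_s2 x)).
have h2 : pd2 (fun x => - 2 * (x.2 - q.2)) x (- 2).
  by apply: (dv_eq (dvZ (- 2) (dvB (dv_id x.2) (dvC q.2 x.2)))); rewrite subr0 mulr1.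
by apply: pd2_eq (pd2M h h2) _; rewrite /f22; ring.
Qed.

(** Inside the disc the sign is that of (m + 3) |x - q|^2 - s, negative only near the centre and on
    a smaller set when m grows. *)
Lemma ball_lap x : f11 x + f22 x =
  4 * m.+4%:R * pp m.+2 (s x) * (m.+3%:R * ((x.1 - q.1) ^+ 2 + (x.2 - q.2) ^+ 2) - Num.max (s x) 0).
Proof.
have -> : f11 x + f22 x = 4 * m.+4%:R * (m.+3%:R * pp m.+2 (s x) * ((x.1 - q.1) ^+ 2 + (x.2 - q.2) ^+ 2) - pp m.+3 (s x)).
  by rewrite /f11 /f22; ring.
have -> : pp m.+3 (s x) = pp m.+2 (s x) * Num.max (s x) 0 by rewrite /pp exprSr.
by ring.
Qed.

Variable e : R.
Hypothesis me : 2 * r ^+ 2 <= m.+3%:R * e ^+ 2.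

(* The power m is so large that (r^2 - |x - q|^2)_+^(m+4) is subharmonic outside the disc of radius e. *)
Lemma ball_harnack : exists2 C : R, 0 <= C & forall u u1 u2, C1c A u u1 u2 -> (forall x, 0 <= u x) ->
  int2 (fun x => \1_(eball q (r / 2)) x * u x) <= C * (int2 (fun x => \1_(eball q e) x * u x) + Num.sqrt (Qf l u u1 u2)).
Proof.
(* [c] bounds the Laplacian from below in the half disc outside radius e, where s > 3/4 r^2 and, by
   [me], the last factor is at least r^2; [C1] bounds its negative part inside radius e. *)
pose c := 4 * m.+4%:R * (3 / 4 * r ^+ 2) ^+ m.+2 * r ^+ 2.
pose C1 := 4 * m.+4%:R * (r ^+ 2) ^+ m.+2 * r ^+ 2.
pose Cf := Num.sqrt (Qf l f f1 f2).
have r20 : 0 < r ^+ 2 by rewrite exprn_gt0.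
have c0 : 0 < c.
  have a0 : 0 < 3 / 4 * r ^+ 2 by apply: mulr_gt0 => //; apply: divr_gt0.
  by rewrite /c; apply: mulr_gt0 => //; apply: mulr_gt0; [exact: mulr_gt0|exact: exprn_gt0].
have C10 : 0 < C1.
  by rewrite /C1; apply: mulr_gt0 => //; apply: mulr_gt0; [exact: mulr_gt0|exact: exprn_gt0].
have Cf0 : 0 <= Cf by exact: sqrtr_ge0.
have point x : c * \1_(eball q (r / 2)) x - (C1 + c) * \1_(eball q e) x <= f11 x + f22 x + l * f x.
  rewrite ball_lap !indicE.
  have f0 : 0 <= l * f x by rewrite mulr_ge0 // pp_ge0.
  have p0 : 0 <= pp m.+2 (s x) by exact: pp_ge0.
  have D0 : 0 <= (x.1 - q.1) ^+ 2 + (x.2 - q.2) ^+ 2 by rewrite addr_ge0 ?sqr_ge0.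
  have b0 (P : bool) : 0 <= (P%:R : R) <= 1 by case: P; rewrite ?lexx ?ler01.
  have bq : (x \in eball q (r / 2))%:R != 0 :> R -> (x.1 - q.1) ^+ 2 + (x.2 - q.2) ^+ 2 < r ^+ 2 / 4.
    by case: (boolP (x \in _)) => [|_]; rewrite ?eqxx // inE /eball /= => h _; move: h; rewrite exprMn; lra.
  have [sx|sx] := leP (s x) 0.
    rewrite pp_neg // mulr0 mul0r add0r.
    have -> : (x \in eball q (r / 2))%:R = 0 :> R.
      by apply/eqP; apply: contraT => /bq; move: sx; rewrite /s; lra.
    rewrite mulr0 add0r (le_trans _ f0) // oppr_le0 mulr_ge0 // ltW // addr_gt0 //.
  rewrite pp_pos ?(ltW sx) //.
  have k0 : 0 <= 4 * m.+4%:R * s x ^+ m.+2 by apply: mulr_ge0 => //; apply: exprn_ge0; exact: ltW.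
  have [xe|xe] := boolP (x \in eball q e).
    have h : 4 * m.+4%:R * s x ^+ m.+2 * s x <= C1.
      have sr : s x <= r ^+ 2 by rewrite /s; lra.
      have s0 : 0 <= s x ^+ m.+2 := exprn_ge0 _ (ltW sx).
      have se : s x ^+ m.+2 <= (r ^+ 2) ^+ m.+2 by rewrite lerXn2r // ?nnegrE ltW.
      by apply: ler_pM => //; [exact: ltW|apply: ler_wpM2l => //; exact: mulr_ge0].
    have /andP[h1 h2] := b0 (x \in eball q (r / 2)).
    have h3 : 0 <= 4 * m.+4%:R * s x ^+ m.+2 * (m.+3%:R * ((x.1 - q.1) ^+ 2 + (x.2 - q.2) ^+ 2)).
      by apply: mulr_ge0 => //; exact: mulr_ge0.
    have h4 : c * (x \in eball q (r / 2))%:R <= c by rewrite ler_piMr // ltW.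
    rewrite mulr1 [X in _ <= X + _]mulrBr; lra.
  rewrite mulr0 subr0.
  have De : e ^+ 2 <= (x.1 - q.1) ^+ 2 + (x.2 - q.2) ^+ 2.
    by move: xe; rewrite notin_setE /eball /= => /negP; rewrite -leNgt.
  have br : r ^+ 2 <= m.+3%:R * ((x.1 - q.1) ^+ 2 + (x.2 - q.2) ^+ 2) - s x.
    have := ler_wpM2l (ler0n _ m.+3) De; have := me; rewrite /s; lra.
  have h5 : 4 * m.+4%:R * s x ^+ m.+2 * r ^+ 2 <=
     4 * m.+4%:R * s x ^+ m.+2 * (m.+3%:R * ((x.1 - q.1) ^+ 2 + (x.2 - q.2) ^+ 2) - s x).
    exact: ler_wpM2l.
  apply: le_trans (lerD h5 f0); rewrite addr0.
  have [xq|xq] := boolP (x \in eball q (r / 2)); last first.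
    by rewrite mulr0; apply: mulr_ge0 => //; exact: ltW.
  have hq : (x.1 - q.1) ^+ 2 + (x.2 - q.2) ^+ 2 < r ^+ 2 / 4 by apply: bq; rewrite xq oner_eq0.
  have r34 : 0 <= 3 / 4 * r ^+ 2 by rewrite mulr_ge0 // ltW.
  rewrite mulr1 /c; apply: ler_wpM2r; first exact: ltW.
  by apply: ler_wpM2l => //; rewrite lerXn2r // ?nnegrE ?(ltW sx) // /s; lra.
exists ((C1 + c + Cf) / c); first by apply: divr_ge0; [apply: addr_ge0 => //; rewrite ltW // addr_gt0|exact: ltW].
move=> u u1 u2 cu u0.
have bu := C1c_Bc cu; have b1 := C1c_Bc1 cu; have b2 := C1c_Bc2 cu.
have cf := ball_C1c; have bf := C1c_Bc cf.
have [g1 g2 g3] := green cu (fun x _ => dv_f1 x) (fun x _ => dv_f2 x)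
  (fun x _ => And4 (@cont_f1 x) (@cont_f2 x) (@cont_f11 x) (@cont_f22 x)).
have bb := Bf_bound hl cu cf; set S := Num.sqrt _ in bb *.
have mB t : measurable (eball q t : set T2).
  apply: open_measurable_prod.
  have -> : eball q t = (fun x : R * R => (x.1 - q.1) ^+ 2 + (x.2 - q.2) ^+ 2) @^-1` [set z | z < t ^+ 2] by [].
  by apply: open_comp; [move=> x _; exact: cont_disc|exact: open_lt].
have bi t : Bc (fun x => \1_(eball q t) x * u x) by apply: Bc_indic.
set I1 := int2 _; set I2 := int2 (fun x => \1_(eball q e) x * u x).
have I20 : 0 <= I2 by apply: int2_ge0 => x; rewrite mulr_ge0.
have S0 : 0 <= S by exact: sqrtr_ge0.
(* Since u >= 0 the pointwise bound integrates against u. By Green its right side becomes - Bf(u,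
   f), which [Bf_bound] controls by the defect of u. *)
have h1 : c * I1 - (C1 + c) * I2 <= int2 (fun x => u x * (f11 x + f22 x) + l * (u x * f x)).
  rewrite -int2_Z // -int2_Z // -int2_B; [|exact: BcZ|exact: BcZ].
  apply: int2_le; [by apply: BcB; exact: BcZ|by apply: BcD => //; apply: BcZ; exact: BcM|].
  by move=> x; have := ler_wpM2l (u0 x) (point x); rewrite mulrBr !mulrDr; lra.
have h2 : int2 (fun x => u x * (f11 x + f22 x) + l * (u x * f x)) = - Bf l u u1 u2 f f1 f2.
  have buf : Bc (fun x => l * (u x * f x)) by apply: BcZ; exact: BcM.
  by rewrite /Bf int2_B // g3 int2_D //; ring.
have h3 : c * I1 <= (C1 + c + Cf) * (I2 + S).
  have := ler_norm (- Bf l u u1 u2 f f1 f2); rewrite normrN -h2 => h4.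
  have h5 : 0 <= Cf * I2 by rewrite mulr_ge0.
  have h6 : 0 <= (C1 + c) * S by rewrite mulr_ge0 // ltW // addr_gt0.
  move: bb; rewrite -/Cf => bb.
  have := le_trans h1 (le_trans h4 bb); rewrite mulrDl !mulrDr; lra.
by rewrite mulrAC ler_pdivlMr // mulrC.
Qed.

End ball.

Lemma eball_open (q : R * R) t : open (eball q t).
Proof.
have -> : eball q t = (fun x : R * R => (x.1 - q.1) ^+ 2 + (x.2 - q.2) ^+ 2) @^-1` [set z | z < t ^+ 2] by [].
by apply: open_comp; [move=> x _; exact: cont_disc|exact: open_lt].
Qed.

Lemma eball_meas (q : R * R) t : measurable (eball q t : set T2).
Proof. exact: open_measurable_prod (@eball_open q t). Qed.

Lemma eball_center (x : R * R) r : 0 < r -> eball x r x.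
Proof. by move=> r0; rewrite /eball /= !subrr expr0n addr0 exprn_gt0. Qed.

Lemma eball_sub (x : R * R) r r' : 0 <= r -> r <= r' -> eball x r `<=` eball x r'.
Proof.
move=> r0 rr y /= h; apply: (lt_le_trans h).
by rewrite lerXn2r // nnegrE // (le_trans r0).
Qed.

Lemma eball_sym (x y : R * R) r : eball x r y -> eball y r x.
Proof. by rewrite /eball /= -(sqrrN (x.1 - y.1)) -(sqrrN (x.2 - y.2)) !opprB. Qed.

Lemma eball_tri (x y : R * R) r d : 0 < r -> 0 < d -> eball x d y -> eball y r `<=` eball x (r + d).
Proof.
move=> r0 d0; rewrite /eball /= => h z /= k.
have -> : z.1 - x.1 = (z.1 - y.1) + (y.1 - x.1) by ring.
have -> : z.2 - x.2 = (z.2 - y.2) + (y.2 - x.2) by ring.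
move: (z.1 - y.1) (z.2 - y.2) (y.1 - x.1) (y.2 - x.2) k h => a b c e k h.
suff : a * c + b * e <= r * d by nra.
rewrite leNgt; apply/negP => hc.
have h1 : (r * d) ^+ 2 < (a * c + b * e) ^+ 2 by rewrite ltrXn2r // ?nnegrE ?mulr_ge0 // ltW // (lt_trans _ hc) ?mulr_gt0.
have h2 : (a ^+ 2 + b ^+ 2) * (c ^+ 2 + e ^+ 2) <= r ^+ 2 * d ^+ 2.
  by apply: ler_pM; rewrite ?addr_ge0 ?sqr_ge0 // ltW.
have h3 := sqr_ge0 (a * e - b * c); nra.
Qed.

Lemma eball_ball (x : R * R) (r e : R) : 0 < r -> r <= e -> eball x r `<=` ball x e.
Proof.
move=> r0 re y; rewrite /eball /= => h.
have bnd (a b : R) : a ^+ 2 + b ^+ 2 < r ^+ 2 -> `|- a| < e.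
  move=> k; rewrite normrN; apply: lt_le_trans re; rewrite -ltr_sqr ?nnegrE ?(ltW r0) //.
  by rewrite real_normK ?num_real //; have := sqr_ge0 b; lra.
split; rewrite /ball /= -opprB; first exact: bnd h.
by rewrite addrC in h; exact: bnd h.
Qed.

Lemma int2_indic_le (A B : set (R * R)) (u : R * R -> R) : measurable (A : set T2) -> measurable (B : set T2) ->
  Bc u -> (forall x, 0 <= u x) -> A `<=` B -> int2 (fun x => \1_A x * u x) <= int2 (fun x => \1_B x * u x).
Proof.
move=> mA mB bu u0 AB; apply: int2_le; [exact: Bc_indic|exact: Bc_indic|].
move=> x; apply: ler_wpM2r => //; rewrite !indicE ler_nat.
by case: (boolP (x \in A)) => // /set_mem /AB /mem_set ->.
Qed.

Section chain.
Variables (A : set (R * R)) (l : R) (K : set (R * R)).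
Hypothesis l0 : 0 <= l.
Hypothesis hl : forall h h1 h2, C1c A h h1 h2 -> 0 <= Qf l h h1 h2.
Hypothesis oA : open A.

(** Smallness of u on [K] propagates to a neighbourhood of x, with constants uniform in u. The
    square root is the price for u being only a near-minimiser. *)
Definition good (x : R * R) := exists r : R, exists C : R, [/\ 0 < r, 0 <= C & forall u u1 u2,
  C1c A u u1 u2 -> (forall x, 0 <= u x) ->
  int2 (fun z => \1_(eball x r) z * u z) <= C * (int2 (fun z => \1_K z * u z) + Num.sqrt (Qf l u u1 u2))].

(** The radius d depends on x alone, so goodness is constant near every point of [A]. This is
    possible because the exponent in [ball_harnack] adapts to the disc of y, however small. *)
Lemma good_local x : A x -> exists2 d, 0 < d & forall y z, eball x d y -> eball x d z -> good y -> good z.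
Proof.
move=> Ax; have /nbhs_ballP[e /= e0 he] : nbhs x A by exact: open_nbhs_nbhs.
pose r := e / 4; have r0 : 0 < r by rewrite divr_gt0.
pose d := r / 8; have d0 : 0 < d by rewrite divr_gt0.
exists d => // y z hy hz [r1 [C [r10 C0 hC]]].
have sub : [set z | (z.1 - y.1) ^+ 2 + (z.2 - y.2) ^+ 2 <= r ^+ 2] `<=` A.
  move=> w /= hw; apply: he; apply: (@eball_ball _ (2 * r + d)); rewrite ?addr_gt0 ?mulr_gt0 //.
    by rewrite /d /r; lra.
  apply: (@eball_tri x y); rewrite ?mulr_gt0 //.
  rewrite /eball /=; apply: (le_lt_trans hw); have r2 : 0 < r ^+ 2 by rewrite exprn_gt0.
  have -> : (2 * r) ^+ 2 = 4 * r ^+ 2 by ring.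
  by move: r2; move: (r ^+ 2) => a; lra.
pose m := Num.bound (2 * r ^+ 2 / r1 ^+ 2).
have hm : 2 * r ^+ 2 <= m.+3%:R * r1 ^+ 2.
  have q0 : 0 <= 2 * r ^+ 2 / r1 ^+ 2.
    by apply: divr_ge0; [apply: mulr_ge0 => //|]; exact: sqr_ge0.
  rewrite -ler_pdivrMr ?exprn_gt0 //; apply/ltW/(lt_le_trans (archi_boundP q0)).
  by rewrite ler_nat -/m -addn3 leq_addr.
have [C2 C20 hC2] := ball_harnack l0 hl r0 sub hm.
exists (r / 8), (C2 * (C + 1)); split; [by rewrite divr_gt0|by rewrite mulr_ge0 // addr_ge0|].
move=> u u1 u2 cu u0.
have bu := C1c_Bc cu.
have h1 := hC2 _ _ _ cu u0; have h2 := hC _ _ _ cu u0.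
have sub2 : eball z (r / 8) `<=` eball y (r / 2).
  have s1 := eball_tri (divr_gt0 r0 (ltr0n _ 8 : 0 < 8%:R)) d0 hz.
  have s2 := eball_tri (addr_gt0 (divr_gt0 r0 (ltr0n _ 8 : 0 < 8%:R)) d0) d0 (eball_sym hy).
  have s3 : eball y (r / 8 + d + d) `<=` eball y (r / 2).
    by apply: eball_sub; rewrite ?addr_ge0 ?divr_ge0 // ?(ltW r0) // ?(ltW d0) // /d; have := r0; lra.
  by move=> w /s1 /s2 /s3.
have h3 := int2_indic_le (@eball_meas z (r / 8)) (@eball_meas y (r / 2)) bu u0 sub2.
apply: (le_trans h3); apply: (le_trans h1).
rewrite -mulrA ler_wpM2l // mulrDl mul1r lerD //.
have : 0 <= int2 (fun z => \1_K z * u z) by apply: int2_ge0 => w; rewrite mulr_ge0.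
lra.
Qed.

Lemma good_path (g : R -> R * R) : continuous g -> (forall t, 0 <= t <= 1 -> A (g t)) -> good (g 0) -> good (g 1).
Proof.
move=> cg gA g0; pose I : set R := `[0, 1]%classic.
have I01 t : I t <-> 0 <= t <= 1 by rewrite /I /= in_itv.
have loc t : I t -> \forall s \near t, good (g s) <-> good (g t).
  move=> /I01 It; have [d d0 hd] := good_local (gA t It).
  have n0 : nbhs (g t) (eball (g t) d).
    by apply: open_nbhs_nbhs; split; [exact: eball_open|rewrite /eball /= !subrr expr0n addr0 exprn_gt0].
  have : \forall s \near t, eball (g t) d (g s) := cg t _ n0.
  by apply: filterS => s hs; split; apply: hd => //; exact: nbhs_singleton.
pose B : set R := [set t | I t /\ good (g t)].
suff BI : B = I by have [] : B 1 by rewrite BI; apply/I01; rewrite ler01 lexx.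
apply: (@segment_connected R 0 1).
- by exists 0; split => //; apply/I01; rewrite lexx ler01.
(* The implication extends the set to the whole line, so that its interior witnesses openness
   relative to [0, 1]; closedness is obtained from the complement in the same way. *)
- exists ([set s | I s -> good (g s)]°); first exact: open_interior.
  apply/seteqP; split => t /=.
    by move=> [It gt]; split => //; apply: filterS (loc t It) => s [_ h] _; exact: h.
  by move=> [It /interior_subset h]; split => //; exact: h.
- exists (~` ([set s | I s -> ~ good (g s)]°)).
    by apply: open_closedC; exact: open_interior.
  apply/seteqP; split => t /=.
    by move=> [It gt]; split => // /interior_subset /=; apply.
  move=> [It h]; split => //; apply: contrapT => ng; apply: h.
  by apply: filterS (loc t It) => s [h _] _ /h.
Qed.

Lemma good_segment x y : (forall t, 0 <= t <= 1 -> A (x.1 + t * (y.1 - x.1), x.2 + t * (y.2 - x.2))) ->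
  good x -> good y.
Proof.
move=> h gx; pose g (t : R) := (x.1 + t * (y.1 - x.1), x.2 + t * (y.2 - x.2)).
have g0 : g 0 = x by rewrite /g !mul0r !addr0 -surjective_pairing.
have g1 : g 1 = y by rewrite /g !mul1r !(addrC _ (_ - _)) !subrK -surjective_pairing.
rewrite -g1; apply: good_path; [|exact: h|by rewrite g0].
have cl (a b : R) : continuous (fun t : R => a + t * b).
  by move=> t; apply: cvgD; [exact: cvg_cst|apply: cvgM; [exact: cvg_id|exact: cvg_cst]].
by move=> t; exact: (cvg_pair (@cl _ _ t) (@cl _ _ t)).
Qed.

(** Finitely many of the discs cover [L], and their constants add up. *)
Lemma good_compact (L : set (R * R)) : compact L -> (forall x, L x -> good x) -> measurable (L : set T2) ->
  exists2 C : R, 0 <= C & forall u u1 u2, C1c A u u1 u2 -> (forall x, 0 <= u x) ->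
  int2 (fun z => \1_L z * u z) <= C * (int2 (fun z => \1_K z * u z) + Num.sqrt (Qf l u u1 u2)).
Proof.
move=> cL gL mL.
pose P (x : R * R) (p : R * R) := L x -> [/\ 0 < p.1, 0 <= p.2 & forall u u1 u2,
  C1c A u u1 u2 -> (forall x, 0 <= u x) ->
  int2 (fun z => \1_(eball x p.1) z * u z) <= p.2 * (int2 (fun z => \1_K z * u z) + Num.sqrt (Qf l u u1 u2))].
have [p hp] : {p : R * R -> R * R & forall x, P x (p x)}.
  apply: (@choice _ _ P) => x; have [Lx|nL] := pselect (L x); last by exists (0, 0).
  by have [r [C h]] := gL x Lx; exists (r, C).
have ccL : cover_compact (L : set (R * R)%type) by move: cL; rewrite (@compact_cover (R * R)%type).
have cov : L `<=` cover L (fun x => eball x (p x).1).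
  by move=> x Lx; exists x => //; case: (hp x Lx) => h _ _; exact: eball_center.
have [D DL cD] := ccL _ L (fun x => eball x (p x).1) (fun x _ => @eball_open x (p x).1) cov.
pose s := finmap.enum_fset D.
have Ls i : i \in s -> L i by move=> /DL /set_mem.
exists (\sum_(i <- s) (p i).2).
  by rewrite big_seq; apply: sumr_ge0 => i /Ls /hp[].
move=> u u1 u2 cu u0; have bu := C1c_Bc cu.
have bi i : i \in s -> Bc (fun z => \1_(eball i (p i).1) z * u z).
  by move=> _; apply: Bc_indic => //; exact: eball_meas.
apply: (@le_trans _ _ (int2 (fun z => \sum_(i <- s) \1_(eball i (p i).1) z * u z))).
  apply: int2_le; [exact: Bc_indic|exact: Bc_sum|move=> z].
  rewrite indicE; have [/set_mem Lz|_] := boolP (z \in L); last first.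
    by rewrite mul0r; apply: sumr_ge0 => i _; rewrite mulr_ge0.
  have [i iD hi] := cD z Lz.
  rewrite mul1r (big_rem i) //= indicE (mem_set hi) mul1r lerDl.
  by apply: sumr_ge0 => j _; rewrite mulr_ge0.
rewrite int2_sum // mulr_suml big_seq [leRHS]big_seq; apply: ler_sum => i /Ls /hp[_ _]; exact.
Qed.

End chain.
End Harnack.

(** * The mass of near-minimisers in a cell below the lid *)

Section Mass.
Variable R : realType.
Local Notation H := (@hersch R).
Local Notation T2 := (measurableTypeR R * measurableTypeR R)%type.

(** The depth below the lid, between 1/10 and 1/8, and the width are chosen so that every pulse
    centred in [5/2, 251/100] is bounded below here; see [pulse_cell]. *)
Definition cell : set (R * R) := rect (249 / 100) (251 / 100) (7 / 8) (9 / 10).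
Definition bend : set (R * R) := [set x | x.1 < 0 /\ x.1 ^+ 2 + x.2 ^+ 2 < 1].
Definition bend_in (s : R) : set (R * R) := [set x | x.1 <= - s /\ x.1 ^+ 2 + x.2 ^+ 2 <= 1 - s].

(** Two segments lead from the cell to x: from its centre [z] to [p], staying at positive height
    above the slit, then from [p] to x inside the convex bend. At [z] itself a disc inside the cell
    gives the constant 1. *)
Lemma good_bend (l : R) : 0 <= l -> (forall h h1 h2, C1c H h h1 h2 -> 0 <= Qf l h h1 h2) ->
  forall x, bend x -> good H l cell x.
Proof.
move=> l0 hl x [x0 x1]; pose p : R * R := (- (1 / 2), 1 / 4); pose z : R * R := (5 / 2, 71 / 80).
have gz : good H l cell z.
  exists (1 / 100), 1; split=> // u u1 u2 cu u0.
  have bu := C1c_Bc cu.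
  have sub : eball z (1 / 100) `<=` cell.
    move=> y; rewrite /eball /cell /rect /z /= => h.
    have h1 : (y.1 - 5 / 2) ^+ 2 < (1 / 100) ^+ 2 by apply: le_lt_trans h; rewrite lerDl sqr_ge0.
    have h2 : (y.2 - 71 / 80) ^+ 2 < (1 / 100) ^+ 2 by apply: le_lt_trans h; rewrite lerDr sqr_ge0.
    have bnd (a : R) : a ^+ 2 < (1 / 100) ^+ 2 -> - (1 / 100) < a < 1 / 100.
      by rewrite -(real_normK (num_real a)) ltr_sqr ?nnegrE // ltr_norml.
    move: (bnd _ h1) (bnd _ h2) => /andP[? ?] /andP[? ?].
    by apply/andP; split; apply/andP; split; lra.
  have h := int2_indic_le (@eball_meas R z (1 / 100)) (@rect_meas R _ _ _ _) bu u0 sub.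
  by apply: (le_trans h); rewrite [leRHS]mul1r lerDl sqrtr_ge0.
have oH := @hersch_open R.
apply: (good_segment l0 hl oH (x := p)).
  move=> t /andP[t0 t1] /=; left; split => /=; last first.
    by move: x0; nra.
  have h : (1 - t) * (5 / 16) + t * (x.1 ^+ 2 + x.2 ^+ 2) < 1 by nra.
  apply: le_lt_trans h.
  have k : 0 <= t * (1 - t) by rewrite mulr_ge0 ?subr_ge0.
  have := mulr_ge0 k (sqr_ge0 (x.1 + 1 / 2)); have := mulr_ge0 k (sqr_ge0 (x.2 - 1 / 4)).
  move: x.1 x.2 => a b h1 h2; rewrite -subr_ge0.
  have -> : (1 - t) * (5 / 16) + t * (a ^+ 2 + b ^+ 2) -
    ((- (1 / 2) + t * (a - - (1 / 2))) ^+ 2 + (1 / 4 + t * (b - 1 / 4)) ^+ 2) =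
    t * (1 - t) * (b - 1 / 4) ^+ 2 + t * (1 - t) * (a + 1 / 2) ^+ 2 by field.
  by rewrite addr_ge0.
apply: (good_segment l0 hl oH (x := z)) gz.
move=> t /andP[t0 t1] /=.
have [h|h] := ltP (5 / 2 + t * (- (1 / 2) - 5 / 2)) 0.
  by left; split => //=; nra.
right; split => //=; rewrite normr_gt0 ltr_norml; apply/and3P; split; [|lra|lra].
by rewrite lt0r_neq0 //; lra.
Qed.

Lemma bend_open : open bend.
Proof.
have -> : bend = (fun x : R * R => x.1) @^-1` [set t | t < 0] `&` (fun x : R * R => x.1 ^+ 2 + x.2 ^+ 2) @^-1` [set t | t < 1].
  by apply/seteqP; split => x.
apply: openI; (apply: open_comp; last exact: open_lt).
  by move=> x _; exact: cont_fst2.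
by move=> x _; apply: contD; apply: contX; [exact: cont_fst2|exact: cont_snd2].
Qed.

Lemma bend_in_closed s : closed (bend_in s).
Proof.
have -> : bend_in s = (fun x : R * R => x.1) @^-1` [set t | t <= - s] `&` (fun x : R * R => x.1 ^+ 2 + x.2 ^+ 2) @^-1` [set t | t <= 1 - s].
  by apply/seteqP; split => x.
apply: closedI; (apply: closed_comp; last exact: closed_le).
  by move=> x _; exact: cont_fst2.
by move=> x _; apply: contD; apply: contX; [exact: cont_fst2|exact: cont_snd2].
Qed.

Lemma bend_in_meas s : measurable (bend_in s : set T2).
Proof.
rewrite -[bend_in s]setCK; apply: measurableC; apply: open_measurable_prod.
by apply: closed_openC; exact: bend_in_closed.
Qed.

Lemma bend_in_compact s : 0 < s -> compact (bend_in s).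
Proof.
move=> s0; apply: (subclosed_compact (@bend_in_closed s) (@closed_disc_compact R (0, 0) 1)).
by move=> x [_ h] /=; rewrite !subr0 expr1n; apply: (le_trans h); rewrite gerBl ltW.
Qed.

Lemma bend_sub_bx : bend `<=` bx 1.
Proof.
move=> x [_ h].
have h1 : x.1 ^+ 2 < 1 by apply: le_lt_trans h; rewrite lerDl sqr_ge0.
have h2 : x.2 ^+ 2 < 1 by apply: le_lt_trans h; rewrite lerDr sqr_ge0.
move: (sqr_lt1 h1) (sqr_lt1 h2) => /andP[? ?] /andP[? ?].
by split; rewrite /= in_itv /=; apply/andP; split; apply: ltW.
Qed.

(** The constants of the Harnack chain are uniform on compact subsets of the bend only; what is left
    near its boundary has small area. *)
Lemma bend_exhaust (e : R) : 0 < e -> exists2 s : R, 0 < s & (@leb R (bend `\` bend_in s) < e%:E)%E.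
Proof.
move=> e0; pose F (n : nat) : set T2 := bend `\` bend_in n.+1%:R^-1.
have mb : measurable (bend : set T2) by apply: open_measurable_prod; exact: bend_open.
have mF n : measurable (F n) by apply: measurableD => //; exact: bend_in_meas.
have F0 : \bigcap_n F n = set0.
  rewrite -subset0 => x Fx; have [[x0 x1] _] := Fx 0%N I.
  pose m := Num.min (- x.1) (1 - (x.1 ^+ 2 + x.2 ^+ 2)).
  have m0 : 0 < m by rewrite lt_min oppr_gt0 x0 subr_gt0.
  have [n _ hn] := near_infty_natSinv_lt (PosNum m0).
  have {}hn := hn n (leqnn n); rewrite /= lt_min in hn.
  have [_] := Fx n I; apply; move: hn => /andP[h1 h2].
  by split; move: h1 h2; move: (_^-1) => q; lra.
have cv : (@leb R \o F) @ \oo --> @leb R (\bigcap_n F n).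
  apply: nonincreasing_cvg_mu => //.
  - apply: le_lt_trans (@bx_fin R 1); apply: le_measure; rewrite ?inE //; first exact: bx_meas.
    by move=> x [/bend_sub_bx].
  - by rewrite F0.
  - move=> m n mn; apply/subsetPset => x [bx nx]; split => // -[h1 h2]; apply: nx.
    have : n.+1%:R^-1 <= m.+1%:R^-1 :> R by rewrite lef_pV2 ?posrE // ler_nat.
    by move: h1 h2 => /=; move: (n.+1%:R^-1) (m.+1%:R^-1) => a b; split; lra.
rewrite F0 measure0 in cv.
have : \forall n \near \oo, (@leb R (F n) < e%:E)%E.
  apply: (cv [set y | (y < e%:E)%E]); apply: open_nbhs_nbhs.
  by split; [exact: open_ereal_lt_ereal|rewrite /= lte_fin].
by case=> n _ /(_ n (leqnn n)) h; exists n.+1%:R^-1.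
Qed.

Lemma bend_split (f : R * R -> R) (s : R) : 0 < s -> (forall x, ~ H x -> f x = 0) -> forall x,
  (x.1 < 0)%R%:R * f x = \1_(bend `\` bend_in s) x * f x + \1_(bend_in s) x * f x.
Proof.
move=> s0 f0 x; rewrite !indicE.
have [Hx|/f0 ->] := pselect (H x); last by rewrite !mulr0 addr0.
have [xb|nb] := boolP (x \in bend_in s).
  rewrite memNset => [|[_]]; last by move/set_mem: xb.
  by rewrite mul0r add0r; have [h _] := set_mem xb; rewrite (_ : (x.1 < 0) = true) //; apply: le_lt_trans h _; rewrite oppr_lt0.
rewrite mul0r addr0; congr ((nat_of_bool _)%:R * _); apply/idP/idP => h.
  apply/mem_set; split; last by move/negP: nb => nb h2; apply: nb; exact/mem_set.
  by case: Hx => [[? ?]|[_]]; [split|rewrite leNgt h].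
by have [[]] := set_mem h.
Qed.

(** The bend mass splits into a thin layer, negligible by its area, and a compact part dominated by
    the cell through the Harnack chain. The constants serve all near-minimisers with energy at most
    l + d. *)
Lemma cell_mass (l : R) : lambda1 H = l%:E -> 0 <= l -> l < pi ^+ 2 -> exists c d : R, [/\ 0 < c, 0 < d & forall f f1 f2,
  C1c H f f1 f2 -> (forall x, 0 <= f x) -> nrm2 f = 1 -> energy f1 f2 <= l + d ->
  c <= int2 (fun x => \1_cell x * f x)].
Proof.
move=> lH l0 lp; have hl h h1 h2 : C1c H h h1 h2 -> 0 <= Qf l h h1 h2.
  by move=> ch; rewrite subr_ge0; apply: (rayleigh _ ch) => //; rewrite lH.
have [c [d [c0 d0 hc]]] := bend_L1 l0 lp.
have e0 : 0 < c ^+ 2 / 8 by rewrite divr_gt0 // exprn_gt0.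
have [s s0 hs] := bend_exhaust e0.
have sb : bend_in s `<=` bend.
  by move=> x [h1 h2]; split; move: h1 h2; have := s0; lra.
have [C C0 hC] := good_compact (bend_in_compact s0) (fun x h => good_bend l0 hl (sb x h)) (@bend_in_meas s).
(* With a defect at most k^2, a cell mass below k would give C (I + k) < c / 2, against the lower
   bound on the compact part. *)
pose k := c / (4 * (C + 1)); have k0 : 0 < k by rewrite divr_gt0 // mulr_gt0 // ltr_wpDl.
exists k, (Num.min d (k ^+ 2)); split => //; first by rewrite lt_min d0 exprn_gt0.
move=> f f1 f2 cf f0 nf ef; have bf := C1c_Bc cf.
have ed : energy f1 f2 <= l + d by apply: (le_trans ef); rewrite lerD2l ge_min lexx.
have ek : Qf l f f1 f2 <= k ^+ 2.
  by rewrite /Qf nf mulr1 lerBlDl (le_trans ef) // lerD2l ge_min lexx orbT.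
have sk : Num.sqrt (Qf l f f1 f2) <= k.
  by rewrite -[leRHS](ger0_norm (ltW k0)) -sqrtr_sqr ler_sqrt // exprn_ge0 // ltW.
have h1 := hc _ _ _ cf f0 nf ed.
have h2 := hC _ _ _ cf f0.
have mF : measurable (bend `\` bend_in s : set T2).
  by apply: measurableD; [apply: open_measurable_prod; exact: bend_open|exact: bend_in_meas].
have bF : Bc (\1_(bend `\` bend_in s) : R * R -> R).
  split; first exact: measurable_indic.
  exists 1 => x; rewrite indicE; split; first by case: (_ \in _); rewrite ?normr1 ?normr0.
  move=> hx; rewrite memNset // => -[/bend_sub_bx [/= + +] _].
  by rewrite !in_itv /= -!ler_norml !leNgt; case: hx => ->.
have aF : int2 (\1_(bend `\` bend_in s) : R * R -> R) <= c ^+ 2 / 8.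
  apply: ltW; rewrite -lte_fin -EFin_int2 //; move: hs; congr (_ < _)%E.
  by rewrite integral_indic // setIT.
(* On the thin layer f <= c/4 f^2 + 1/c, and its area is below c^2 / 8. *)
have h3 : int2 (fun x => \1_(bend `\` bend_in s) x * f x) <= c / 4 + c / 8.
  have -> : c / 4 + c / 8 = c / 4 * nrm2 f + c^-1 * (c ^+ 2 / 8).
    by rewrite nf; have := lt0r_neq0 c0; move: (c) => z zn; field.
  apply: (@le_trans _ _ (c / 4 * nrm2 f + c^-1 * int2 (\1_(bend `\` bend_in s) : R * R -> R))).
    rewrite /nrm2 -!int2_Z //; last exact: Bc_sqr.
    rewrite -int2_D; [|by apply: BcZ; exact: Bc_sqr|exact: BcZ].
    apply: int2_le; [exact: Bc_indic|by apply: BcD; apply: BcZ => //; exact: Bc_sqr|move=> x].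
    rewrite indicE; case: (_ \in _); last by rewrite mul0r mulr0 addr0 mulr_ge0 ?sqr_ge0 // divr_ge0 // ltW.
    have : 0 <= (c / 2 * f x - 1) ^+ 2 / c by rewrite divr_ge0 ?sqr_ge0 // ltW.
    have cn := lt0r_neq0 c0; move: (f x) => z hz; rewrite mul1r mulr1 -subr_ge0.
    suff <- : (c / 2 * z - 1) ^+ 2 / c = c / 4 * z ^+ 2 + c^-1 - z by [].
    by field.
  by rewrite lerD2l ler_pM2l // invr_gt0.
have h4 : c <= c / 4 + c / 8 + int2 (fun x => \1_(bend_in s) x * f x).
  have off x : ~ H x -> f x = 0.
    by have [_ _ _ _ [L [_ LH L0]]] := cf; move=> nH; apply: L0 => /LH.
  apply: (le_trans h1); rewrite (_ : (fun x => (x.1 < 0)%R%:R * f x) =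
    (fun x => \1_(bend `\` bend_in s) x * f x + \1_(bend_in s) x * f x)); last first.
    by apply/funext => x; exact: bend_split.
  by rewrite int2_D; [rewrite lerD2r|exact: Bc_indic|apply: Bc_indic => //; exact: bend_in_meas].
set I := int2 (fun x => \1_cell x * f x) in h2 *.
set J := int2 _ in h2 h4.
have h5 : c / 2 <= C * (I + k) by move: h2 h4; have := ler_wpM2l C0 sk; rewrite !mulrDr; lra.
have kE : k * (4 * (C + 1)) = c by rewrite /k mulfVK // lt0r_neq0 // mulr_gt0 // ltr_wpDl.
have I0 : 0 <= I by apply: int2_ge0 => x; rewrite mulr_ge0.
rewrite leNgt; apply/negP => Ik.
have : C * I <= C * k by rewrite ler_wpM2l // ltW.
by move: h5; rewrite mulrDr -kE; have := k0; nra.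
Qed.

End Mass.

Section Tooth.
Variable R : realType.
Local Notation H := (@hersch R).
Local Notation T2 := (measurableTypeR R * measurableTypeR R)%type.
Implicit Types (A : set (R * R)).

Lemma cont_at_div (f g : R * R -> R) (x : R * R) : {for x, continuous f} -> {for x, continuous g} -> g x != 0 ->
  {for x, continuous (fun x => f x / g x)}.
Proof. by move=> cf cg g0; apply: cvgM => //; apply: cvgV. Qed.

(** * The correctors *)

Section theta.
(* [theta] is X^3 / (1 + X)^2 with X = (s - 1)_+: it is C^2, convex and of linear growth. *)
Definition theta (s : R) : R := pp 3 (s - 1) / s ^+ 2.
Definition theta1 (s : R) : R := pp 2 (s - 1) * (s + 2) / s ^+ 3.
Definition theta2 (s : R) : R := 6 * pp 1 (s - 1) / s ^+ 4.

Lemma near_pp_0 n (s : R) : s < 1 -> \forall y \near s, pp n.+1 (y - 1) = 0 :> R.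
Proof. by move=> s1; apply: filterS (near_lt s1) => y y1; rewrite pp_neg // subr_le0 ltW. Qed.

Lemma dv_ppB n (s : R) : is_derive s 1 (fun s : R => pp n.+2 (s - 1)) (n.+2%:R * pp n.+1 (s - 1)).
Proof. exact: dv_ppd. Qed.

Lemma dv_theta (s : R) : is_derive s 1 theta (theta1 s).
Proof.
have [s1|s1] := ltP s 1.
  rewrite /theta1 (nbhs_singleton (near_pp_0 1 s1)) !mul0r.
  by apply: dv_near (dvC 0 s); apply: filterS (near_pp_0 2 s1) => y; rewrite /theta => ->; rewrite mul0r.
have s0 : s != 0 by rewrite lt0r_neq0 // (lt_le_trans _ s1).
apply: dv_eq (dv_div (dv_ppB 1 s) (dvX 2 (dv_id s)) (expf_neq0 2 s0)) _.
rewrite /theta1 /= !pp_pos ?subr_ge0 //; by field.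
Qed.

Lemma dv_theta1 (s : R) : is_derive s 1 theta1 (theta2 s).
Proof.
have [s1|s1] := ltP s 1.
  rewrite /theta2 (nbhs_singleton (near_pp_0 0 s1)) mulr0 mul0r.
  by apply: dv_near (dvC 0 s); apply: filterS (near_pp_0 1 s1) => y; rewrite /theta1 => ->; rewrite !mul0r.
have s0 : s != 0 by rewrite lt0r_neq0 // (lt_le_trans _ s1).
apply: dv_eq (dv_div (dvM (dv_ppB 0 s) (dvD (dv_id s) (dvC 2 s))) (dvX 3 (dv_id s)) (expf_neq0 3 s0)) _.
rewrite /theta2 /= !pp_pos ?subr_ge0 //; by field.
Qed.

Lemma cont_theta2 : continuous theta2.
Proof.
move=> s; have [s1|s1] := ltP s 1.
  rewrite /continuous_at {2}/theta2 (nbhs_singleton (near_pp_0 0 s1)) mulr0 mul0r.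
  by apply: cvg_near_cst; apply: filterS (near_pp_0 0 s1) => y; rewrite /theta2 => ->; rewrite mulr0 mul0r.
have s0 : s != 0 by rewrite lt0r_neq0 // (lt_le_trans _ s1).
apply: cvgM.
  apply: cvgM; first exact: cvg_cst.
  apply: (@continuous_comp _ _ _ (fun t : R => t - 1) (pp 1)); last exact: cont_pp.
  by apply: cvgB; [exact: cvg_id|exact: cvg_cst].
by apply: cvgV; [exact: expf_neq0|exact: exprn_continuous].
Qed.

Lemma theta_0 s : s <= 1 -> theta s = 0.
Proof. by move=> s1; rewrite /theta pp_neg ?mul0r // subr_le0. Qed.

Lemma theta1_0 s : s <= 1 -> theta1 s = 0.
Proof. by move=> s1; rewrite /theta1 pp_neg ?mul0r // subr_le0. Qed.

Lemma theta_ge0 s : 0 <= theta s.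
Proof. by rewrite /theta divr_ge0 ?pp_ge0 ?sqr_ge0. Qed.

Lemma theta2_ge0 s : 0 <= theta2 s.
Proof. by apply: divr_ge0; [apply: mulr_ge0 => //; exact: pp_ge0|rewrite exprn_even_ge0]. Qed.

Lemma theta_le s : 0 <= s -> theta s <= s.
Proof.
move=> s0; have [s1|s1] := leP s 1; first by rewrite theta_0.
have s0' : 0 < s by lra.
rewrite /theta pp_pos ?subr_ge0 ?(ltW s1) // ler_pdivrMr ?exprn_gt0 // -exprS.
by rewrite lerXn2r ?nnegrE //; lra.
Qed.

Lemma theta1_01 s : 0 <= theta1 s <= 1.
Proof.
have [s1|s1] := leP s 1; first by rewrite theta1_0 // lexx ler01.
have s0 : 0 < s by lra.
rewrite /theta1 pp_pos ?subr_ge0 ?(ltW s1) //; apply/andP; split.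
  by rewrite divr_ge0 ?exprn_ge0 ?mulr_ge0 ?sqr_ge0 //; lra.
rewrite ler_pdivrMr ?exprn_gt0 // mul1r -subr_ge0.
have -> : s ^+ 3 - (s - 1) ^+ 2 * (s + 2) = 3 * s - 2 by ring.
lra.
Qed.

(** 1/18 is the value at 3/2. *)
Lemma theta_ge s : 3 / 2 <= s -> 1 / 18 <= theta s.
Proof.
move=> s1; have s0 : 0 < s by lra.
rewrite /theta pp_pos; last by lra.
rewrite ler_pdivlMr ?exprn_gt0 //.
have : s / 3 <= s - 1 by lra.
have : 0 <= s / 3 by lra.
move=> h0 h1; have : (s / 3) ^+ 2 <= (s - 1) ^+ 2 by rewrite lerXn2r ?nnegrE //; lra.
rewrite exprSr; nra.
Qed.

End theta.

(* [pole] is harmonic below its singularity (p, 1 + b): it is Re (1 / z) for z = ht + i (x1 - p). *)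
Section pole.
Variables p b : R.
Definition ht (x : R * R) : R := 1 - x.2 + b.
Definition nn (x : R * R) : R := (x.1 - p) ^+ 2 + ht x ^+ 2.
Definition pole (x : R * R) : R := ht x / nn x.
Definition pole1 (x : R * R) : R := - 2 * (x.1 - p) * ht x / nn x ^+ 2.
Definition pole2 (x : R * R) : R := (ht x ^+ 2 - (x.1 - p) ^+ 2) / nn x ^+ 2.
Definition pole11 (x : R * R) : R := - 2 * ht x * (ht x ^+ 2 - 3 * (x.1 - p) ^+ 2) / nn x ^+ 3.

Lemma nn_gt0 x : 0 < ht x -> 0 < nn x.
Proof. by move=> h; rewrite /nn ltr_wpDl ?sqr_ge0 // exprn_gt0. Qed.

Lemma dv_xi x : pd1 (fun x => x.1 - p) x 1.
Proof. by apply: (dv_eq (dvB (dv_id x.1) (dvC p x.1))); rewrite subr0. Qed.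

Lemma dv_ht x : pd2 ht x (- 1).
Proof. by apply: (dv_eq (dvD (dvB (dvC 1 x.2) (dv_id x.2)) (dvC b x.2))); rewrite addr0 sub0r. Qed.

Lemma dv_nn1 x : pd1 nn x (2 * (x.1 - p)).
Proof. by apply: (dv_eq (dvD (dvX 2 (dv_xi x)) (dvC (ht x ^+ 2) x.1))); rewrite /= expr1 addr0 mulr1. Qed.

Lemma dv_nn2 x : pd2 nn x (- (2 * ht x)).
Proof.
apply: (dv_eq (dvD (dvC ((x.1 - p) ^+ 2) x.2) (dvX 2 (dv_ht x)))).
by rewrite /= expr1 add0r -surjective_pairing mulrN1.
Qed.

Lemma pd1_div f g (x : R * R) c d : pd1 f x c -> pd1 g x d -> g x != 0 ->
  pd1 (fun x => f x / g x) x ((c * g x - f x * d) / g x ^+ 2).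
Proof. by move=> hf hg gx; have := @dv_div R _ _ _ _ _ hf hg; rewrite /pd1 -surjective_pairing; apply. Qed.

Lemma pd2_div f g (x : R * R) c d : pd2 f x c -> pd2 g x d -> g x != 0 ->
  pd2 (fun x => f x / g x) x ((c * g x - f x * d) / g x ^+ 2).
Proof. by move=> hf hg gx; have := @dv_div R _ _ _ _ _ hf hg; rewrite /pd2 -surjective_pairing; apply. Qed.

Lemma dv_pole1 x : 0 < ht x -> pd1 pole x (pole1 x).
Proof.
move=> /nn_gt0 /lt0r_neq0 n0.
have h : pd1 ht x 0 := dvC (ht x) x.1.
by apply: pd1_eq (pd1_div h (dv_nn1 x) n0) _; rewrite /pole1 mul0r sub0r; ring.
Qed.

Lemma dv_pole2 x : 0 < ht x -> pd2 pole x (pole2 x).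
Proof.
move=> /nn_gt0 /lt0r_neq0 n0.
apply: pd2_eq (pd2_div (dv_ht x) (dv_nn2 x) n0) _; rewrite /pole2.
by apply: (congr1 (fun z => z / _)); rewrite /nn; ring.
Qed.

Lemma dv_pole11 x : 0 < ht x -> pd1 pole1 x (pole11 x).
Proof.
move=> /nn_gt0 /lt0r_neq0 n0.
have h : pd1 (fun x => - 2 * (x.1 - p) * ht x) x (- 2 * ht x).
  have h0 : pd1 ht x 0 := dvC (ht x) x.1.
  have h2 : pd1 (fun x => - 2 * (x.1 - p)) x (- 2 * 1) := dvZ (- 2) (dv_xi x).
  by apply: pd1_eq (pd1M h2 h0) _; rewrite mulr1 mulr0 addr0.
have h3 : pd1 (fun x => nn x ^+ 2) x (2 * nn x * (2 * (x.1 - p))).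
  by have := pd1M (dv_nn1 x) (dv_nn1 x); rewrite /pd1; move/dv_eq; apply; ring.
apply: pd1_eq (pd1_div h h3 (expf_neq0 2 n0)) _; rewrite /pole11.
move: n0; rewrite /nn; move: (x.1 - p) (ht x) => u v n0; by field.
Qed.

Lemma dv_pole22 x : 0 < ht x -> pd2 pole2 x (- pole11 x).
Proof.
move=> /nn_gt0 /lt0r_neq0 n0.
have h : pd2 (fun x => ht x ^+ 2 - (x.1 - p) ^+ 2) x (- 2 * ht x).
  have h2 : pd2 (fun x => ht x ^+ 2) x (- (2 * ht x)).
    by have := pd2M (dv_ht x) (dv_ht x); rewrite /pd2; move/dv_eq; apply; ring.
  by apply: (dv_eq (dvB h2 (dvC ((x.1 - p) ^+ 2) x.2))); rewrite subr0; ring.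
have h3 : pd2 (fun x => nn x ^+ 2) x (2 * nn x * (- (2 * ht x))).
  by have := pd2M (dv_nn2 x) (dv_nn2 x); rewrite /pd2; move/dv_eq; apply; ring.
apply: pd2_eq (pd2_div h h3 (expf_neq0 2 n0)) _; rewrite /pole11.
move: n0; rewrite /nn; move: (x.1 - p) (ht x) => u v n0; by field.
Qed.

Lemma cont_xi : continuous (fun x : R * R => x.1 - p).
Proof. by apply: cont_addc; exact: cont_fst2. Qed.

Lemma cont_ht : continuous ht.
Proof. by apply: cont_addc; apply: contD; [exact: cst_continuous|apply: contN; exact: cont_snd2]. Qed.

Lemma cont_nn : continuous nn.
Proof. by apply: contD; apply: contX; [exact: cont_xi|exact: cont_ht]. Qed.

Lemma cont_pole x : 0 < ht x -> [/\ {for x, continuous pole}, {for x, continuous pole1}, {for x, continuous pole2} &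
  {for x, continuous pole11}].
Proof.
move=> /nn_gt0 /lt0r_neq0 n0.
have cn k : {for x, continuous (fun x => nn x ^+ k)} by apply: contX; exact: cont_nn.
split.
- by apply: cont_at_div => //; [exact: cont_ht|exact: cont_nn].
- apply: cont_at_div; rewrite ?expf_neq0 //.
  by apply: contM; [apply: contZ; exact: cont_xi|exact: cont_ht].
- apply: cont_at_div; rewrite ?expf_neq0 //.
  apply: contD; first by apply: contX; exact: cont_ht.
  by apply: contN; apply: contX; exact: cont_xi.
- apply: cont_at_div; rewrite ?expf_neq0 //.
  apply: contM; first by apply: contZ; exact: cont_ht.
  apply: contD; first by apply: contX; exact: cont_ht.
  by apply: contN; apply: contZ; apply: contX; exact: cont_xi.
Qed.

(** The gradient of Re (1 / z) has length 1 / |z|^2, and |z|^2 is [nn]. *)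
Lemma pole_le x : 0 < ht x -> [/\ `|pole1 x| <= (nn x)^-1, `|pole2 x| <= (nn x)^-1 & 0 < pole x].
Proof.
move=> h; have n0 := nn_gt0 h; rewrite /pole1 /pole2 /pole divr_gt0 //.
have n2 : 0 < nn x ^+ 2 by rewrite exprn_gt0.
have e : (nn x)^-1 = nn x / nn x ^+ 2 by have := lt0r_neq0 n0; move: (nn x) => z zn; field.
have bnd (a : R) : - nn x <= a <= nn x -> `|a / nn x ^+ 2| <= (nn x)^-1.
  by rewrite normrM (gtr0_norm (_ : 0 < (nn x ^+ 2)^-1)) ?invr_gt0 // e ler_pM2r ?invr_gt0 // ler_norml.
split => //; apply: bnd; rewrite /nn; move: (x.1 - p) (ht x) => u v.
  have := sqr_ge0 (u - v); have := sqr_ge0 (u + v); rewrite !sqrrD => ? ?; apply/andP; split; nra.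
have := sqr_ge0 u; have := sqr_ge0 v => ? ?; apply/andP; split; lra.
Qed.

End pole.

Section pulse.
Variables (p a : R).
Hypothesis a0 : 0 < a.
Hypothesis a1 : a < 1.
Hypothesis p2 : 2 <= p <= 3.
Local Notation Y := (ht a).
Local Notation N := (nn p a).
(* The weight 3/4 makes [Dp] nonpositive on the lid outside |x1 - p| < 3 a. *)
Definition Dp (x : R * R) : R := pole p a x - 3 / 4 * pole p (2 * a) x.
Definition Dp1 (x : R * R) : R := pole1 p a x - 3 / 4 * pole1 p (2 * a) x.
Definition Dp2 (x : R * R) : R := pole2 p a x - 3 / 4 * pole2 p (2 * a) x.
Definition Dp11 (x : R * R) : R := pole11 p a x - 3 / 4 * pole11 p (2 * a) x.
(** Equal to 1 up to the lid and to 0 from height 1 + a/2 on, hence before the lower of the two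
    singularities at height 1 + a. *)
Definition chi (x : R * R) : R := pp 2 (1 - 4 / a ^+ 2 * pp 2 (x.2 - 1)).
Definition chi2 (x : R * R) : R := 2 * pp 1 (1 - 4 / a ^+ 2 * pp 2 (x.2 - 1)) * (- (4 / a ^+ 2 * (2 * pp 1 (x.2 - 1)))).
Definition pulse (x : R * R) : R := chi x * theta (Dp x).
Definition pulse1 (x : R * R) : R := chi x * (theta1 (Dp x) * Dp1 x).
Definition pulse2 (x : R * R) : R := chi2 x * theta (Dp x) + chi x * (theta1 (Dp x) * Dp2 x).
Let U : set (R * R) := [set x | 0 < Y x].

Lemma ht2a (x : R * R) : U x -> 0 < ht (2 * a) x.
Proof. by rewrite /U /ht /= => h; have := a0; lra. Qed.

Lemma dv_Dp1 x : U x -> pd1 Dp x (Dp1 x).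
Proof. by move=> h; exact: (dvB (dv_pole1 p h) (dvZ (3 / 4) (dv_pole1 p (ht2a h)))). Qed.

Lemma dv_Dp2 x : U x -> pd2 Dp x (Dp2 x).
Proof. by move=> h; exact: (dvB (dv_pole2 p h) (dvZ (3 / 4) (dv_pole2 p (ht2a h)))). Qed.

Lemma dv_Dp11 x : U x -> pd1 Dp1 x (Dp11 x).
Proof. by move=> h; exact: (dvB (dv_pole11 p h) (dvZ (3 / 4) (dv_pole11 p (ht2a h)))). Qed.

Lemma dv_Dp22 x : U x -> pd2 Dp2 x (- Dp11 x).
Proof.
move=> h; apply: pd2_eq (dvB (dv_pole22 p h) (dvZ (3 / 4) (dv_pole22 p (ht2a h)))) _.
by rewrite /Dp11; ring.
Qed.

Lemma cont_Dp (x : R * R) : U x -> [/\ {for x, continuous Dp}, {for x, continuous Dp1}, {for x, continuous Dp2} &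
  {for x, continuous Dp11}].
Proof.
move=> h; have [c1 c2 c3 c4] := cont_pole p h; have [d1 d2 d3 d4] := cont_pole p (ht2a h).
by split; apply: cvgB => //; apply: cvgM => //; exact: cvg_cst.
Qed.

Lemma cont_at_comp (F : R -> R) (g : R * R -> R) (x : R * R) : continuous F -> {for x, continuous g} ->
  {for x, continuous (fun x => F (g x))}.
Proof. by move=> cF cg; apply: (@continuous_comp _ _ _ g F) => //; exact: cF. Qed.

Lemma cont_theta : continuous theta.
Proof. by move=> t; exact: dv_continuous (dv_theta t). Qed.

Lemma cont_theta1 : continuous theta1.
Proof. by move=> t; exact: dv_continuous (dv_theta1 t). Qed.

Lemma dv_chi2 x : pd2 chi x (chi2 x).
Proof.
have h := dv_ppd 1 0 x.2.
have h2 : is_derive x.2 1 (fun t => 1 - 4 / a ^+ 2 * pp 2 (t - 1)) (- (4 / a ^+ 2 * (2 * pp 1 (x.2 - 1)))).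
  by apply: (dv_eq (dvB (dvC 1 x.2) (dvZ (4 / a ^+ 2) h))); rewrite sub0r.
by apply: pd2_eq (pd2_comp (dv_pp 0) (h2 : pd2 (fun x => 1 - 4 / a ^+ 2 * pp 2 (x.2 - 1)) x _)) _.
Qed.

Lemma dv_chi1 x : pd1 chi x 0.
Proof. exact: (dvC (chi x) x.1). Qed.

Lemma cont_pp1 n : continuous (fun x : R * R => pp n (x.2 - 1)).
Proof. by apply: cont_comp1; [exact: cont_pp|apply: cont_addc; exact: cont_snd2]. Qed.

Lemma cont_chi : continuous chi.
Proof.
apply: cont_comp1; first exact: cont_pp.
apply: contD; first exact: cst_continuous.
by apply: contN; apply: contZ; exact: cont_pp1.
Qed.

Lemma cont_chi2 : continuous chi2.
Proof.
apply: contM.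
  apply: contZ; apply: cont_comp1; first exact: cont_pp.
  apply: contD; first exact: cst_continuous.
  by apply: contN; apply: contZ; exact: cont_pp1.
by apply: contN; apply: contZ; apply: contZ; exact: cont_pp1.
Qed.

Lemma chi_arg (x : R * R) : 1 + a / 2 <= x.2 -> 1 - 4 / a ^+ 2 * pp 2 (x.2 - 1) <= 0.
Proof.
have a0' := a0; move=> h; rewrite subr_le0 pp_pos; last by lra.
rewrite mulrAC ler_pdivlMr ?exprn_gt0 // mul1r.
have : (a / 2) ^+ 2 <= (x.2 - 1) ^+ 2 by rewrite lerXn2r ?nnegrE //; lra.
by move: (x.2 - 1) => z; rewrite exprMn => hz; lra.
Qed.

Lemma chi_off (x : R * R) : 1 + a / 2 <= x.2 -> chi x = 0 /\ chi2 x = 0.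
Proof.
move=> /chi_arg h; rewrite /chi /chi2; move: h; move: (1 - _) => z z0.
have e1 : pp 1 z = 0 := pp_neg 0 z0; have e2 : pp 2 z = 0 := pp_neg 1 z0.
by rewrite e1 e2 mulr0 mul0r.
Qed.

Lemma near_chi (x : R * R) : ~ U x -> \forall y \near x, chi y = 0.
Proof.
rewrite /U /ht /= => /negP; rewrite -leNgt => h; have a0' := a0.
have : \forall y \near x, 1 + a / 2 < y.2.
  have h' : 1 + a / 2 < x.2 by lra.
  exact: (@cont_snd2 R x _ (near_gt h')).
by apply: filterS => y /ltW /chi_off [].
Qed.

Lemma near_chi2 (x : R * R) : ~ U x -> \forall y \near x, chi2 y = 0.
Proof. by move=> /near_chi; apply: near_pd2_0; exact: dv_chi2. Qed.

Lemma chi_in (x : R * R) : x.2 <= 1 -> chi x = 1 /\ chi2 x = 0.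
Proof.
move=> h; have e1 : pp 2 (x.2 - 1) = 0 :> R by apply: pp_neg; lra.
have e2 : pp 1 (x.2 - 1) = 0 :> R by apply: pp_neg; lra.
rewrite /chi /chi2 e1 e2; by rewrite !mulr0 oppr0 mulr0 addr0 pp_pos ?expr1n.
Qed.

Lemma chi_bound (x : R * R) : [/\ 0 <= chi x, chi x <= 1 & `|chi2 x| <= 8 / a].
Proof.
have q0 : 0 <= 4 / a ^+ 2 by apply: divr_ge0 => //; apply: sqr_ge0.
have k0 : 0 <= 4 / a ^+ 2 * pp 2 (x.2 - 1) by apply: mulr_ge0 => //; exact: pp_ge0.
have m1 : 0 <= Num.max (1 - 4 / a ^+ 2 * pp 2 (x.2 - 1)) 0 <= 1.
  by rewrite le_max lexx orbT ge_max ler01 gerBl k0.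
split; first exact: pp_ge0.
  by move/andP: m1 => [? ?]; rewrite /chi /pp exprn_ile1.
have [h|h] := leP (1 + a / 2) x.2.
  by have [_ ->] := chi_off h; rewrite normr0 divr_ge0 // ltW.
rewrite /chi2 normrM normrN [pp 1 (1 - _)]/pp expr1.
have -> : 8 / a = 2 * (4 / a ^+ 2 * (2 * (a / 2))) by have := lt0r_neq0 a0; move: (a) => z zn; field.
have p1 : 0 <= pp 1 (x.2 - 1) <= a / 2.
  by have a0' := a0; rewrite pp_ge0 /pp expr1 ge_max; apply/andP; split; lra.
move/andP: m1 => [m0 m1]; move/andP: p1 => [p0 p1].
rewrite !ger0_norm; [|exact: mulr_ge0 q0 (mulr_ge0 _ p0)|exact: mulr_ge0].
apply: ler_pM; [exact: mulr_ge0|exact: mulr_ge0 q0 (mulr_ge0 _ p0)|by rewrite ler_piMr|].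
by apply: ler_wpM2l => //; rewrite ler_pM2l.
Qed.

(** From [1 <= Dp x] the first pole is at least 1, so x lies in the disc [N x <= Y x] of diameter 1
    hanging from the singularity. Above the lid the subtracted pole confines the pulse to |x1 - p| <
    3 a, the inside of a tooth when a = e / 3. *)
Lemma pulse_region (x : R * R) : x.2 <= 1 + a / 2 -> 1 <= Dp x -> [/\ N x <= Y x, a / 2 <= Y x <= 1, `|x.1 - p| <= 1 / 2,
  a <= x.2 & 1 <= x.2 -> `|x.1 - p| < 3 * a].
Proof.
move=> hx D1; have a0' := a0; have a1' := a1.
have Ya : a / 2 <= Y x by rewrite /ht; lra.
have Y0 : 0 < Y x by lra.
have Ux : U x by [].
have n0 := nn_gt0 p Y0; have m0 := nn_gt0 p (ht2a Ux).
have [_ _ q0] := pole_le p Y0; have [_ _ r0] := pole_le p (ht2a Ux).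
have NY : N x <= Y x.
  have : 1 <= pole p a x by move: D1; rewrite /Dp; lra.
  by rewrite /pole ler_pdivlMr // mul1r.
have Y1 : Y x <= 1.
  have : Y x ^+ 2 <= Y x by apply: le_trans NY; rewrite lerDr sqr_ge0.
  nra.
split => //.
- by rewrite Ya.
- rewrite -ler_sqr ?nnegrE // real_normK ?num_real //.
  by move: NY; rewrite /nn; have := sqr_ge0 (Y x - 1 / 2); move: (Y x) (x.1 - p) => u v; nra.
- by move: Y1; rewrite /ht; lra.
- move=> x1; rewrite -ltr_sqr ?nnegrE ?mulr_ge0 ?(ltW a0) // real_normK ?num_real //.
  have D0 : 3 / 4 * (ht (2 * a) x * N x) < Y x * nn p (2 * a) x.
    have : 0 < Dp x by lra.
    rewrite /Dp /pole subr_gt0 -(ltr_pM2r (mulr_gt0 n0 m0)).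
    have -> : 3 / 4 * (ht (2 * a) x / nn p (2 * a) x) * (N x * nn p (2 * a) x) = 3 / 4 * (ht (2 * a) x * N x).
      by have := lt0r_neq0 m0; move: (nn p (2 * a) x) => z zn; field.
    have -> : Y x / N x * (N x * nn p (2 * a) x) = Y x * nn p (2 * a) x by have := lt0r_neq0 n0; move: (N x) => z zn; field.
    by [].
  have Yle : Y x <= a by rewrite /ht; lra.
  have e2 : ht (2 * a) x = Y x + a by rewrite /ht; ring.
  move: D0; rewrite /nn e2; move: Ya Yle Y0; move: (Y x) (x.1 - p) => v u v1 v2 v0 D0.
  (* [Dp x > 0] with denominators cleared. For a/2 <= v <= a the right side is at most 5/2 a^3 and
     the factor of u^2 at least a/2, hence u^2 < 5 a^2. *)
  have E : u ^+ 2 * (3 / 4 * a - v / 4) < v * (v + a) * (v / 4 + a) by move: D0; rewrite -subr_gt0 => D0; nra.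
  have F : v * (v + a) * (v / 4 + a) <= 5 / 2 * a ^+ 3.
    have : v * (v + a) <= a * (2 * a) by nra.
    have : v / 4 + a <= 5 / 4 * a by lra.
    have : 0 <= v * (v + a) by nra.
    move: (v * (v + a)) (v / 4 + a) => s t; have : 0 < a ^+ 2 by rewrite exprn_gt0.
    move=> ? ? ? ?; have : s * t <= (a * (2 * a)) * (5 / 4 * a) by nra.
    lra.
  have G : a / 2 <= 3 / 4 * a - v / 4 by lra.
  have G2 : u ^+ 2 * (a / 2) <= u ^+ 2 * (3 / 4 * a - v / 4) by rewrite ler_wpM2l ?sqr_ge0.
  have : u ^+ 2 * (a / 2) < 5 * a ^+ 2 * (a / 2).
    by apply: (le_lt_trans G2); apply: (lt_le_trans E); apply: (le_trans F); lra.
  rewrite ltr_pM2r; last by lra.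
  by move=> h; apply: (lt_le_trans h); rewrite exprMn; have := sqr_ge0 a; lra.
Qed.

Lemma pulse_zero (x : R * R) : ~ (x.2 <= 1 + a / 2 /\ 1 <= Dp x) -> [/\ pulse x = 0, pulse1 x = 0 & pulse2 x = 0].
Proof.
move=> h; rewrite /pulse /pulse1 /pulse2; have [hx|hx] := leP x.2 (1 + a / 2); last first.
  by have [-> ->] := chi_off (ltW hx); rewrite !mul0r addr0.
have D1 : Dp x <= 1 by rewrite leNgt; apply/negP => /ltW D1; exact: h.
by rewrite theta_0 // theta1_0 // !mul0r !mulr0 addr0.
Qed.

Lemma pulse_rect (x : R * R) : ~ rect (p - 1) (p + 1) 0 2 x -> [/\ pulse x = 0, pulse1 x = 0 & pulse2 x = 0].
Proof.
move=> h; apply: pulse_zero => -[h1 h2]; apply: h.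
have [_ _ h3 h4 _] := pulse_region h1 h2; move: h3; rewrite ler_norml => /andP[? ?].
by have a0' := a0; have a1' := a1; apply/andP; split; apply/andP; split; lra.
Qed.

(** Each partial of theta (Dp) is at most 2 / N. The derivative of the cut-off acts above the lid
    only, where Y <= a, and adds at most (8 / a) (Y / N) <= 8 / N. The size bound is Y / N <= 1 / Y
    <= 2 / a. *)
Lemma pulse_bounds (x : R * R) : [/\ `|pulse1 x| <= 10 * (N x)^-1, `|pulse2 x| <= 10 * (N x)^-1 & 0 <= pulse x <= 2 / a].
Proof.
have [hx|/pulse_zero [-> -> ->]] := pselect (x.2 <= 1 + a / 2 /\ 1 <= Dp x); last first.
  have h : 0 <= 10 * (N x)^-1 by apply: mulr_ge0 => //; rewrite invr_ge0 addr_ge0 ?sqr_ge0.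
  by rewrite normr0 lexx; split => //=; apply: divr_ge0 => //; exact: ltW.
have [hx1 hx2] := hx; have [NY /andP[Y1 Y2] _ _ _] := pulse_region hx1 hx2.
have a0' := a0; have Y0 : 0 < Y x by lra.
have Ux : U x by [].
have n0 := nn_gt0 p Y0; have m0 := nn_gt0 p (ht2a Ux).
have [q1 q2 q0] := pole_le p Y0; have [r1 r2 r0] := pole_le p (ht2a Ux).
have nm : (nn p (2 * a) x)^-1 <= (N x)^-1.
  rewrite lef_pV2 ?posrE // /nn lerD2l lerXn2r ?nnegrE //; [exact: ltW|exact: ltW (ht2a Ux)|].
  by rewrite /ht; lra.
have DD (u v : R) : `|u| <= (N x)^-1 -> `|v| <= (nn p (2 * a) x)^-1 -> `|u - 3 / 4 * v| <= 2 * (N x)^-1.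
  move=> hu hv; apply: (le_trans (ler_normB _ _)); rewrite normrM ger0_norm ?divr_ge0 //.
  by move: hu hv nm; move: `|u| `|v| (N x)^-1 (nn p (2 * a) x)^-1 (normr_ge0 v) => *; lra.
have d1 := DD _ _ q1 r1; have d2 := DD _ _ q2 r2.
have /andP[t0 t1] := theta1_01 (Dp x); have [c0 c1 c2] := chi_bound x.
have ni : 0 < (N x)^-1 by rewrite invr_gt0.
have D0 : 0 <= Dp x by lra.
have Dle : Dp x <= pole p a x by rewrite /Dp; lra.
have tD := theta_le D0; have tg := theta_ge0 (Dp x).
have prod (u v w : R) : 0 <= u <= 1 -> 0 <= v <= 1 -> `|w| <= 2 * (N x)^-1 -> `|u * (v * w)| <= 2 * (N x)^-1.
  move=> /andP[u0 u1] /andP[v0 v1] hw; rewrite !normrM (ger0_norm u0) (ger0_norm v0) mulrA.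
  have uv : u * v <= 1 by rewrite mulr_ile1.
  by apply: (le_trans _ hw); rewrite ler_piMl.
have e1 : `|pulse1 x| <= 2 * (N x)^-1 by apply: prod d1; [rewrite c0 c1|rewrite t0 t1].
have e2 : `|chi x * (theta1 (Dp x) * Dp2 x)| <= 2 * (N x)^-1 by apply: prod d2; [rewrite c0 c1|rewrite t0 t1].
have e3 : `|chi2 x * theta (Dp x)| <= 8 * (N x)^-1.
  have [x1|x1] := leP x.2 1; first by have [_ ->] := chi_in x1; rewrite mul0r normr0 mulr_ge0 // ltW.
  rewrite normrM (ger0_norm tg).
  have Yle : Y x <= a by rewrite /ht; lra.
  have h1 : `|chi2 x| * theta (Dp x) <= 8 / a * pole p a x.
    by apply: ler_pM => //; apply: (le_trans tD).
  apply: (le_trans h1); rewrite /pole mulrA ler_pM2r // -mulrA -[leRHS]mulr1 ler_pM2l //.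
  by rewrite mulrC ler_pdivrMr // mul1r.
split.
- by apply: (le_trans e1); rewrite ler_pM2r // ler_nat.
- apply: (le_trans (ler_normD _ _)); apply: (le_trans (lerD e3 e2)); lra.
- apply/andP; split; first exact: mulr_ge0.
  have h1 : pulse x <= theta (Dp x) by rewrite /pulse ler_piMl.
  apply: (le_trans h1); apply: (le_trans tD); apply: (le_trans Dle).
  rewrite /pole ler_pdivrMr // mulrAC ler_pdivlMr //.
  have : Y x ^+ 2 <= N x by rewrite /nn lerDr sqr_ge0.
  by nra.
Qed.

Lemma pulse_pd1 (x : R * R) : pd1 pulse x (pulse1 x).
Proof.
have h : forall x, U x -> pd1 (fun x => theta (Dp x)) x (theta1 (Dp x) * Dp1 x).
  by move=> y Uy; exact: pd1_comp dv_theta (dv_Dp1 Uy).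
by apply: pd1_eq (pd1_mul_loc dv_chi1 near_chi h x) _; rewrite mul0r add0r.
Qed.

Lemma pulse_pd2 (x : R * R) : pd2 pulse x (pulse2 x).
Proof.
have h : forall x, U x -> pd2 (fun x => theta (Dp x)) x (theta1 (Dp x) * Dp2 x).
  by move=> y Uy; exact: pd2_comp dv_theta (dv_Dp2 Uy).
exact: (pd2_mul_loc dv_chi2 near_chi h x).
Qed.

Lemma pulse_cont1 : continuous pulse1.
Proof.
apply: cont_mul_loc cont_chi near_chi _ => x Ux; have [c1 c2 c3 _] := cont_Dp Ux.
by apply: cvgM => //; apply: cont_at_comp => //; exact: cont_theta1.
Qed.

Lemma pulse_cont2 : continuous pulse2.
Proof.
apply: contD.
  apply: cont_mul_loc cont_chi2 near_chi2 _ => x Ux; have [c1 c2 c3 _] := cont_Dp Ux.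
  by apply: cont_at_comp => //; exact: cont_theta.
apply: cont_mul_loc cont_chi near_chi _ => x Ux; have [c1 c2 c3 _] := cont_Dp Ux.
by apply: cvgM => //; apply: cont_at_comp => //; exact: cont_theta1.
Qed.

(** The region of [pulse_zero] with denominators cleared: a polynomial inequality, hence closed
    without regard to the singularities. *)
Definition pulse_set : set (R * R) := [set x | x.2 <= 1 + a / 2 /\
  N x * nn p (2 * a) x <= Y x * nn p (2 * a) x - 3 / 4 * (ht (2 * a) x * N x)].

Lemma pulse_setP (x : R * R) : pulse_set x <-> x.2 <= 1 + a / 2 /\ 1 <= Dp x.
Proof.
have a0' := a0.
suff h : x.2 <= 1 + a / 2 -> (N x * nn p (2 * a) x <= Y x * nn p (2 * a) x - 3 / 4 * (ht (2 * a) x * N x)) = (1 <= Dp x).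
  by split => -[h1 h2]; split => //; rewrite ?h // -?h.
move=> hx; have Y0 : 0 < Y x by rewrite /ht; lra.
have Ux : U x by [].
have n0 := nn_gt0 p Y0; have m0 := nn_gt0 p (ht2a Ux).
rewrite /Dp /pole -[RHS](ler_pM2r (mulr_gt0 n0 m0)) mul1r; congr (_ <= _).
have := lt0r_neq0 m0; have := lt0r_neq0 n0; move: (N x) (nn p (2 * a) x) => z w zn wn; field.
by rewrite zn wn.
Qed.

Lemma pulse_set_compact : compact pulse_set.
Proof.
have cB : closed pulse_set.
  have -> : pulse_set = (fun x : R * R => x.2) @^-1` [set t | t <= 1 + a / 2] `&`
    (fun x => N x * nn p (2 * a) x - (Y x * nn p (2 * a) x - 3 / 4 * (ht (2 * a) x * N x))) @^-1` [set t | t <= 0].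
    by apply/seteqP; split => x [h1 h2]; split => //; move: h2; rewrite /= subr_le0.
  apply: closedI; (apply: closed_comp; last exact: closed_le).
    by move=> x _; exact: cont_snd2.
  move=> x _; apply: contD; first by apply: contM; exact: cont_nn.
  apply: contN; apply: contD; first by apply: contM; [exact: cont_ht|exact: cont_nn].
  by apply: contN; apply: contZ; apply: contM; [exact: cont_ht|exact: cont_nn].
apply: (subclosed_compact cB (@compact_box R (`|p| + 2))).
move=> x /pulse_setP [h1 h2]; have a1' := a1; have a0' := a0.
have [_ _ h3 h4 _] := pulse_region h1 h2.
split; rewrite /= in_itv /= -ler_norml.
  have := ler_normD (x.1 - p) p; rewrite subrK; lra.
by have := normr_ge0 p; rewrite (ger0_norm (_ : 0 <= x.2)); lra.
Qed.

Lemma pulse_C1c (A : set (R * R)) : H `<=` A -> (forall x : R * R, `|x.1 - p| < 3 * a -> 1 <= x.2 < 2 -> A x) ->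
  C1c A pulse pulse1 pulse2.
Proof.
move=> HA TA; split; [exact: pulse_cont1|exact: pulse_cont2|exact: pulse_pd1|exact: pulse_pd2|].
exists pulse_set; split; [exact: pulse_set_compact| |].
  move=> x /pulse_setP [h1 h2]; have [_ _ h3 h4 h5] := pulse_region h1 h2.
  have [x1|x1] := leP 1 x.2.
    by apply: TA; [exact: h5|have := a1; rewrite x1 /=; lra].
  apply: HA; right; have := a0; have /andP[? ?] := p2; move: h3; rewrite ler_norml => /andP[? ?] ?.
  by split => /=; [rewrite ger0_norm; [apply/andP; split|]|]; lra.
by move=> x nB; have [] := pulse_zero (fun h => nB ((pulse_setP x).2 h)).
Qed.

Lemma hersch_lt1 (x : R * R) : H x -> x.2 < 1.
Proof. by move=> /hersch_x2 /sqr_lt1 /andP[]. Qed.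

(** In the pipe the cut-off is 1 and D is harmonic, so the Laplacian of the pulse is theta''(D)
    |grad D|^2 >= 0. Green's formula against u >= 0 then leaves only the mass term. *)
Lemma pulse_Bf (l : R) u u1 u2 : 0 <= l -> C1c H u u1 u2 -> (forall x, 0 <= u x) ->
  Bf l u u1 u2 pulse pulse1 pulse2 <= - (l * int2 (fun x => u x * pulse x)).
Proof.
move=> l0 cu u0; have a0' := a0.
have UH x : H x -> U x by move=> /hersch_lt1; rewrite /U /ht /=; lra.
pose g1 x := theta1 (Dp x) * Dp1 x; pose g2 x := theta1 (Dp x) * Dp2 x.
pose g11 x := theta2 (Dp x) * Dp1 x * Dp1 x + theta1 (Dp x) * Dp11 x.
pose g22 x := theta2 (Dp x) * Dp2 x * Dp2 x + theta1 (Dp x) * (- Dp11 x).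
have h1 x : H x -> pd1 g1 x (g11 x).
  by move=> /UH Ux; exact: pd1M (pd1_comp dv_theta1 (dv_Dp1 Ux)) (dv_Dp11 Ux).
have h2 x : H x -> pd2 g2 x (g22 x).
  by move=> /UH Ux; exact: pd2M (pd2_comp dv_theta1 (dv_Dp2 Ux)) (dv_Dp22 Ux).
have hc x : H x -> [/\ {for x, continuous g1}, {for x, continuous g2}, {for x, continuous g11} & {for x, continuous g22}].
  move=> /UH Ux; have [c0 c1 c2 c11] := cont_Dp Ux.
  have t1 : {for x, continuous (fun x => theta1 (Dp x))} by apply: cont_at_comp => //; exact: cont_theta1.
  have t2 : {for x, continuous (fun x => theta2 (Dp x))} by apply: cont_at_comp => //; exact: cont_theta2.
  split; [exact: cvgM|exact: cvgM| |].
    by apply: cvgD; apply: cvgM => //; exact: cvgM.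
  by apply: cvgD; apply: cvgM => //; [exact: cvgM|exact: cvgN].
have [b1 b2 e] := green cu h1 h2 hc.
have bu := C1c_Bc cu.
have bb : Bc pulse.
  have cb := @pulse_C1c setT (fun _ _ => I) (fun _ _ _ => I); exact: C1c_Bc cb.
have off : forall x, ~ H x -> [/\ u x = 0, u1 x = 0 & u2 x = 0].
  have [_ _ p1 p2' su] := cu; move=> x nH.
  have z f : supp_in H f -> f x = 0 by move=> [K [_ KH K0]]; apply: K0 => /KH.
  by split; apply: z => //; [exact: pd1_supp p1 su|exact: pd2_supp p2' su].
have -> : Bf l u u1 u2 pulse pulse1 pulse2 = int2 (fun x => u1 x * g1 x + u2 x * g2 x - l * (u x * pulse x)).
  congr int2; apply/funext => x; have [Hx|/off [-> -> ->]] := pselect (H x); last by rewrite !mul0r.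
  have [c1 c2] := chi_in (ltW (hersch_lt1 Hx)).
  by rewrite /pulse1 /pulse2 c1 c2 !mul1r mul0r add0r.
have bub : Bc (fun x => l * (u x * pulse x)) by apply: BcZ; exact: BcM.
rewrite int2_B // e int2_Z; last exact: BcM.
rewrite lerBlDr addrC subrr oppr_le0; apply: int2_ge0 => x; apply: mulr_ge0 => //.
have -> : g11 x + g22 x = theta2 (Dp x) * (Dp1 x ^+ 2 + Dp2 x ^+ 2) by rewrite /g11 /g22; ring.
by apply: mulr_ge0; [exact: theta2_ge0|rewrite addr_ge0 ?sqr_ge0].
Qed.

(** On the cell Y lies between 1/10 and 13/100 and dominates both |x1 - p| and a, so D is bounded
    below by nearly (1 - 3/4) / Y, which exceeds 3/2. *)
Lemma pulse_cell (x : R * R) : a <= 1 / 200 -> 5 / 2 <= p <= 251 / 100 -> @cell R x -> 1 / 18 <= pulse x.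
Proof.
move=> a3 /andP[p3 p4] /andP[/andP[x1 x2] /andP[x3 x4]]; have a0' := a0.
have x21 : x.2 <= 1 by lra.
have [c1 _] := chi_in x21; rewrite /pulse c1 [leRHS]mul1r; apply: theta_ge.
have Y0 : 1 / 10 <= Y x by rewrite /ht; lra.
have Y1 : Y x <= 13 / 100 by rewrite /ht; lra.
have Yp : 0 < Y x by exact: lt_le_trans Y0.
have xi : (x.1 - p) ^+ 2 <= 1 / 50 / 50.
  by have : `|x.1 - p| <= 1 / 50; [rewrite ler_norml; apply/andP; split; lra|
     rewrite -(real_normK (num_real (x.1 - p))); have := normr_ge0 (x.1 - p); move: `|_| => z; nra].
have e2 : ht (2 * a) x = Y x + a by rewrite /ht; ring.
have hb : pole p (2 * a) x <= (Y x)^-1.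
  have n0 : 0 < nn p (2 * a) x by apply: nn_gt0; rewrite e2; exact: addr_gt0.
  rewrite /pole ler_pdivrMr // [leRHS]mulrC ler_pdivlMr // /nn e2.
  have k0 := sqr_ge0 (x.1 - p); move: (Y x) Yp (_ ^+ 2) k0 a0' => v Yp k k0 a0'.
  by clear -Yp k0 a0'; nra.
have hc : 3 / 2 <= pole p a x - 3 / 4 * (Y x)^-1.
  have q0 := nn_gt0 p Yp; have k0 := sqr_ge0 (x.1 - p).
  rewrite /pole; move: q0 k0 xi Yp Y0 Y1; rewrite /nn; move: (Y x) ((x.1 - p) ^+ 2) => v k q0 k0 xi Yp Y0 Y1.
  rewrite -(ler_pM2r (mulr_gt0 q0 Yp)).
  have -> : (v / (k + v ^+ 2) - 3 / 4 * v^-1) * ((k + v ^+ 2) * v) = v ^+ 2 - 3 / 4 * (k + v ^+ 2).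
    by have := lt0r_neq0 q0; have := lt0r_neq0 Yp => n1 n2; field; rewrite n1 n2.
  have h1 : v ^+ 3 <= 13 / 100 * v ^+ 2 by rewrite exprS ler_wpM2r ?sqr_ge0.
  have h2 : k * v <= k * (13 / 100) by rewrite ler_wpM2l.
  have h3 : 1 / 10 * (1 / 10) <= v ^+ 2 by rewrite expr2; apply: ler_pM.
  have -> : 3 / 2 * ((k + v ^+ 2) * v) = 3 / 2 * (k * v) + 3 / 2 * v ^+ 3 by field.
  move: h1 h2 h3; move: (v ^+ 3) (v ^+ 2) (k * v) => s t w; lra.
by rewrite /Dp; lra.
Qed.

End pulse.
End Tooth.

(** * Combs of pulses and the drop of the eigenvalue *)

Section Comb.
Variable R : realType.
Local Notation H := (@hersch R).
Local Notation T2 := (measurableTypeR R * measurableTypeR R)%type.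

Lemma int2_ge0_slice1 (f : R * R -> R) : Bc f -> (forall b, 0 <= \int[lebesgue_measure]_a (f (a, b))%:E)%E -> 0 <= int2 f.
Proof. by move=> hf h; rewrite -lee_fin int2_fubini2 //; apply: integral_ge0. Qed.

(** Replacing w by the constant C / (be - al) does not lower its integral over the interval. The
    interval enters as a weight so that the statement fits slices of a rectangle. *)
Lemma slice_average (w W : R -> R) (al be C : R) : al < be -> (forall t : R, is_derive t 1 W (w t)) -> continuous w ->
  W be - W al <= C ->
  (0 <= \int[lebesgue_measure]_t ((al <= t <= be)%R%:R * (C / (be - al) - w t))%:E)%E.
Proof.
move=> ab dW cw hC; pose k := C / (be - al).
have -> : (\int[lebesgue_measure]_t ((al <= t <= be)%R%:R * (C / (be - al) - w t))%:E =
   \int[lebesgue_measure]_(t in `[al, be]) (k - w t)%:E)%E.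
  rewrite [RHS]integral_mkcond; apply: eq_integral => t _.
  rewrite patchE; case: ifPn => h.
    by move: h; rewrite inE /= in_itv /= => ->; rewrite mul1r.
  by move/negP: h; rewrite inE /= in_itv /= => /negP /negbTE ->; rewrite mul0r.
have dF (t : R) : is_derive t 1 (fun t => k * t - W t) (k - w t).
  by apply: (dv_eq (dvB (dvZ k (dv_id t)) (dW t))); rewrite mulr1.
rewrite (int_segment_derive ab dF).
  rewrite lee_fin; have -> : k * be - W be - (k * al - W al) = k * (be - al) - (W be - W al) by ring.
  by rewrite /k mulfVK ?subr_ge0 // subr_eq0 gt_eqF.
by move=> t; apply: cvgB; [exact: cvg_cst|exact: cw].
Qed.

Section lorentz.
Variable c : R.
Hypothesis c0 : 0 < c.
(** A Lorentz profile, of total integral pi / c by the arctangent. At depth at least c, a product of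
    one in x1 and one in x2 dominates the squared gradient of a pole up to a constant, and it splits
    under Fubini. *)
Definition lor (t : R) : R := (t ^+ 2 + c ^+ 2)^-1.

Lemma lor_gt0 t : 0 < t ^+ 2 + c ^+ 2.
Proof. by rewrite ltr_wpDl ?sqr_ge0 // exprn_gt0. Qed.

Lemma dv_lor q (t : R) : is_derive t 1 (fun t => atan ((t - q) / c) / c) (lor (t - q)).
Proof.
have h : is_derive t 1 (fun t => (t - q) / c) c^-1.
  by apply: (dv_eq (dvM (dvB (dv_id t) (dvC q t)) (dvC c^-1 t))); rewrite subr0 mul1r mulr0 addr0.
apply: (dv_eq (dvM (dv_comp (is_derive1_atan _) h) (dvC c^-1 t))).
rewrite mulr0 addr0 /lor; have := lt0r_neq0 c0; have := lt0r_neq0 (lor_gt0 (t - q)); move: (t - q) => z zn cn.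
have zn' : 1 + (z / c) ^+ 2 != 0 by rewrite lt0r_neq0 // ltr_wpDr ?sqr_ge0.
have e : z ^+ 2 + c ^+ 2 = (1 + (z / c) ^+ 2) * c ^+ 2 by field.
by rewrite e; move: zn'; move: (1 + _) => y yn; field; rewrite ?yn ?cn.
Qed.

Lemma cont_lor q : continuous (fun t => lor (t - q)).
Proof.
move=> t; apply: cvgV; first exact: lt0r_neq0 (lor_gt0 _).
apply: cvgD; last exact: cvg_cst.
by apply: (@continuous_comp _ _ _ (fun t => t - q) (fun t => t ^+ 2)); [apply: cvgB; [exact: cvg_id|exact: cvg_cst]|exact: exprn_continuous].
Qed.

Lemma lor_total q al be : atan ((be - q) / c) / c - atan ((al - q) / c) / c <= pi / c.
Proof.
rewrite -mulrBl ler_pM2r ?invr_gt0 //.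
have := atan_ltpi2 ((be - q) / c); have := atan_gtNpi2 ((al - q) / c); lra.
Qed.

Lemma lor_le t : 0 <= lor t <= c ^- 2.
Proof.
rewrite /lor invr_ge0 ltW ?lor_gt0 //= lef_pV2 ?posrE ?lor_gt0 ?exprn_gt0 //.
by rewrite lerDr sqr_ge0.
Qed.

(** One variable at a time, the profile is replaced by a constant of integral pi / c; only the area
    of the rectangle is left to compute. *)
Lemma int2_lor p q al be ga de : al < be -> ga < de ->
  int2 (fun x : R * R => \1_(rect al be ga de) x * (lor (x.1 - p) * lor (x.2 - q))) <= (pi / c) ^+ 2.
Proof.
move=> ab gd; have br := @Bc_rect R al be ga de.
have c1 : continuous (fun x : R * R => lor (x.1 - p)) by apply: (cont_fst_comp (@cont_lor p)).
have c2 : continuous (fun x : R * R => lor (x.2 - q)) by apply: (cont_snd_comp (@cont_lor q)).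
have bcm (g : R * R -> R) K : continuous g -> (forall x, `|g x| <= K) -> Bc (fun x => \1_(rect al be ga de) x * g x).
  move=> cg gK; rewrite (_ : (fun x => _ * g x) = (fun x => g x * \1_(rect al be ga de) x)); last first.
    by apply/funext => x; rewrite mulrC.
  by apply: BcMl => //; [exact: cont_meas2|move=> M; exists K => x _ _].
have lb t : `|lor t| <= c ^- 2 by case/andP: (lor_le t) => h1 h2; rewrite ger0_norm.
pose k1 := pi / c / (be - al); pose k2 := pi / c / (de - ga).
have b12 : Bc (fun x => \1_(rect al be ga de) x * (lor (x.1 - p) * lor (x.2 - q))).
  apply: (bcm _ (c ^- 2 * c ^- 2)); first exact: contM.
  by move=> x; rewrite normrM ler_pM.
have b1 : Bc (fun x => \1_(rect al be ga de) x * (lor (x.1 - p) * k2)).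
  apply: (bcm _ (c ^- 2 * `|k2|)); first by apply: contM => //; exact: cst_continuous.
  by move=> x; rewrite normrM ler_pM.
have b0 : Bc (fun x => \1_(rect al be ga de) x * (k1 * k2)).
  by apply: (bcm _ `|k1 * k2|); first exact: cst_continuous.
have rE (x : R * R) : \1_(rect al be ga de) x = (al <= x.1 <= be)%R%:R * (ga <= x.2 <= de)%R%:R :> R.
  by rewrite indicE mem_setE /rect /= -natrM mulnb.
have k20 : 0 <= k2 by rewrite divr_ge0 ?subr_ge0 ?(ltW gd) // divr_ge0 ?(ltW c0) // pi_ge0.
have s1 : int2 (fun x : R * R => \1_(rect al be ga de) x * (lor (x.1 - p) * lor (x.2 - q))) <=
   int2 (fun x => \1_(rect al be ga de) x * (lor (x.1 - p) * k2)).
  rewrite -subr_ge0 -int2_B //; apply: int2_ge0_slice2 => [|a]; first exact: BcB.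
  set v := (al <= a <= be)%R%:R * lor (a - p); have v0 : 0 <= v by rewrite mulr_ge0 //; case/andP: (lor_le (a - p)).
  have cv : continuous (fun t => v * lor (t - q)) by move=> t; apply: cvgM; [exact: cvg_cst|exact: cont_lor].
  have tot := ler_wpM2l v0 (@lor_total q ga de); rewrite mulrBr in tot.
  have := slice_average gd (fun t => dvZ v (dv_lor q t)) cv tot.
  under eq_integral => t _.
    rewrite (_ : _ * _ = \1_(rect al be ga de) (a, t) * (lor (a - p) * k2) -
      \1_(rect al be ga de) (a, t) * (lor (a - p) * lor (t - q))); first over.
    by rewrite !rE /= /v /k2; ring.
  by [].
have s2 : int2 (fun x => \1_(rect al be ga de) x * (lor (x.1 - p) * k2)) <= int2 (fun x => \1_(rect al be ga de) x * (k1 * k2)).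
  rewrite -subr_ge0 -int2_B //; apply: int2_ge0_slice1 => [|b]; first exact: BcB.
  set v := (ga <= b <= de)%R%:R * k2; have v0 : 0 <= v by rewrite mulr_ge0.
  have cv : continuous (fun t => v * lor (t - p)) by move=> t; apply: cvgM; [exact: cvg_cst|exact: cont_lor].
  have tot := ler_wpM2l v0 (@lor_total p al be); rewrite mulrBr in tot.
  have := slice_average ab (fun t => dvZ v (dv_lor p t)) cv tot.
  under eq_integral => t _.
    rewrite (_ : _ * _ = \1_(rect al be ga de) (t, b) * (k1 * k2) -
      \1_(rect al be ga de) (t, b) * (lor (t - p) * k2)); first over.
    by rewrite !rE /= /v /k1; ring.
  by [].
apply: (le_trans s1); apply: (le_trans s2).
have -> : (fun x => \1_(rect al be ga de) x * (k1 * k2)) = (fun x => (k1 * k2) * \1_(rect al be ga de) x).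
  by apply/funext => x; rewrite mulrC.
rewrite int2_Z // int2_rect ?(ltW ab) ?(ltW gd) // /k1 /k2.
rewrite le_eqVlt; apply/orP; left; apply/eqP.
have h1 : be - al != 0 by rewrite subr_eq0 gt_eqF.
have h2 : de - ga != 0 by rewrite subr_eq0 gt_eqF.
move: h1 h2 (lt0r_neq0 c0); move: (be - al) (de - ga) => u v un vn cn; field.
by rewrite un vn cn.
Qed.

End lorentz.

(** At most one term exceeds M in size. Separating it by (b + y)^2 <= 2 b^2 + 2 y^2 avoids a factor
    [size s] in front of the sum of squares. *)
Lemma sum_sq_near (s : seq nat) (b : nat -> R) (M : R) : uniq s -> 0 <= M ->
  (forall j k, j \in s -> k \in s -> j != k -> `|b j| <= M \/ `|b k| <= M) ->
  (\sum_(j <- s) b j) ^+ 2 <= 2 * \sum_(j <- s) b j ^+ 2 + 2 * ((size s)%:R * M) ^+ 2.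
Proof.
move=> us M0 h.
have far (r : seq nat) : (size r <= size s)%N -> (forall j, j \in r -> `|b j| <= M) ->
    (\sum_(j <- r) b j) ^+ 2 <= ((size s)%:R * M) ^+ 2.
  move=> rs hr; rewrite -(real_normK (num_real _)) lerXn2r ?nnegrE ?mulr_ge0 //.
  apply: (le_trans (ler_norm_sum _ _ _)).
  apply: (@le_trans _ _ (\sum_(j <- r) M)).
    by rewrite big_seq [leRHS]big_seq; apply: ler_sum.
  by rewrite big_const_seq count_predT iter_addr addr0 -[leLHS]mulr_natl; apply: ler_wpM2r => //; rewrite ler_nat.
have s0 : 0 <= \sum_(j <- s) b j ^+ 2 by apply: sumr_ge0 => j _; exact: sqr_ge0.
have q0 := sqr_ge0 ((size s)%:R * M).
have [hs|/existsNP [j /not_implyP [js hj]]] := pselect (forall j, j \in s -> `|b j| <= M).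
  by apply: (le_trans (far s (leqnn _) hs)); lra.
rewrite (big_rem j) //=.
have f1 := far (rem j s).
have {f1} f1 : (\sum_(k <- rem j s) b k) ^+ 2 <= ((size s)%:R * M) ^+ 2.
  apply: f1; first by rewrite size_rem // leq_pred.
  move=> k; rewrite mem_rem_uniq // inE => /andP[kj ks].
  by case: (h j k js ks) => //; rewrite eq_sym.
have f2 : b j ^+ 2 <= \sum_(j <- s) b j ^+ 2.
  by rewrite (big_rem j) //= lerDl; apply: sumr_ge0 => k _; exact: sqr_ge0.
move: f1 f2; move: (\sum_(k <- rem j s) b k) (\sum_(j <- s) _) (_ * M) => y S w.
have := sqr_ge0 (b j - y); rewrite sqrrB sqrrD; nra.
Qed.


(** The energy density is at most 200 / N^2, and N^-2 is at most twice the product of Lorentz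
    profiles because Y >= a/2 where the pulse lives. *)
Lemma pulse_energy (p a : R) : 0 < a -> a < 1 -> 2 <= p <= 3 ->
  energy (pulse1 p a) (pulse2 p a) <= 20 * 20 * (pi / (a / 2)) ^+ 2.
Proof.
move=> a0 a1 p2; have c0 : 0 < a / 2 by rewrite divr_gt0.
have cb := @pulse_C1c R p a a0 a1 p2 setT (fun _ _ => I) (fun _ _ _ => I).
have pp1 : p - 1 < p + 1 by lra.
have p02 : 0 < 2 :> R by [].
have h := int2_lor c0 p (1 + a) pp1 p02.
pose f (x : R * R) : R := \1_(rect (p - 1) (p + 1) 0 2) x * (lor (a / 2) (x.1 - p) * lor (a / 2) (x.2 - (1 + a))).
have bf : Bc f.
  rewrite /f (_ : (fun x => _) = (fun x : R * R => (lor (a / 2) (x.1 - p) * lor (a / 2) (x.2 - (1 + a))) * \1_(rect (p - 1) (p + 1) 0 2) x)); last first.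
    by apply/funext => x; rewrite mulrC.
  apply: BcMl; [|move=> M; exists ((a / 2) ^- 2 * (a / 2) ^- 2) => x _ _|exact: Bc_rect].
    apply: cont_meas2; apply: contM.
      exact: (cont_fst_comp (cont_lor c0 (q := p))).
    exact: (cont_snd_comp (cont_lor c0 (q := 1 + a))).
  have /andP[g1 g2] := lor_le c0 (x.1 - p); have /andP[g3 g4] := lor_le c0 (x.2 - (1 + a)).
  by rewrite ger0_norm ?mulr_ge0 // ler_pM.
apply: (@le_trans _ _ (20 * 20 * int2 f)); last by rewrite ler_pM2l // mulr_gt0.
rewrite -int2_Z //; apply: int2_le.
- by apply: Bc_en; [exact: C1c_Bc1 cb|exact: C1c_Bc2 cb].
- exact: BcZ.
move=> x; have f0 : 0 <= f x.
  by rewrite /f !mulr_ge0 //; [case/andP: (lor_le c0 (x.1 - p))|case/andP: (lor_le c0 (x.2 - (1 + a)))].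
have [hx|/(pulse_zero a0) [_ -> ->]] := pselect (x.2 <= 1 + a / 2 /\ 1 <= Dp p a x); last first.
  by rewrite expr0n addr0 mulr_ge0.
have [rx|/(pulse_rect a0 a1) [_ -> ->]] := pselect (rect (p - 1) (p + 1) 0 2 x); last first.
  by rewrite expr0n addr0 mulr_ge0.
have [hx1 hx2] := hx; have [_ /andP[Y1 Y2] _ _ _] := pulse_region a0 a1 hx1 hx2.
have [b1 b2 _] := pulse_bounds p a0 a1 x.
have n0 : 0 < nn p a x by apply: nn_gt0; lra.
have sq (z : R) : `|z| <= 10 * (nn p a x)^-1 -> z ^+ 2 <= 100 * (nn p a x) ^- 2.
  move=> hz; rewrite -(real_normK (num_real z)).
  have -> : 100 * (nn p a x) ^- 2 = (10 * (nn p a x)^-1) ^+ 2 by rewrite exprMn exprVn; congr (_ * _); rewrite -natrX.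
  by rewrite lerXn2r ?nnegrE // mulr_ge0 // invr_ge0 ltW.
have key : (nn p a x) ^- 2 <= 2 * f x.
  rewrite /f indicE mem_set // mul1r /lor -invfM.
  have e : (x.2 - (1 + a)) ^+ 2 = ht a x ^+ 2 by rewrite /ht; ring.
  rewrite e /nn; move: n0 Y1 c0; rewrite /nn; move: (x.1 - p) (ht a x) (a / 2) => u v c n0 Y1 c0.
  have q0 : 0 < (u ^+ 2 + c ^+ 2) * (v ^+ 2 + c ^+ 2).
    by rewrite mulr_gt0 // ltr_wpDl ?sqr_ge0 // exprn_gt0.
  rewrite ler_pdivlMr // [leLHS]mulrC ler_pdivrMr ?exprn_gt0 //.
  have cv : c ^+ 2 <= v ^+ 2 by rewrite lerXn2r ?nnegrE //; lra.
  have := sqr_ge0 u; have := sqr_ge0 c; move: cv; move: (u ^+ 2) (v ^+ 2) (c ^+ 2) => U V C; nra.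
by have := sq _ b1; have := sq _ b2; move: key; move: (_ ^- 2) (f x) => z w; lra.
Qed.

Section teeth.
Variables (N : nat) (a : R).
Hypothesis N1 : (0 < N)%N.
Hypothesis a0 : 0 < a.
Hypothesis a1 : a < 1.
Let s := iota 0 N.
(** For n = 100 N these are the centres of the teeth of index 50 N + j. All N of them stay above the
    cell, however large N is. *)
Definition cen (j : nat) : R := 5 / 2 + j%:R / (100 * N%:R).
Definition comb (x : R * R) : R := \sum_(j <- s) pulse (cen j) a x.
Definition comb1 (x : R * R) : R := \sum_(j <- s) pulse1 (cen j) a x.
Definition comb2 (x : R * R) : R := \sum_(j <- s) pulse2 (cen j) a x.

Lemma cen_bound j : j \in s -> 5 / 2 <= cen j <= 251 / 100.
Proof.
rewrite mem_iota add0n => /andP[_ jN]; have n0 : 0 < N%:R :> R by rewrite ltr0n.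
have q0 : 0 <= j%:R / (100 * N%:R) :> R by rewrite divr_ge0 // mulr_ge0.
have q1 : j%:R / (100 * N%:R) <= 1 / 100 :> R.
  rewrite ler_pdivrMr ?mulr_gt0 // mulrA (_ : 1 / 100 * 100 = 1 :> R); last by field.
  by rewrite mul1r ler_nat ltnW.
by rewrite /cen; apply/andP; split; lra.
Qed.

Lemma cen23 j : j \in s -> 2 <= cen j <= 3.
Proof. by move/cen_bound => /andP[? ?]; apply/andP; split; lra. Qed.

Lemma comb_C1c (A : set (R * R)) : H `<=` A ->
  (forall j, j \in s -> forall x : R * R, `|x.1 - cen j| < 3 * a -> 1 <= x.2 < 2 -> A x) ->
  C1c A comb comb1 comb2.
Proof. by move=> HA TA; apply: C1c_sum => j js; apply: pulse_C1c => //; [exact: cen23|exact: TA]. Qed.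

Lemma pulse_BcT j : j \in s -> C1c setT (pulse (cen j) a) (pulse1 (cen j) a) (pulse2 (cen j) a).
Proof. by move=> js; apply: pulse_C1c => //; exact: cen23. Qed.

Lemma comb_rect (x : R * R) : ~ rect 1 4 0 2 x -> [/\ comb x = 0, comb1 x = 0 & comb2 x = 0].
Proof.
move=> nr; have h j : j \in s -> [/\ pulse (cen j) a x = 0, pulse1 (cen j) a x = 0 & pulse2 (cen j) a x = 0].
  move=> js; have := cen23 js; move=> hc; apply: pulse_rect => // hr; apply: nr; move: hr hc.
  move=> /andP[/andP[h1 h2] h3] /andP[h4 h5]; apply/andP; split => //; apply/andP; split; lra.
by split; rewrite /comb /comb1 /comb2 big_seq big1 // => j /h[].
Qed.

(* Each gradient is at most [far_bd] at the points whose distance to its centre is at least half of the spacing. *)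
Definition far_bd : R := 10 * (2 * 100 * N%:R) ^+ 2.

(** Distinct centres are at least 2 d apart, so x has distance at least d from one of them. *)
Lemma comb_far (x : R * R) j k : j \in s -> k \in s -> j != k ->
  10 * (nn (cen j) a x)^-1 <= far_bd \/ 10 * (nn (cen k) a x)^-1 <= far_bd.
Proof.
move=> js ks jk; pose d : R := (2 * 100 * N%:R)^-1.
have n0 : 0 < N%:R :> R by rewrite ltr0n.
have d0 : 0 < d by rewrite invr_gt0 !mulr_gt0.
have dist : 2 * d <= `|cen j - cen k|.
  have -> : cen j - cen k = (j%:R - k%:R) * (2 * d).
    by rewrite /cen /d; have := lt0r_neq0 n0; move: (N%:R : R) (j%:R : R) (k%:R : R) => u v w un; field.
  rewrite normrM (gtr0_norm (_ : 0 < 2 * d)) ?mulr_gt0 // ler_peMl ?mulr_ge0 ?(ltW d0) //.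
  have i1 (z : int) : z != 0 -> 1 <= `|z%:~R| :> R.
    by move=> z0; rewrite -intr_norm ler1z -gtz0_ge1 normr_gt0.
  have := i1 (j%:Z - k%:Z); rewrite intrB; apply.
  by rewrite subr_eq0 eqz_nat.
have bd i : d <= `|x.1 - cen i| -> 10 * (nn (cen i) a x)^-1 <= far_bd.
  move=> hd; rewrite /far_bd ler_pM2l // -[leRHS]invrK -exprVn -/d.
  have dn : d ^+ 2 <= nn (cen i) a x.
    rewrite /nn -(real_normK (num_real (x.1 - cen i))) (le_trans (lerXn2r 2 _ _ hd)) ?nnegrE ?(ltW d0) //.
    by rewrite lerDl sqr_ge0.
  by rewrite lef_pV2 // posrE ?(lt_le_trans _ dn) // exprn_gt0.
have [h|h] := leP d `|x.1 - cen j|; first by left; exact: bd.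
right; apply: bd; have := ler_normB (x.1 - cen k) (x.1 - cen j).
have -> : x.1 - cen k - (x.1 - cen j) = cen j - cen k by ring.
by move: dist h; lra.
Qed.

(** By [sum_sq_near] the energy is at most twice the sum of the single energies, which is of order N
    / a^2, plus 4 Q on a rectangle of area 6. This remainder depends on N but not on a. *)
Lemma comb_energy : energy comb1 comb2 <= N%:R * (2 * (20 * 20) * (pi / (a / 2)) ^+ 2) + 24 * (N%:R * far_bd) ^+ 2.
Proof.
pose Q := (N%:R * far_bd) ^+ 2.
have f0 : 0 <= far_bd by rewrite /far_bd mulr_ge0 // sqr_ge0.
have us : uniq s by exact: iota_uniq.
have ss : size s = N by rewrite size_iota.
have bE j : j \in s -> Bc (fun x => pulse1 (cen j) a x ^+ 2 + pulse2 (cen j) a x ^+ 2).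
  by move=> /pulse_BcT cb; apply: Bc_en; [exact: C1c_Bc1 cb|exact: C1c_Bc2 cb].
have cbT := @comb_C1c setT (fun _ _ => I) (fun _ _ _ _ _ => I).
have br := @Bc_rect R 1 4 0 2.
have bS := Bc_sum bE.
apply: (@le_trans _ _ (int2 (fun x => 2 * (\sum_(j <- s) (pulse1 (cen j) a x ^+ 2 + pulse2 (cen j) a x ^+ 2)) + (4 * Q) * \1_(rect 1 4 0 2) x))).
  apply: int2_le.
  - by apply: Bc_en; [exact: C1c_Bc1 cbT|exact: C1c_Bc2 cbT].
  - by apply: BcD; exact: BcZ.
  move=> x; have S0 : 0 <= \sum_(j <- s) (pulse1 (cen j) a x ^+ 2 + pulse2 (cen j) a x ^+ 2).
    by apply: sumr_ge0 => j _; rewrite addr_ge0 ?sqr_ge0.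
  have [rx|/comb_rect [_ -> ->]] := pselect (rect 1 4 0 2 x); last first.
    by rewrite expr0n addr0 addr_ge0 // ?mulr_ge0 // ?sqr_ge0 // mulr_ge0.
  rewrite indicE mem_set // mulr1.
  have h1 : (comb1 x) ^+ 2 <= 2 * \sum_(j <- s) pulse1 (cen j) a x ^+ 2 + 2 * ((size s)%:R * far_bd) ^+ 2.
    apply: sum_sq_near => // j k js ks jk; have [b1 _ _] := pulse_bounds (cen j) a0 a1 x.
    have [c1 _ _] := pulse_bounds (cen k) a0 a1 x.
    by have [h|h] := comb_far x js ks jk; [left|right]; exact: le_trans h.
  have h2 : (comb2 x) ^+ 2 <= 2 * \sum_(j <- s) pulse2 (cen j) a x ^+ 2 + 2 * ((size s)%:R * far_bd) ^+ 2.
    apply: sum_sq_near => // j k js ks jk; have [_ b1 _] := pulse_bounds (cen j) a0 a1 x.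
    have [_ c1 _] := pulse_bounds (cen k) a0 a1 x.
    by have [h|h] := comb_far x js ks jk; [left|right]; exact: le_trans h.
  rewrite ss in h1 h2; rewrite big_split /= /Q; lra.
rewrite int2_D; [|exact: BcZ|exact: BcZ].
rewrite int2_Z // (int2_sum bE) int2_Z // int2_rect; [|lra|lra].
have hs : \sum_(j <- s) int2 (fun x => pulse1 (cen j) a x ^+ 2 + pulse2 (cen j) a x ^+ 2) <=
   \sum_(j <- s) 20 * 20 * (pi / (a / 2)) ^+ 2.
  by rewrite big_seq [leRHS]big_seq; apply: ler_sum => j js; apply: pulse_energy => //; exact: cen23.
move: hs; rewrite [X in _ <= X]big_const_seq count_predT iter_addr addr0 ss -mulr_natl.
rewrite /Q; move: (\sum_(j <- s) _) ((pi / (a / 2)) ^+ 2) ((N%:R * far_bd) ^+ 2) => S P q; lra.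
Qed.

Lemma comb_nrm2 : nrm2 comb <= 6 * (N%:R * (2 / a)) ^+ 2.
Proof.
have cbT := @comb_C1c setT (fun _ _ => I) (fun _ _ _ _ _ => I).
have br := @Bc_rect R 1 4 0 2.
have -> : 6 * (N%:R * (2 / a)) ^+ 2 = int2 (fun x => (N%:R * (2 / a)) ^+ 2 * \1_(rect 1 4 0 2) x).
  rewrite int2_Z // int2_rect; [|lra|lra].
  by move: ((N%:R * (2 / a)) ^+ 2) => z; ring.
apply: int2_le; [by apply: Bc_sqr; exact: C1c_Bc cbT|exact: BcZ|move=> x].
have [rx|/comb_rect [-> _ _]] := pselect (rect 1 4 0 2 x); last first.
  by rewrite expr0n mulr_ge0 // sqr_ge0.
rewrite indicE mem_set // mulr1.
have c0 : 0 <= comb x by rewrite /comb big_seq; apply: sumr_ge0 => j js; have [_ _ /andP[]] := pulse_bounds (cen j) a0 a1 x.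
have q0 : 0 <= N%:R * (2 / a) by rewrite mulr_ge0 // divr_ge0 // ltW.
rewrite lerXn2r ?nnegrE //.
apply: (@le_trans _ _ (\sum_(j <- s) 2 / a)).
  by rewrite /comb big_seq [leRHS]big_seq; apply: ler_sum => j js; have [_ _ /andP[]] := pulse_bounds (cen j) a0 a1 x.
by rewrite big_const_seq count_predT iter_addr addr0 size_iota -[leLHS]mulr_natl.
Qed.

Lemma comb_Bf (l : R) u u1 u2 : a <= 1 / 200 -> 0 <= l -> C1c H u u1 u2 -> (forall x, 0 <= u x) ->
  Bf l u u1 u2 comb comb1 comb2 <= - (l * (N%:R / 18 * int2 (fun x => \1_(@cell R) x * u x))).
Proof.
move=> a2 l0 cu u0; have bu := C1c_Bc cu; have b1 := C1c_Bc1 cu; have b2 := C1c_Bc2 cu.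
have -> : Bf l u u1 u2 comb comb1 comb2 = \sum_(j <- s) Bf l u u1 u2 (pulse (cen j) a) (pulse1 (cen j) a) (pulse2 (cen j) a).
  rewrite /Bf -int2_sum; last first.
    by move=> j js; have cb := pulse_BcT js; apply: Bf_Bc => //; [exact: C1c_Bc cb|exact: C1c_Bc1 cb|exact: C1c_Bc2 cb].
  congr int2; apply/funext => x.
  by rewrite /comb /comb1 /comb2 !mulr_sumr -big_split -sumrB.
have bc : Bc (fun x => \1_(@cell R) x * u x) by apply: Bc_indic => //; exact: rect_meas.
apply: (@le_trans _ _ (\sum_(j <- s) - (l * (1 / 18 * int2 (fun x => \1_(@cell R) x * u x))))).
  rewrite big_seq [leRHS]big_seq; apply: ler_sum => j js.
  apply: (le_trans (pulse_Bf a0 a1 (cen23 js) l0 cu u0)); rewrite lerN2 ler_wpM2l // -int2_Z //.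
  have cb := pulse_BcT js.
  apply: int2_le; [exact: BcZ|by apply: BcM => //; exact: C1c_Bc cb|move=> x].
  rewrite indicE; have [/set_mem xc|_] := boolP (x \in _).
    by have := pulse_cell a0 a2 (cen_bound js) xc; have := u0 x; move: (u x) (pulse _ _ _) => v w; rewrite [1%:R * v]mul1r; nra.
  rewrite !(mul0r, mulr0); apply: mulr_ge0 => //; have [_ _ /andP[]] := pulse_bounds (cen j) a0 a1 x; by [].
rewrite big_const_seq count_predT iter_addr addr0 size_iota -mulr_natl.
by rewrite le_eqVlt; apply/orP; left; apply/eqP; field.
Qed.

End teeth.

Lemma teeth_sub (N : nat) (e : R) : H `<=` hersch_teeth (100 * N) e.
Proof. by move=> x; left. Qed.

Lemma teeth_cen (N j : nat) (e : R) : (0 < N)%N -> j \in iota 0 N -> forall x : R * R,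
  `|x.1 - cen N j| < 3 * (e / 3) -> 1 <= x.2 < 2 -> hersch_teeth (100 * N) e x.
Proof.
move=> N1; rewrite mem_iota add0n => /andP[_ jN] x hx x2.
have n0 : N%:R != 0 :> R by rewrite pnatr_eq0 -lt0n.
right; exists (50 * N + j)%N; first by rewrite /= -(subnK (ltnW jN)); lia.
split => //.
have -> : 2 + (50 * N + j)%:R / (100 * N)%:R = cen N j :> R.
  by rewrite /cen natrD !natrM; move: n0; move: (N%:R : R) (j%:R : R) => u v un; field.
by move: hx; rewrite mulrCA mulfV // mulr1 ltr_norml => /andP[? ?]; apply/andP; split; lra.
Qed.

(* Adding [N] equally spaced pulses to a near-minimiser of [H] lowers the Rayleigh quotient by
   a multiple of [N e^2]: the gain is linear in [N], the pulses being almost orthogonal. *)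
Lemma lambda1_teeth_drop (l k : R) : lambda1 H = l%:E -> 0 < l -> l < pi ^+ 2 -> exists N : nat, (0 < N)%N /\
  exists2 e0 : R, 0 < e0 & forall e, 0 < e -> e < e0 ->
  exists2 l' : R, lambda1 (hersch_teeth (100 * N) e) = l'%:E & l' <= l - k * e ^+ 2.
Proof.
move=> lH l0 lp; have [c [d [c0 d0 hcd]]] := cell_mass lH (ltW l0) lp.
have pi0 : 0 < pi :> R by exact: pi_gt0.
pose c4 := l * (c / 18); have c40 : 0 < c4 by rewrite mulr_gt0 // divr_gt0.
(* For a = e / 3 one has (pi / (a / 2))^2 = 36 pi^2 / e^2, so the main term of [comb_energy] is N K
   / e^2. *)
pose K : R := 36 * (2 * (20 * 20)) * pi ^+ 2; have K0 : 0 < K by rewrite mulr_gt0 ?exprn_gt0 // mulr_gt0 // mulr_gt0 // mulr_gt0.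
(* For the amplitude t = e^2 tau the linear gain is 2 e^2 tau c4 N, and 2 K tau = c4 makes the
   quadratic cost at most half of it. A quarter is left to the defect of u and a quarter is the net
   drop [g]. *)
pose tau := c4 / (2 * K); have tau0 : 0 < tau by rewrite divr_gt0 // mulr_gt0.
(* The corrected function has squared norm at most 4, so l - l' >= g / 4, which this N makes at
   least k e^2. *)
have [N [N1 hN]] : exists N : nat, (0 < N)%N /\ k <= tau * c4 * N%:R / 8.
  exists (Num.bound (`|k| / (tau * c4 / 8))).+1; split => //.
  have q0 : 0 < tau * c4 / 8 by rewrite divr_gt0 // mulr_gt0.
  rewrite -mulrA (mulrC _ 8^-1) mulrA; apply: (le_trans (ler_norm k)).
  rewrite -ler_pdivrMl // mulrC; apply: ltW; apply: (lt_trans (archi_boundP _)).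
    by rewrite divr_ge0 // ltW.
  by rewrite ltr_nat.
have n0 : 0 < N%:R :> R by rewrite ltr0n.
pose CN := 24 * (N%:R * far_bd N) ^+ 2 : R.
have CN0 : 0 < CN.
  by rewrite mulr_gt0 // exprn_gt0 // mulr_gt0 // /far_bd mulr_gt0 // exprn_gt0 // !mulr_gt0.
(* These conditions give a <= 1/200 as [pulse_cell] requires, make the remainder of [comb_energy] at
   most its main term, and keep the squared norm of t comb below 1. *)
have [e0 [e00 e01 e02 e03]] : exists e0 : R, [/\ 0 < e0, e0 <= 3 / 200, e0 ^+ 2 * CN <= N%:R * K &
    e0 ^+ 2 * (6 * (6 * (tau * N%:R)) ^+ 2) <= 1].
  pose M1 := CN / (N%:R * K); pose M2 := 6 * (6 * (tau * N%:R)) ^+ 2; pose M := M1 + M2 + 1.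
  have NK0 : 0 < N%:R * K by rewrite mulr_gt0.
  have M10 : 0 <= M1 by rewrite divr_ge0 // ltW.
  have M20 : 0 <= M2 by apply: mulr_ge0 => //; exact: sqr_ge0.
  have M0 : 0 < M by rewrite /M; lra.
  pose e0 := Num.min (3 / 200) M^-1.
  have e00 : 0 < e0 by rewrite lt_min invr_gt0 M0 andbT divr_gt0.
  have eM : e0 ^+ 2 * M <= 1.
    have h : e0 * M <= 1 by rewrite -ler_pdivlMr // mul1r ge_min lexx orbT.
    have h1 : e0 <= 1.
      have : M^-1 <= 1 by rewrite invf_le1 // /M; lra.
      by apply: le_trans; rewrite ge_min lexx orbT.
    by rewrite expr2 -mulrA mulr_ile1 // ?mulr_ge0 // ltW.
  exists e0; split => //; first by rewrite ge_min lexx.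
    have -> : CN = N%:R * K * M1 by rewrite /M1 mulrC mulfVK // lt0r_neq0.
    rewrite mulrCA -[leRHS]mulr1 ler_pM2l //; apply: (le_trans _ eM).
    by rewrite ler_pM2l ?exprn_gt0 // /M; lra.
  by apply: (le_trans _ eM); rewrite ler_pM2l ?exprn_gt0 // /M -/M2; lra.
exists N; split => //; exists e0 => // e e_gt0 ee0.
have ee : e ^+ 2 <= e0 ^+ 2 by rewrite lerXn2r ?nnegrE ?ltW.
pose a := e / 3; have a0 : 0 < a by rewrite divr_gt0.
have a2 : a <= 1 / 200 by rewrite /a; lra.
have a1 : a < 1 by lra.
set A := hersch_teeth _ e; have HA : H `<=` A by exact: teeth_sub.
have cF := comb_C1c N1 a0 a1 HA (fun j js => teeth_cen N1 js).
have lA := lambda1_sub HA.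
have [l' lA'] : exists l', lambda1 A = l'%:E.
  have := lambda1_ge0 A; move: lA; rewrite lH; case: (lambda1 A) => [r|//|//] _ _; by exists r.
exists l' => //; have l'0 : 0 <= l' by rewrite -lee_fin -lA' lambda1_ge0.
(* The quality asked of u depends on e, while the cell mass [c] does not; [d] keeps u within the
   range of [cell_mass]. *)
pose del := Num.min d (e ^+ 2 * tau * c4 * N%:R / 2).
have e2 : 0 < e ^+ 2 by rewrite exprn_gt0.
pose g := e ^+ 2 * tau * c4 * N%:R / 2.
have g0 : 0 < g by apply: divr_gt0 => //; apply: mulr_gt0 => //; apply: mulr_gt0 => //; exact: mulr_gt0.
have del0 : 0 < del by rewrite lt_min d0.
have [u [u1 [u2 [cu nu u0 eu]]]] := near_min_nneg lH (ltW l0) del0.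
have du : energy u1 u2 <= l + d by apply: (le_trans (ltW eu)); rewrite lerD2l ge_min lexx.
have mass := hcd _ _ _ cu u0 nu du.
pose t := e ^+ 2 * tau; have t0 : 0 < t by rewrite mulr_gt0.
have cuA := C1c_sub HA cu.
have cw := C1cD cuA (C1cZ t cF).
have E1 : energy (comb1 N a) (comb2 N a) * e ^+ 2 <= 2 * (N%:R * K).
  have := comb_energy N1 a0 a1; rewrite -/CN => h.
  have -> : 2 * (N%:R * K) = (N%:R * (2 * (20 * 20) * (pi / (a / 2)) ^+ 2)) * e ^+ 2 + N%:R * K.
    have en := lt0r_neq0 e_gt0; rewrite /K /a; move: (e) en (pi : R) (N%:R : R) => z zn q m; field; exact: zn.
  apply: (le_trans (ler_wpM2r (ltW e2) h)); rewrite mulrDl lerD2l mulrC; apply: le_trans e02.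
  by rewrite ler_pM2r.
have B1 : Bf l u u1 u2 (comb N a) (comb1 N a) (comb2 N a) <= - (c4 * N%:R).
  apply: (le_trans (comb_Bf N1 a0 a1 a2 (ltW l0) cu u0)); rewrite lerN2.
  have -> : c4 * N%:R = l * (N%:R / 18 * c) by rewrite /c4; field.
  by rewrite ler_pM2l // ler_pM2l // divr_gt0.
have M1 : t ^+ 2 * nrm2 (comb N a) <= 1.
  have h := comb_nrm2 N1 a0 a1.
  apply: (le_trans (ler_wpM2l (sqr_ge0 t) h)).
  have -> : t ^+ 2 * (6 * (N%:R * (2 / a)) ^+ 2) = e ^+ 2 * (6 * (6 * (tau * N%:R)) ^+ 2).
    have en := lt0r_neq0 e_gt0; rewrite /t /a; move: (e) en (tau) (N%:R : R) => z zn q m; field; exact: zn.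
  by apply: le_trans e03; rewrite ler_wpM2r // mulr_ge0 // sqr_ge0.
have Qw := Qf_expand l t cu cF.
have Qu : Qf l u u1 u2 <= e ^+ 2 * tau * c4 * N%:R / 2.
  by rewrite /Qf nu mulr1 lerBlDl (le_trans (ltW eu)) // lerD2l ge_min lexx orbT.
have Qc : Qf l (comb N a) (comb1 N a) (comb2 N a) <= energy (comb1 N a) (comb2 N a).
  by rewrite /Qf gerBl mulr_ge0 ?nrm2_ge0 // ltW.
have QW : energy (fun x => u1 x + t * comb1 N a x) (fun x => u2 x + t * comb2 N a x) <=
   l * nrm2 (fun x => u x + t * comb N a x) - g.
  have h1 : t ^+ 2 * Qf l (comb N a) (comb1 N a) (comb2 N a) <= e ^+ 2 * tau * c4 * N%:R.
    apply: (le_trans (ler_wpM2l (sqr_ge0 t) Qc)).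
    have -> : t ^+ 2 * energy (comb1 N a) (comb2 N a) = t * tau * (energy (comb1 N a) (comb2 N a) * e ^+ 2) by rewrite /t; ring.
    have -> : e ^+ 2 * tau * c4 * N%:R = t * tau * (2 * (N%:R * K)).
      have tK : tau * (2 * K) = c4 by rewrite /tau mulfVK // lt0r_neq0 // mulr_gt0.
      by rewrite -{1}tK /t; ring.
    by rewrite ler_wpM2l // mulr_ge0 // ltW.
  have h2 : 2 * t * Bf l u u1 u2 (comb N a) (comb1 N a) (comb2 N a) <= - (2 * (e ^+ 2 * tau * c4 * N%:R)).
    have -> : - (2 * (e ^+ 2 * tau * c4 * N%:R)) = 2 * t * - (c4 * N%:R) by rewrite /t; ring.
    by rewrite ler_pM2l // mulr_gt0.
  move: Qw; rewrite {1}/Qf => Qw; move: Qu h1 h2; rewrite /g; lra.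
have Nw : nrm2 (fun x => u x + t * comb N a x) <= 4.
  have bu := C1c_Bc cu; have bc := C1c_Bc cF.
  have bt : Bc (fun x => t * comb N a x) by exact: BcZ.
  apply: (@le_trans _ _ (2 * nrm2 u + 2 * nrm2 (fun x => t * comb N a x))); last by rewrite nu nrm2Z //; lra.
  have [s1 s2 s3] := And3 (Bc_sqr bu) (Bc_sqr bt) (Bc_sqr (BcD bu bt)).
  rewrite /nrm2 -!int2_Z // -int2_D; [|exact: BcZ|exact: BcZ].
  apply: int2_le => //; first by apply: BcD; exact: BcZ.
  by move=> x; have := sqr_ge0 (u x - t * comb N a x); move: (u x) (t * _) => p q; nra.
have Rw : l' * nrm2 (fun x => u x + t * comb N a x) <= energy (fun x => u1 x + t * comb1 N a x) (fun x => u2 x + t * comb2 N a x).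
  by apply: (rayleigh _ cw l'0); rewrite lA'.
have n1 := nrm2_ge0 (fun x => u x + t * comb N a x).
have ll : l' <= l by rewrite -lee_fin -lA' -lH.
have hg : k * e ^+ 2 <= g / 4.
  have := ler_wpM2r (ltW e2) hN; rewrite /g; lra.
have : g <= (l - l') * 4.
  apply: (@le_trans _ _ ((l - l') * nrm2 (fun x => u x + t * comb N a x))).
    by rewrite mulrBl; lra.
  by rewrite ler_wpM2l // subr_ge0.
lra.
Qed.

End Comb.

(** * Inradius and topology of the toothed pipe *)

Section Geom.
Variable R : realType.
Local Notation H := (@hersch R).

Lemma inradius_sub (A B : set (R * R)) : A `<=` B -> (inradius A <= inradius B)%E.
Proof.
move=> AB; apply: le_ereal_sup => _ [r [r0 [x hx]] <-]; exists r => //.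
by split => //; exists x => y /hx /AB.
Qed.

Lemma inradius_ge (A : set (R * R)) x (r : R) : 0 < r -> eball x r `<=` A -> (r%:E <= inradius A)%E.
Proof. by move=> r0 h; apply: ereal_sup_ubound; exists r => //; split => //; exists x. Qed.

Lemma inradius_le (A : set (R * R)) (M : R) : (forall c r, 0 < r -> eball c r `<=` A -> r <= M) -> (inradius A <= M%:E)%E.
Proof. by move=> h; apply: ge_ereal_sup => _ [r [r0 [x hx]] <-]; rewrite lee_fin; exact: h hx. Qed.

(** A point off [A] within distance M of the centre caps the radius; bounding the inradius amounts
    to choosing such a point for every centre. *)
Lemma eball_out (A : set (R * R)) (c z : R * R) (r M : R) : 0 < r -> 0 <= M -> eball c r `<=` A -> ~ A z ->
  (z.1 - c.1) ^+ 2 + (z.2 - c.2) ^+ 2 <= M ^+ 2 -> r <= M.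
Proof.
move=> r0 M0 cA nz h; rewrite leNgt; apply/negP => Mr; apply: nz; apply: cA.
by rewrite /eball /=; apply: (le_lt_trans h); rewrite ltrXn2r ?nnegrE // ltW.
Qed.

Lemma inradius_hersch_ge : ((1 / 2)%:E <= inradius H)%E.
Proof.
apply: (@inradius_ge _ (10, 1 / 2)) => // x; rewrite /eball /= => h.
have h1 : (x.1 - 10) ^+ 2 < (1 / 2) ^+ 2 by apply: le_lt_trans h; rewrite lerDl sqr_ge0.
have h2 : (x.2 - 1 / 2) ^+ 2 < (1 / 2) ^+ 2 by apply: le_lt_trans h; rewrite lerDr sqr_ge0.
have bnd (a : R) : a ^+ 2 < (1 / 2) ^+ 2 -> - (1 / 2) < a < 1 / 2.
  by rewrite -(real_normK (num_real a)) ltr_sqr ?nnegrE // ltr_norml.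
move: (bnd _ h1) (bnd _ h2) => /andP[? ?] /andP[? ?].
right; split => /=; last by lra.
by rewrite gtr0_norm; [apply/andP; split|]; lra.
Qed.

Section teeth.
Variables (n : nat) (e : R).
Hypothesis n1 : (0 < n)%N.
Hypothesis e0 : 0 < e.
Hypothesis en : e < (2 * n%:R)^-1.
Local Notation A := (hersch_teeth n e).
Let nR : 0 < n%:R :> R. Proof. by rewrite ltr0n. Qed.

Lemma e_half : e < 1 / 2.
Proof.
apply: (lt_le_trans en); rewrite invfM div1r ler_piMr // invf_le1 //.
by rewrite ler1n.
Qed.

Lemma teeth_gap (i j : nat) : `|i%:R / n%:R - j%:R / n%:R| < 2 * e :> R -> i = j.
Proof.
move=> h; have : `|i%:R - j%:R| < 1 :> R.
  have : 2 * e < n%:R^-1 by move: en; rewrite invfM; lra.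
  move=> h2; have := lt_trans h h2; rewrite -mulrBl normrM (gtr0_norm (_ : 0 < n%:R^-1)) ?invr_gt0 //.
  by rewrite -[ltRHS]mul1r ltr_pM2r // invr_gt0.
have i1 (z : int) : `|z%:~R| < 1 :> R -> z = 0.
  move=> z0; apply/eqP; apply: contraT => zn; move: z0; rewrite -intr_norm ltrz1 => z0.
  by have := normr_gt0 z; rewrite zn; move: z0; lia.
move=> h3; have := i1 (i%:Z - j%:Z); rewrite intrB => /(_ h3) /eqP; rewrite subr_eq0 eqz_nat; exact: eqP.
Qed.

Lemma out_slit (t : R) : 0 <= t -> ~ A (t, 0).
Proof.
move=> t0 [[[_ /=]|[/= + _]]|[i _ [_ /= /andP[+ _]]]]; first by rewrite ltNge t0.
  by rewrite normr0 ltxx.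
by rewrite ler10.
Qed.

Lemma out_circle (x : R * R) : x.1 <= 0 -> x.1 ^+ 2 + x.2 ^+ 2 = 1 -> ~ A x.
Proof.
move=> x0 x1 [[[+ _]|[/andP[_ +] h]]|[i _ [/andP[h _] _]]].
- by rewrite x1 ltxx.
- have z : x.1 = 0 by apply/eqP; rewrite eq_le x0.
  move: x1; rewrite z expr0n add0r -(real_normK (num_real x.2)) => e1 e2.
  by have := normr_ge0 x.2; move: e1 e2; move: `|x.2| => u; nra.
- have : 0 <= i%:R / n%:R :> R by rewrite divr_ge0.
  by have := e_half; lra.
Qed.

Lemma out_below (t : R) : 0 <= t -> ~ A (t, -1).
Proof.
move=> t0 [[[_ /=]|[/= /andP[_ +] _]]|[i _ [_ /= /andP[+ _]]]]; first by rewrite ltNge t0.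
  by rewrite normrN normr1 ltxx.
lra.
Qed.

Lemma out_lid (t s : R) : 0 <= t -> 1 <= s -> (forall i : nat, ~ (2 + i%:R / n%:R - e < t < 2 + i%:R / n%:R + e)) -> ~ A (t, s).
Proof.
move=> t0 s1 ht [[[_ /=]|[/= /andP[_ +] _]]|[i _ [/= + _]]]; first by rewrite ltNge t0.
  by rewrite ger0_norm; lra.
exact: ht.
Qed.

(** The spacing 1/n exceeds 2 e, so the wall of one tooth is not inside another. *)
Lemma out_wall (i : nat) (d s : R) : `|d| = e -> 1 <= s -> ~ A (2 + i%:R / n%:R + d, s).
Proof.
move=> de s1; have de' : - e <= d <= e by rewrite -ler_norml de.
have i0 : 0 <= i%:R / n%:R :> R by rewrite divr_ge0.
have eh := e_half; move/andP: de' => [d1 d2].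
apply: out_lid => // [|j /andP[h1 h2]]; first lra.
have ij : i = j by apply: teeth_gap; rewrite ltr_norml; apply/andP; split; lra.
move: de h1 h2; rewrite ij => de h1 h2.
have : `|d| < e by rewrite ltr_norml; apply/andP; split; lra.
by rewrite de ltxx.
Qed.

(** The extreme centre lies below an opening, equally far from the slit and from the corners at
    horizontal distance e: c2^2 = e^2 + (1 - c2)^2 gives c2 = (1 + e^2) / 2. *)
Lemma inradius_teeth : (inradius A <= ((1 + e ^+ 2) / 2)%:E)%E.
Proof.
apply: inradius_le => c r r0 cA.
have e2 := sqr_ge0 e; pose M := (1 + e ^+ 2) / 2.
have M0 : 0 <= M by rewrite /M; lra.
have half : 1 / 2 <= M by rewrite /M; lra.
have out z k : ~ A z -> 0 <= k -> k <= M -> (z.1 - c.1) ^+ 2 + (z.2 - c.2) ^+ 2 <= k ^+ 2 -> r <= M.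
  by move=> nz k0 kM h; apply: le_trans kM; exact: eball_out nz h.
have Ac : A c by apply: cA; exact: eball_center.
have [c1|c1] := leP c.1 0.
  (* A centre in the bend is tested against the origin, where the slit ends, or against its radial
     projection on the unit circle; the smaller distance is at most 1/2. *)
  pose rr := Num.sqrt (c.1 ^+ 2 + c.2 ^+ 2).
  have r2 : rr ^+ 2 = c.1 ^+ 2 + c.2 ^+ 2 by rewrite sqr_sqrtr // addr_ge0 ?sqr_ge0.
  have rr0 : 0 <= rr by exact: sqrtr_ge0.
  have [rh|rh] := leP rr (1 / 2).
    apply: (@out (0, 0) (1 / 2)) => //=; first exact: out_slit.
    rewrite !sub0r !sqrrN -r2 lerXn2r ?nnegrE //.
  have [rb|rb] := leP 1 rr.
    exfalso; case: Ac => [[[h _]|[/andP[_ h1] h2]]|[i _ [/andP[h _] _]]].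
    - by move: h; rewrite -r2; nra.
    - have z : c.1 = 0 by apply/eqP; rewrite eq_le c1.
      move: r2; rewrite z expr0n add0r -(real_normK (num_real c.2)) => r2.
      have := normr_ge0 c.2; nra.
    - have : 0 <= i%:R / n%:R :> R by rewrite divr_ge0.
      by have := e_half; lra.
  have rn : rr != 0 by rewrite lt0r_neq0 //; lra.
  apply: (@out (c.1 / rr, c.2 / rr) (1 - rr)) => /=; [|lra|lra|].
    apply: out_circle => /=; first by rewrite mulr_le0_ge0 // invr_ge0.
    by rewrite !expr_div_n -mulrDl -r2 mulfV // expf_neq0.
  rewrite le_eqVlt; apply/orP; left; apply/eqP.
  have -> : (c.1 / rr - c.1) ^+ 2 + (c.2 / rr - c.2) ^+ 2 = (c.1 ^+ 2 + c.2 ^+ 2) * (rr^-1 - 1) ^+ 2 by ring.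
  by rewrite -r2; move: rn; move: (rr) => q qn; field.
have [c2|c2] := leP c.2 0.
  have [c3|c3] := leP (- (1 / 2)) c.2.
    apply: (@out (c.1, 0) (- c.2)) => /=; [exact: out_slit (ltW c1)|lra|lra|].
    by rewrite subrr expr0n add0r sub0r.
  have c4 : -1 < c.2.
    case: Ac => [[[_]|[/andP[_] ]]|[i _ [_ /andP[h _]]]]; [lra| |lra].
    by rewrite ltr_norml => /andP[].
  apply: (@out (c.1, -1) (1 + c.2)) => /=; [exact: out_below (ltW c1)|lra|lra|].
  by rewrite subrr expr0n add0r -sqrrN opprB addrC opprK.
have [c3|c3] := leP c.2 (1 / 2).
  apply: (@out (c.1, 0) c.2) => /=; [exact: out_slit (ltW c1)|lra|lra|].
  by rewrite subrr expr0n add0r sub0r sqrrN.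
have [[i hi]|no] := pselect (exists i : nat, 2 + i%:R / n%:R - e < c.1 < 2 + i%:R / n%:R + e); last first.
  have c4 : c.2 < 1.
    case: Ac => [[[_]|[/andP[_] ]]|[i _ [h _]]]; [lra| |].
      by rewrite ltr_norml => /andP[].
    by case: no; exists i.
  apply: (@out (c.1, 1) (1 - c.2)) => /=; [|lra|lra|by rewrite subrr expr0n add0r].
  by apply: out_lid => //; [exact: ltW|move=> i hi; apply: no; exists i].
have eh := e_half; move/andP: hi => [h1 h2].
have [c4|c4] := leP 1 c.2.
  apply: (@out (2 + i%:R / n%:R + (if c.1 < 2 + i%:R / n%:R then - e else e), c.2) e) => /=; [|lra|lra|].
    by apply: out_wall => //; case: ifP => _; rewrite ?normrN ger0_norm // ltW.
  rewrite subrr expr0n addr0 -(real_normK (num_real (_ - c.1))) lerXn2r ?nnegrE // ?(ltW e0) //.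
  by rewrite ler_norml; case: (ltP c.1 _) => h3; apply/andP; split; lra.
have [c5|c5] := leP c.2 M.
  apply: (@out (c.1, 0) c.2) => /=; [exact: out_slit (ltW c1)|lra|lra|].
  by rewrite subrr expr0n add0r sub0r sqrrN.
apply: (@out (2 + i%:R / n%:R + (if c.1 < 2 + i%:R / n%:R then - e else e), 1) M) => //=.
  by apply: out_wall => //; case: ifP => _; rewrite ?normrN ger0_norm // ltW.
have k1 : (2 + i%:R / n%:R + (if c.1 < 2 + i%:R / n%:R then - e else e) - c.1) ^+ 2 <= e ^+ 2.
  rewrite -(real_normK (num_real (_ - c.1))) lerXn2r ?nnegrE // ?(ltW e0) //.
  by rewrite ler_norml; case: (ltP c.1 _) => h3; apply/andP; split; lra.
have k2 : (1 - c.2) ^+ 2 <= ((1 - e ^+ 2) / 2) ^+ 2.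
  rewrite lerXn2r ?nnegrE //; [lra| |by move: c5; rewrite /M; lra].
  by move: c5 c4; rewrite /M; lra.
apply: (le_trans (lerD k1 k2)); rewrite /M le_eqVlt; apply/orP; left; apply/eqP; by field.
Qed.

(** A tooth contains its bottom edge x2 = 1. Prolonged down to height 0 it becomes an open
    rectangle, and the union is unchanged. *)
Lemma teeth_open : open A.
Proof.
pose T i : set (R * R) := [set x | 2 + i%:R / n%:R - e < x.1 < 2 + i%:R / n%:R + e /\ 0 < x.2 < 2].
have -> : A = H `|` \bigcup_(i in [set i : nat | (i <= n)%N]) T i.
  have i0 (i : nat) : 0 <= i%:R / n%:R :> R by rewrite divr_ge0.
  apply/seteqP; split => x [Hx|[i ni [h1 h2]]]; try by left.
    by right; exists i => //; split => //; lra.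
  have [x2|x2] := ltP x.2 1; last by right; exists i => //; split => //; lra.
  left; right; have := e_half; have := i0 i; split => /=; last by lra.
  by rewrite gtr0_norm; lra.
apply: openU; first exact: hersch_open.
apply: bigcup_open => i _.
have -> : T i = ((fun x : R * R => x.1) @^-1` [set t | 2 + i%:R / n%:R - e < t] `&` (fun x : R * R => x.1) @^-1` [set t | t < 2 + i%:R / n%:R + e]) `&`
   ((fun x : R * R => x.2) @^-1` [set t | 0 < t] `&` (fun x : R * R => x.2) @^-1` [set t | t < 2]).
  by apply/seteqP; split => x /=; [by move=> [/andP[? ?] /andP[? ?]]|by move=> [[h1 h2] [h3 h4]]; split; apply/andP].
by apply: openI; apply: openI; apply: open_comp; try exact: open_lt; try exact: open_gt; move=> x _; (exact: cont_fst2 || exact: cont_snd2).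
Qed.

End teeth.
End Geom.

(** * Contractibility of the toothed pipe *)

Section Contract.
Variable R : realType.
Local Notation H := (@hersch R).
Implicit Types (t s : R).

Definition clamp (t : R) : R := Num.max 0 (Num.min t 1).

Lemma clamp_le0 t : t <= 0 -> clamp t = 0.
Proof. by move=> t0; rewrite /clamp min_l ?max_l //; lra. Qed.

Lemma clamp_ge1 t : 1 <= t -> clamp t = 1.
Proof. by move=> t1; rewrite /clamp min_r // max_r. Qed.

Lemma clamp_id t : 0 <= t <= 1 -> clamp t = t.
Proof. by move=> /andP[t0 t1]; rewrite /clamp min_l // max_r. Qed.

Lemma clamp01 t : 0 <= clamp t <= 1.
Proof. by rewrite /clamp le_max lexx /= ge_max ler01 ge_min lexx orbT. Qed.

Lemma cont_max (T : topologicalType) (f g : T -> R) : continuous f -> continuous g -> continuous (fun x => Num.max (f x) (g x)).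
Proof. by move=> cf cg x; apply: continuous_max; [exact: cf|exact: cg]. Qed.

Lemma cont_min (T : topologicalType) (f g : T -> R) : continuous f -> continuous g -> continuous (fun x => Num.min (f x) (g x)).
Proof. by move=> cf cg x; apply: continuous_min; [exact: cf|exact: cg]. Qed.

Lemma cont_clamp : continuous clamp.
Proof.
apply: cont_max; first exact: cst_continuous.
by apply: cont_min; [move=> t; exact: cvg_id|exact: cst_continuous].
Qed.

Lemma cont_clamp_comp (T : topologicalType) (f : T -> R) : continuous f -> continuous (fun x => clamp (f x)).
Proof. by move=> cf x; apply: (@continuous_comp _ _ _ f clamp); [exact: cf|exact: cont_clamp]. Qed.

Definition base : R * R := (- (1 / 4), 0).

(* Three successive motions: shrink vertically (and the bend radially) by 4,
   retract the strips onto the segment x1 = 0, then contract the bend to the base point. *)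
Definition contr (x : R * R) (t : R) : R * R :=
  let s := 1 - 3 / 4 * clamp (3 * t) in
  let b := clamp (3 * t - 1) in
  let c := clamp (3 * t - 2) in
  ((1 - b) * Num.max x.1 0 + (1 - c) * (s * Num.min x.1 0) - c * (1 / 4), (1 - c) * (s * x.2)).

Arguments contr : simpl never.

Lemma contr_cont (T : topologicalType) (x : T -> R * R) (t : T -> R) : continuous x -> continuous t ->
  continuous (fun z => contr (x z) (t z)).
Proof.
move=> cx ct; have c3 : continuous (fun z => 3 * t z) by apply: contM => //; exact: cont_cst.
have cs : continuous (fun z => 1 - 3 / 4 * clamp (3 * t z)).
  by apply: contB; [exact: cont_cst|apply: contM; [exact: cont_cst|exact: cont_clamp_comp]].
have cb : continuous (fun z => clamp (3 * t z - 1)) by apply: cont_clamp_comp; apply: contB => //; exact: cont_cst.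
have cc : continuous (fun z => clamp (3 * t z - 2)) by apply: cont_clamp_comp; apply: contB => //; exact: cont_cst.
have c1 : continuous (fun z => 1 - clamp (3 * t z - 1)) by apply: contB => //; exact: cont_cst.
have c2 : continuous (fun z => 1 - clamp (3 * t z - 2)) by apply: contB => //; exact: cont_cst.
apply: cont_pair.
  apply: contB; last by apply: contM => //; exact: cont_cst.
  apply: contD; apply: contM => //.
    by apply: cont_max; [exact: cont_proj1|exact: cont_cst].
  by apply: contM => //; apply: cont_min; [exact: cont_proj1|exact: cont_cst].
by apply: contM => //; apply: contM => //; exact: cont_proj2.
Qed.

Lemma contr_0 (x : R * R) t : t <= 0 -> contr x t = x.
Proof.
move=> t0; rewrite /contr !clamp_le0; [|lra|lra|lra].
rewrite mulr0 subr0 !mul1r mul0r subr0 [RHS]surjective_pairing; congr (_, _).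
by case: (leP x.1 0) => h; rewrite ?add0r ?addr0.
Qed.

Lemma contr_1 (x : R * R) t : 1 <= t -> contr x t = base.
Proof.
move=> t1; rewrite /contr /base; cbv zeta; rewrite !clamp_ge1; [|lra|lra|lra].
by congr (_, _); ring.
Qed.

(** Heights stay below 2, so the vertical factor 1/4 brings them under 1/2 before any horizontal
    motion starts and no wall is crossed; being positive, it never moves a point onto the slit. In
    the last motion x1 becomes negative at once and the point stays in the convex unit disc. *)
Lemma contr_in (n : nat) (e : R) (x : R * R) t : e < 1 / 2 -> hersch_teeth n e x -> hersch_teeth n e (contr x t).
Proof.
move=> eh Ax; rewrite /contr; cbv zeta.
set a := clamp (3 * t); set b := clamp (3 * t - 1); set c := clamp (3 * t - 2).
have /andP[a0 a1] : 0 <= a <= 1 := clamp01 _.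
have /andP[b0 b1] : 0 <= b <= 1 := clamp01 _.
have /andP[c0 c1] : 0 <= c <= 1 := clamp01 _.
(* The motions do not overlap: each starts only when the previous ones are complete. *)
have hb : 0 < b -> a = 1.
  move=> bp; apply: clamp_ge1; rewrite leNgt; apply/negP => h; move: bp; rewrite /b clamp_le0 ?ltxx //; lra.
have hc : 0 < c -> a = 1 /\ b = 1.
  move=> cp; have h : 2 <= 3 * t by rewrite leNgt; apply/negP => h; move: cp; rewrite /c clamp_le0 ?ltxx //; lra.
  by split; apply: clamp_ge1; lra.
have i0 (i : nat) : 0 <= i%:R / n%:R :> R by rewrite divr_ge0.
pose s := 1 - 3 / 4 * a; have s1 : 1 / 4 <= s <= 1 by rewrite /s; apply/andP; split; lra.
rewrite -/s; move/andP: s1 => [s0 s1].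
have [x0|x0] := ltP x.1 0.
  have d : x.1 ^+ 2 + x.2 ^+ 2 < 1.
    by case: Ax => [[[h _]|[_ h]]|[i _ [/andP[h _] _]]] //; [lra|have := i0 i; lra].
  rewrite mulr0 add0r.
  left; left; split => /=.
    have d2 : (s * x.1) ^+ 2 + (s * x.2) ^+ 2 < 1.
      rewrite !exprMn -mulrDr; have : s ^+ 2 <= 1 by rewrite exprn_ile1 //; lra.
      have := addr_ge0 (sqr_ge0 x.1) (sqr_ge0 x.2); move: (_ + _) d (s ^+ 2) => q d p q0 p1; nra.
    move: d2; move: (s * x.1) (s * x.2) => u v d2.
    have k : 0 <= c * (1 - c) by rewrite mulr_ge0 ?subr_ge0.
    have h : (1 - c) * (u ^+ 2 + v ^+ 2) + c * (1 / 16) < 1 by nra.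
    apply: le_lt_trans h; rewrite -subr_ge0.
    have -> : (1 - c) * (u ^+ 2 + v ^+ 2) + c * (1 / 16) - (((1 - c) * u - c * (1 / 4)) ^+ 2 + ((1 - c) * v) ^+ 2) =
      c * (1 - c) * (u + 1 / 4) ^+ 2 + c * (1 - c) * v ^+ 2 by field.
    by rewrite addr_ge0 // mulr_ge0 ?sqr_ge0.
  have : s * x.1 < 0 by nra.
  by move: (s * x.1) => u; nra.
rewrite !mulr0 addr0.
have x2 : x.2 != 0 /\ `|x.2| < 2.
  case: Ax => [[[_]|[/= /andP[h1 h2] _]]|[i _ [_ /andP[h1 h2]]]]; first by rewrite ltNge x0.
    by rewrite -normr_gt0; split => //; lra.
  by split; [rewrite lt0r_neq0 //; lra|rewrite ger0_norm //; lra].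
case: x2 => [x2n x22].
have sn : s != 0 by rewrite lt0r_neq0 //; lra.
have [cp|cz] := ltP 0 c.
  have [ea eb] := hc cp.
  left; left; split => /=; last by rewrite eb; lra.
  have se : s = 1 / 4 by rewrite /s ea; field.
  rewrite eb subrr mul0r add0r sqrrN se !exprMn.
  have q : x.2 ^+ 2 < 4 by rewrite -(real_normK (num_real x.2)); have := normr_ge0 x.2; move: `|x.2| x22 => z; nra.
  have p0 := sqr_ge0 x.2.
  have : (1 - c) ^+ 2 <= 1 by rewrite exprn_ile1 //; lra.
  have : c ^+ 2 <= 1 by rewrite exprn_ile1.
  have := sqr_ge0 (1 - c); have := sqr_ge0 c.
  by move: ((1 - c) ^+ 2) (c ^+ 2) (x.2 ^+ 2) q p0 => u v w *; nra.
have ce : c = 0 by apply/eqP; rewrite eq_le cz.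
rewrite ce subr0 mul0r subr0 mul1r.
have [bp|bz] := ltP 0 b.
  have ea := hb bp; have se : s = 1 / 4 by rewrite /s ea; field.
  left; right; split => /=; last by rewrite mulr_ge0 // subr_ge0.
  rewrite normr_gt0 mulf_neq0 //= normrM se ger0_norm ?divr_ge0 //; lra.
have be : b = 0 by apply/eqP; rewrite eq_le bz.
rewrite be subr0 mul1r.
have strip : `|s * x.2| < 1 -> hersch_teeth n e (x.1, s * x.2).
  by move=> h; left; right; split => //=; rewrite normr_gt0 mulf_neq0.
case: Ax => [[[_]|[/= /andP[h1 h2] _]]|[i ni [hp /andP[h1 h2]]]]; first by rewrite ltNge x0.
  apply: strip; rewrite normrM ger0_norm; last by lra.
  by apply: le_lt_trans h2; rewrite ler_piMl.
have [h|h] := ltP (s * x.2) 1.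
  by apply: strip; rewrite ger0_norm // mulr_ge0 //; lra.
right; exists i => //; split => //=; rewrite h /=.
by apply: le_lt_trans h2; rewrite ler_piMl //; lra.
Qed.

Lemma base_in (n : nat) (e : R) : hersch_teeth n e base.
Proof. by left; left; rewrite /base /=; split; lra. Qed.

(** Precomposing with the retraction onto [0, 1] gives a function continuous on the whole line, so
    homotopies can be assembled from global maps. *)
Lemma within01_clamp (g : R -> R * R) : {within `[0, 1], continuous g} -> continuous (fun t => g (clamp t)).
Proof.
move=> /subspace_continuousP cg t.
have ct : `[0, 1]%classic (clamp t) by rewrite /= in_itv /=; exact: clamp01.
move=> P nP; have := cg _ ct P nP; rewrite /within /= => /nbhs_ballP [d /= d0 hd].
have ct2 : \forall y \near t, ball (clamp t) d (clamp y) := @cont_clamp t _ (nbhsx_ballx (clamp t) d d0).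
change (\forall y \near t, P (g (clamp y))).
apply: filterS ct2 => y /= hy; apply: hd => //; rewrite in_itv /=; exact: clamp01.
Qed.

(** [contr] moves the base point of a loop, while the homotopy must fix it. The loop is deformed
    into the track of its base point under [contr], run to [base] and back, and this detour is then
    retracted. *)
Lemma teeth_simply_connected (n : nat) (e : R) : e < 1 / 2 -> simply_connected (hersch_teeth n e).
Proof.
move=> eh; set A := hersch_teeth n e.
have cA x t : A x -> A (contr x t) by exact: contr_in.
split; first by exists base; exact: base_in.
split.
  move=> x y Ax Ay.
  (* At every time one of the two summands equals [base], so the difference glues the two tracks
     without a case split and is visibly continuous. *)
  pose g (t : R) : R * R := ((contr x (2 * t)).1 + (contr y (2 - 2 * t)).1 - base.1,
                   (contr x (2 * t)).2 + (contr y (2 - 2 * t)).2 - base.2).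
  have gl t : t <= 1 / 2 -> g t = contr x (2 * t).
    move=> ht; rewrite /g (@contr_1 y); last by lra.
    by rewrite !addrK -surjective_pairing.
  have gr t : 1 / 2 <= t -> g t = contr y (2 - 2 * t).
    move=> ht; rewrite /g (@contr_1 x); last by lra.
    by rewrite (addrC base.1) (addrC base.2) !addrK -surjective_pairing.
  exists g; split; last first.
    by rewrite gl ?gr; [|lra|lra]; rewrite !contr_0 //; lra.
  split.
    apply: continuous_subspaceT.
    have c1 : continuous (fun t : R => contr x (2 * t)).
      by apply: contr_cont; [exact: cst_continuous|apply: contM; [exact: cont_cst|move=> t; exact: cvg_id]].
    have c2 : continuous (fun t : R => contr y (2 - 2 * t)).
      by apply: contr_cont; [exact: cst_continuous|apply: contB; [exact: cont_cst|apply: contM; [exact: cont_cst|move=> t; exact: cvg_id]]].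
    by apply: cont_pair; apply: contB; try exact: cont_cst; apply: contD; (exact: cont_proj1 || exact: cont_proj2).
  move=> _ [t _ <-]; have [ht|ht] := leP t (1 / 2); first by rewrite gl //; exact: cA.
  by rewrite gr ?(ltW ht) //; exact: cA.
move=> g [cg gA] g01; pose x0 := g 0.
pose gh t := g (clamp t); have cgh := within01_clamp cg.
have Agh t : A (gh t) by apply: gA; exists (clamp t) => //; rewrite /= in_itv /=; exact: clamp01.
have Ax0 : A x0 by apply: gA; exists 0 => //; rewrite /= in_itv /= lexx ler01.
have gh0 : gh 0 = x0 by rewrite /gh clamp_le0.
have gh1 : gh 1 = x0 by rewrite /gh clamp_ge1 // -g01.
(* The contraction time allowed at parameter s: 0 at both ends, which therefore stay put, and 1 on
   the middle third, where the loop is run. *)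
pose tau (s : R) := Num.min 1 (Num.min (3 * s) (3 * (1 - s))).
pose P1 (z : R * R) := let t := Num.min z.2 (1 / 2) in
  contr (gh ((1 - 2 * t) * z.1 + 2 * t * clamp (3 * z.1 - 1))) (2 * t * tau z.1).
pose P2 (z : R * R) := let t := Num.max z.2 (1 / 2) in contr x0 (tau z.1 * (2 - 2 * t)).
pose M (z : R * R) := contr x0 (tau z.1).
(* [P1] and [P2] both equal [M] at time 1/2, so [P1] for t <= 1/2 and [P2] for t >= 1/2 glue to P1 + P2 - M
   once their time is truncated at 1/2. *)
pose F0 (z : R * R) : R * R := ((P1 z).1 + (P2 z).1 - (M z).1, (P1 z).2 + (P2 z).2 - (M z).2).
pose sq : set (R * R) := `[0, 1] `*` `[0, 1].
(* The boundary identities are required for all real s and t; off the unit square F takes the values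
   that they prescribe. *)
pose F (z : R * R) : R * R := if z \in sq then F0 z else if z.2 == 0 then g z.1 else g 0.
have sqE (z : R * R) : sq z <-> (0 <= z.1 <= 1) && (0 <= z.2 <= 1).
  by rewrite /sq /= !in_itv /=; split => [[-> ->]|/andP[-> ->]].
have c12 : 1 / 2 = 2^-1 :> R by rewrite div1r.
have mid (s : R) : contr (gh (clamp (3 * s - 1))) (tau s) = contr x0 (tau s).
  have [s1|s1] := leP s (1 / 3); first by rewrite clamp_le0 ?gh0 //; lra.
  have [s2|s2] := leP (2 / 3) s; first by rewrite clamp_ge1 ?gh1 //; lra.
  have t1 : 1 <= tau s by rewrite /tau !le_min lexx /=; apply/andP; split; lra.
  by rewrite !(contr_1 _ t1).
have F0l (z : R * R) : z.2 <= 1 / 2 -> F0 z = P1 z.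
  move=> h; rewrite /F0 /P2 /M max_r //.
  have -> : tau z.1 * (2 - 2 * (1 / 2)) = tau z.1 by field.
  by rewrite !addrK -surjective_pairing.
have F0r (z : R * R) : 1 / 2 <= z.2 -> F0 z = P2 z.
  move=> h; have e1 : P1 z = M z.
    rewrite /P1 /M; cbv zeta; rewrite min_r //.
    have -> : (1 - 2 * (1 / 2)) * z.1 + 2 * (1 / 2) * clamp (3 * z.1 - 1) = clamp (3 * z.1 - 1) by field.
    have -> : 2 * (1 / 2) * tau z.1 = tau z.1 by field.
    exact: mid.
  by rewrite /F0 e1 (addrC (M z).1) (addrC (M z).2) !addrK -surjective_pairing.
have cF : continuous F0.
  have c1 := @cont_fst2 R; have c2 := @cont_snd2 R.
  have ctau : continuous (fun z : R * R => tau z.1).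
    apply: cont_min; first exact: cont_cst.
    by apply: cont_min; apply: contM; try exact: cont_cst; try exact: c1; apply: contB => //; exact: cont_cst.
  have cm : continuous (fun z : R * R => Num.min z.2 (1 / 2)) by apply: cont_min => //; exact: cont_cst.
  have cx : continuous (fun z : R * R => Num.max z.2 (1 / 2)) by apply: cont_max => //; exact: cont_cst.
  have cm2 : continuous (fun z : R * R => 2 * Num.min z.2 (1 / 2)) by apply: contM => //; exact: cont_cst.
  have cP1 : continuous P1.
    apply: contr_cont; last exact: contM.
    move=> z; apply: (@continuous_comp _ _ _ (fun z : R * R => (1 - 2 * Num.min z.2 (1 / 2)) * z.1 + 2 * Num.min z.2 (1 / 2) * clamp (3 * z.1 - 1)) gh); last exact: cgh.
    move: z; apply: contD; apply: contM => //; first by apply: contB => //; exact: cont_cst.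
    by apply: cont_clamp_comp; apply: contB; [apply: contM => //|]; exact: cont_cst.
  have cP2 : continuous P2.
    apply: contr_cont; first exact: cst_continuous.
    by apply: contM => //; apply: contB; [exact: cont_cst|apply: contM => //; exact: cont_cst].
  have cMM : continuous M by apply: contr_cont => //; exact: cst_continuous.
  by apply: cont_pair; apply: contB; try (by apply: cont_proj1); try (by apply: cont_proj2); apply: contD; (by apply: cont_proj1) || by apply: cont_proj2.
have AF0 z : A (F0 z).
  have [h|h] := leP z.2 (1 / 2); first by rewrite F0l //; exact: cA.
  by rewrite F0r ?(ltW h) //; exact: cA.
have Fin z : sq z -> F z = F0 z by move=> h; rewrite /F mem_set.
have tau0 : tau 0 = 0 by rewrite /tau mulr0 subr0 mulr1 (min_l (_ : 0 <= 3)) // min_r.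
have tau1 : tau 1 = 0 by rewrite /tau subrr mulr0 mulr1 (min_r (_ : 0 <= 3)) // min_r.
have edge (s t : R) : tau s = 0 -> gh ((1 - 2 * Num.min t (1 / 2)) * s + 2 * Num.min t (1 / 2) * clamp (3 * s - 1)) = x0 ->
    F0 (s, t) = x0.
  move=> ts es; have q1 : P1 (s, t) = x0 by rewrite /P1; cbv zeta; rewrite (_ : (s, t).1 = s) // (_ : (s, t).2 = t) // es ts mulr0 contr_0.
  have q2 : P2 (s, t) = x0 by rewrite /P2; cbv zeta; rewrite (_ : (s, t).1 = s) // ts mul0r contr_0.
  have q3 : M (s, t) = x0 by rewrite /M (_ : (s, t).1 = s) // ts contr_0.
  by rewrite /F0 q1 q2 q3 !addrK -surjective_pairing.
have off z : ~ sq z -> F z = if z.2 == 0 then g z.1 else g 0 by move=> h; rewrite /F memNset.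
exists F; split; [|split; [|split; [|split; [|split]]]].
- have ce : {in sq, F0 =1 F} by move=> z /set_mem /Fin ->.
  exact: (@subspace_eq_continuous _ sq _ F0 F ce (continuous_subspaceT cF)).
- by move=> _ [z hz <-]; rewrite Fin.
- move=> s; have [h|h] := pselect (sq (s, 0)); last by rewrite off //= eqxx.
  rewrite Fin // F0l //= /P1 /= min_l // !(mulr0, mul0r) subr0 mul1r addr0 contr_0 //.
  by rewrite /gh clamp_id //; move/sqE: h => /andP[].
- move=> s; have [h|h] := pselect (sq (s, 1)); last by rewrite off //= oner_eq0.
  rewrite Fin // F0r /=; last by lra.
  rewrite /P2 /= max_l; last by lra.
  by rewrite mulr1 subrr mulr0 contr_0.
- move=> t; have [h|h] := pselect (sq (0, t)); last by rewrite off //=; case: ifP.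
  have c1 : clamp (3 * 0 - 1) = 0 by apply: clamp_le0; lra.
  by rewrite Fin // edge // c1 !mulr0 addr0 gh0.
- move=> t; have [h|h] := pselect (sq (1, t)); last by rewrite off //= -g01; case: ifP.
  have c1 : clamp (3 * 1 - 1) = 1 by apply: clamp_ge1; lra.
  by rewrite Fin // edge // c1 !mulr1 subrK gh1.
Qed.

End Contract.

(** * Comparison of inradius and eigenvalue *)

Section Final.
Variable R : realType.
Local Notation H := (@hersch R).

Lemma rho_real (A : set (R * R)) (i l : R) : inradius A = i%:E -> lambda1 A = l%:E -> rho A = (i * i * l)%:E.
Proof. by rewrite /rho => -> ->. Qed.

Lemma inradius_teeth_real (n : nat) (e : R) : (0 < n)%N -> 0 < e -> e < (2 * n%:R)^-1 ->
  exists2 i, inradius (hersch_teeth n e) = i%:E & 1 / 2 <= i <= (1 + e ^+ 2) / 2.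
Proof.
move=> n1 e0 en; have u := inradius_teeth n1 e0 en.
have lo : ((1 / 2)%:E <= inradius (hersch_teeth n e))%E.
  by apply: (le_trans (@inradius_hersch_ge R)); apply: inradius_sub => x; left.
move: u lo; case: (inradius _) => [r|//|//]; rewrite !lee_fin => u lo.
by exists r => //; rewrite lo u.
Qed.

Lemma inradius_hersch_real : exists2 i, inradius H = i%:E & 1 / 2 <= i.
Proof.
have e0 : 0 < 1 / 4 :> R by [].
have e1 : 1 / 4 < (2 * 1%:R)^-1 :> R by rewrite mulr1 -[ltRHS]div1r; lra.
have [i hi /andP[_ _]] := inradius_teeth_real (ltnSn 0) e0 e1.
have : (inradius H <= inradius (hersch_teeth 1 (1 / 4)))%E by apply: inradius_sub => x; left.
have := @inradius_hersch_ge R; rewrite hi; case: (inradius H) => [r|//|//]; rewrite lee_fin => ? _.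
by exists r.
Qed.

(** To first order the inradius bound multiplies rho by 1 + 2 e^2, so reaching the factor 1 - e^2
    takes an eigenvalue drop of at least 3 l e^2. The choice 4 l also absorbs the higher orders, and
    no error term is left for e < e0. *)
Lemma teeth_rho_drop : exists n : nat, (0 < n)%N /\ exists2 e0 : R, 0 < e0 & forall e, 0 < e -> e < e0 ->
  e < (2 * n%:R)^-1 -> (rho (hersch_teeth n e) <= (1 - e ^+ 2)%:E * rho H)%E.
Proof.
have [l lH /andP[l14 lp]] := lambda1_hersch_fin R.
have l0 : 0 < l by lra.
have [N [N1 [e0 e00 he]]] := lambda1_teeth_drop (4 * l) lH l0 lp.
exists (100 * N)%N; split; first by rewrite muln_gt0.
exists e0 => // e e_gt0 ee0 en.
have [l' lA l'le] := he e e_gt0 ee0.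
have n1 : (0 < 100 * N)%N by rewrite muln_gt0.
have [i iA /andP[i1 i2]] := inradius_teeth_real n1 e_gt0 en.
have [j jH j1] := inradius_hersch_real.
rewrite (rho_real iA lA) (rho_real jH lH) -EFinM lee_fin.
have l'0 : 0 <= l' by rewrite -lee_fin -lA lambda1_ge0.
have s0 : 0 < e ^+ 2 by rewrite exprn_gt0.
have eh := e_half n1 en.
have s1 : e ^+ 2 <= 1 / 4 by nra.
move: (e ^+ 2) i2 l'le s0 s1 => s i2 l'le s0 s1.
have h1 : i * i <= (1 + s) / 2 * ((1 + s) / 2) by apply: ler_pM => //; lra.
have h2 : 1 / 2 * (1 / 2) <= j * j by apply: ler_pM.
have h3 : i * i * l' <= (1 + s) / 2 * ((1 + s) / 2) * (l - 4 * l * s).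
  by apply: ler_pM => //; rewrite mulr_ge0 //; lra.
have h4 : (1 - s) * (1 / 2 * (1 / 2) * l) <= (1 - s) * (j * j * l).
  by apply: ler_wpM2l; [lra|apply: ler_wpM2r => //; exact: ltW].
apply: (le_trans h3); apply: le_trans h4.
have sl : 0 <= s * l by rewrite mulr_ge0 // ltW.
rewrite -subr_ge0.
have -> : (1 - s) * (1 / 2 * (1 / 2) * l) - (1 + s) / 2 * ((1 + s) / 2) * (l - 4 * l * s) =
  s * l * (1 + 7 * s + 4 * s ^+ 2) / 4 by field.
by rewrite divr_ge0 // mulr_ge0 //; have := sqr_ge0 s; lra.
Qed.

End Final.

Theorem mainTheorem13 (R : realType) :
  (exists n0 : nat, (1 <= n0)%N /\
     exists g : R -> R,
       (fun eps => g eps / eps ^+ 2) @ (0 : R)^'+ --> (0 : R) /\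
       (forall eps : R, 0 < eps -> eps < (2 * n0%:R)^-1 ->
          (rho (hersch_teeth n0 eps) <=
             (1 - eps ^+ 2)%:E * rho (@hersch R) + (g eps)%:E)%E)) /\
  (@C_MH R < rho (@hersch R))%E.
Proof.
have [n [n1 [e0 e00 he]]] := teeth_rho_drop R.
have [l lH /andP[l14 lp]] := lambda1_hersch_fin R.
have [j jH j1] := inradius_hersch_real R.
have rH : rho (@hersch R) = (j * j * l)%:E := rho_real jH lH.
have r0 : 0 < j * j * l by rewrite !mulr_gt0 //; lra.
have inv0 : 0 < (2 * n%:R)^-1 :> R by rewrite invr_gt0 mulr_gt0 // ltr0n.
split.
  exists n; split => //.
  (* Below e0 the bound holds without error, so g is 0 there and the limit at 0 is trivial. Beyond
     e0 the toothed pipe's own rho suffices, because (1 - e^2) times rho of the pipe is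
     nonnegative. *)
  exists (fun e => if e < e0 then 0 else fine (rho (hersch_teeth n e))); split.
    apply: cvg_near_cst; near=> e.
    have -> : (e < e0) = true by near: e; exact: nbhs_right_lt.
    by rewrite mul0r.
  move=> e e_gt0 en; case: ifPn => h; first by rewrite adde0; exact: he.
  have [i iA _] := inradius_teeth_real n1 e_gt0 en.
  have [l' lA] : exists l', lambda1 (hersch_teeth n e) = l'%:E.
    have : (lambda1 (hersch_teeth n e) <= lambda1 (@hersch R))%E by apply: lambda1_sub => x; left.
    have := lambda1_ge0 (hersch_teeth n e); rewrite lH; case: (lambda1 _) => [r|//|//] _ _; by exists r.
  rewrite (rho_real iA lA) rH -EFinM -EFinD lee_fin /= lerDr mulr_ge0 ?(ltW r0) //.
  by have := e_half n1 en; nra.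
pose e := Num.min (e0 / 2) ((2 * n%:R)^-1 / 2).
have e_gt0 : 0 < e by rewrite lt_min !divr_gt0.
have ee0 : e < e0 by rewrite gt_min; apply/orP; left; lra.
have en : e < (2 * n%:R)^-1 by rewrite gt_min; apply/orP; right; lra.
have [i iA _] := inradius_teeth_real n1 e_gt0 en.
apply: (@le_lt_trans _ _ (rho (hersch_teeth n e))).
  apply: ereal_inf_lbound; exists (hersch_teeth n e) => //; split; first exact: teeth_open n1 en.
  by split; [exact: teeth_simply_connected (e_half n1 en)|rewrite iA ltry].
apply: (le_lt_trans (he e e_gt0 ee0 en)); rewrite rH -EFinM lte_fin gtr_pMl //.
by rewrite gtrBl exprn_gt0.
Unshelve. all: by end_near.
Qed.
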